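(* Let $a_0>a_1$. For $t>0$ the (generalised) density functions $p_i^j(x,t)=\mathbb P\{\mathbb T(t)\in dx,\ \varepsilon(t)=j\mid\varepsilon(0)=i\}/dx$, $i,j\in\{0,1\}$, of the joint distribution of $\mathbb T(t)$ and $\varepsilon(t)$ are given by $$p_0^0(x,t)=e^{-\lambda_0t}\delta(x-a_0t)+\frac{\sqrt{\lambda_0\lambda_1}}{a_0-a_1}\sqrt{\frac{\xi}{t-\xi}}\;e^{-\lambda_0\xi-\lambda_1(t-\xi)}I_1\bigl(2\sqrt{\lambda_0\lambda_1\xi(t-\xi)}\bigr)\mathbf 1_{\{0<\xi<t\}},$$ $$p_1^1(x,t)=e^{-\lambda_1t}\delta(x-a_1t)+\frac{\sqrt{\lambda_0\lambda_1}}{a_0-a_1}\sqrt{\frac{t-\xi}{\xi}}\;e^{-\lambda_0\xi-\lambda_1(t-\xi)}I_1\bigl(2\sqrt{\lambda_0\lambda_1\xi(t-\xi)}\bigr)\mathbf 1_{\{0<\xi<t\}},$$ $$p_0^1(x,t)=\frac{\lambda_0}{a_0-a_1}\,e^{-\lambda_0\xi-\lambda_1(t-\xi)}I_0\bigl(2\sqrt{\lambda_0\lambda_1\xi(t-\xi)}\bigr)\mathbf 1_{\{0<\xi<t\}},$$ $$p_1^0(x,t)=\frac{\lambda_1}{a_0-a_1}\,e^{-\lambda_0\xi-\lambda_1(t-\xi)}I_0\bigl(2\sqrt{\lambda_0\lambda_1\xi(t-\xi)}\bigr)\mathbf 1_{\{0<\xi<t\}},$$ where $\xi=(x-a_1t)/(a_0-a_1)$,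 so that $t-\xi=(a_0t-x)/(a_0-a_1)$ and $0<\xi<t$ means $a_1t<x<a_0t$; $\delta$ is Dirac's delta function, and $I_0,I_1$ are the modified Bessel functions $$I_0(z)=1+\sum_{n=1}^\infty\frac{(z/2)^{2n}}{(n!)^2},\qquad I_1(z)=I_0'(z)=\sum_{n=1}^\infty\frac{(z/2)^{2n-1}}{(n-1)!\,n!}.$$
   Context: Let $\varepsilon=\varepsilon(t)\in\{0,1\}$, $t\ge0$, be a time-homogeneous two-state Markov process with positive switching intensities $\lambda_0,\lambda_1$: $\mathbb P\{\varepsilon(t+dt)=i\mid\varepsilon(t)=i\}=1-\lambda_i\,dt+o(dt)$, $dt\to 0$. The (integrated) telegraph process with velocities $a_0,a_1\in\mathbb R$ is $\mathbb T(t)=\int_0^ta_{\varepsilon(s)}\,ds$. ''Generalised density'' means that the distribution is the measure consisting of the stated atom (delta term) plus the stated absolutely continuous part. *)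

(* Defs.v *)
From HB Require Import structures.
From mathcomp Require Import all_boot all_order all_algebra.
From mathcomp Require Import all_classical all_reals all_analysis.
From mathcomp Require Import ring.
Import Order.TTheory GRing.Theory Num.Theory.
Import numFieldNormedType.Exports.

Set Implicit Arguments.
Unset Strict Implicit.
Unset Printing Implicit Defensive.

Local Open Scope classical_set_scope.
Local Open Scope ring_scope.

Section Bessel.
Context {R : realType}.
Implicit Types z : R.

Definition besselI0 z : R :=
  1 + limn (fun N => \sum_(1 <= n < N) (z / 2) ^+ (2 * n) / n`!%:R ^+ 2).

Definition besselI1 z : R :=
  limn (fun N =>
    \sum_(1 <= n < N) (z / 2) ^+ (2 * n - 1) / (n.-1`!%:R * n`!%:R)).

End Bessel.

Section BesselDerivative.
Context {R : realType}.
Implicit Types z : R.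

(* Taylor coefficients of besselI0 at 0. *)
Let c (m : nat) : R := (~~ odd m)%:R / (2 ^+ m * (m./2)`!%:R ^+ 2).

Let c_even n : c n.*2 = (2 ^+ n.*2 * n`!%:R ^+ 2)^-1.
Proof. by rewrite /c odd_double doubleK mul1r. Qed.

Let c_odd n : c n.*2.+1 = 0.
Proof. by rewrite /c /= odd_double mul0r. Qed.

Let c_ge0 m : 0 <= c m.
Proof. by rewrite divr_ge0// mulr_ge0// exprn_ge0. Qed.

Let c_le m : c m <= (m`!%:R)^-1.
Proof.
rewrite -(odd_double_half m); case: (odd m) => /=.
  by rewrite add1n c_odd invr_ge0.
rewrite add0n c_even; set n := m./2.
rewrite -!natrX -natrM lef_pV2 ?posrE ?ltr0n ?muln_gt0 ?expn_gt0 ?fact_gt0//.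
rewrite ler_nat.
have := @bin_fact n.*2 n; rewrite -addnn addnK leq_addr addnn => <- //.
rewrite -mulnn leq_mul// -[2%N]/((1 + 1)%N) expnDn.
have n2 : (n < n.*2.+1)%N by rewrite ltnS -addnn leq_addr.
by rewrite (bigD1 (Ordinal n2))//= !exp1n !muln1 leq_addr.
Qed.

Let dc_le m : `|pseries_diffs c m| <= (m`!%:R)^-1.
Proof.
rewrite /pseries_diffs ger0_norm ?mulr_ge0//.
apply: (le_trans (ler_wpM2l _ (c_le _))) => //.
by rewrite factS natrM invfM mulVKf.
Qed.

Let ddc_le m : `|pseries_diffs (pseries_diffs c) m| <= (m`!%:R)^-1.
Proof.
rewrite /pseries_diffs -/(pseries_diffs c m.+1) normrM ger0_norm//.
apply: (le_trans (ler_wpM2l _ (dc_le _))) => //.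
by rewrite factS natrM invfM mulVKf.
Qed.

Let cvg_le (f : nat -> R) z :
  (forall m, `|f m| <= (m`!%:R)^-1) -> cvgn (pseries f z).
Proof.
move=> fle; apply: normed_cvg.
apply: series_le_cvg; last exact: (is_cvg_series_exp_coeff `|z|).
- by move=> n; rewrite normr_ge0.
- by move=> n; rewrite divr_ge0// exprn_ge0.
- move=> n /=; rewrite /exp_coeff /= normrM normrX mulrC.
  by rewrite ler_wpM2l ?exprn_ge0.
Qed.

Let cvg_double : (fun n => n.*2) @ \oo --> \oo.
Proof.
apply/cvgnyPge => A; near=> n.
rewrite (@leq_trans n)//; last by rewrite -addnn leq_addr.
by near: n; exact: nbhs_infty_ge.
Unshelve. all: by end_near. Qed.

Let cvg_doubleS : (fun n => n.+1.*2) @ \oo --> \oo.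
Proof. by rewrite (@cvg_shiftS _ (fun n => n.*2)). Qed.

Let besselI0E : besselI0 = fun z => limn (pseries c z).
Proof.
apply/funext => z; rewrite /besselI0.
have cz : cvgn (pseries c z) by apply: cvg_le => m; rewrite ger0_norm.
suff h : (fun N => \sum_(1 <= n < N) (z / 2) ^+ (2 * n) / n`!%:R ^+ 2)
    @ \oo --> limn (pseries c z) - 1.
  by rewrite (cvg_lim _ h)// addrC subrK.
rewrite -cvg_shiftS.
have -> : (fun N => \sum_(1 <= n < N.+1) (z / 2) ^+ (2 * n) / n`!%:R ^+ 2) =
    (fun N => pseries c z N.+1.*2 - 1).
  apply/funext; elim=> [|N IHN].
    rewrite big_geq// /pseries/= /series/= !big_nat_recr// big_geq//=.
    rewrite -[1%N]/(0.*2.+1) c_odd -[0%N]/(0.*2) c_even.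
    by rewrite double0 !expr0 mul0r fact0; field.
  rewrite big_nat_recr//= IHN /pseries/= /series/= doubleS !big_nat_recr//=.
  rewrite -doubleS [LHS]addrAC (c_odd N.+1) (c_even N.+1) mul0r addr0.
  congr (_ + _ - 1).
  rewrite mul2n expr_div_n; move: (2 ^+ _) (z ^+ _) (_ ^+ 2) => p q r.
  by rewrite invfM -mulrA [LHS]mulrC.
by apply: cvgB; [exact: (cvg_comp _ _ cvg_doubleS cz)|exact: cvg_cst].
Qed.

Let besselI1E z : besselI1 z = limn (pseries (pseries_diffs c) z).
Proof.
rewrite /besselI1.
have cz : cvgn (pseries (pseries_diffs c) z) by exact: cvg_le.
apply: cvg_lim => //; rewrite -cvg_shiftS.
have -> : (fun N => \sum_(1 <= n < N.+1)
      (z / 2) ^+ (2 * n - 1) / (n.-1`!%:R * n`!%:R)) =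
    (fun N => pseries (pseries_diffs c) z N.*2).
  apply/funext; elim=> [|N IHN].
    by rewrite double0 /pseries/= /series/= !big_geq.
  rewrite big_nat_recr//= IHN /pseries/= /series/= doubleS !big_nat_recr//=.
  rewrite -addrA; congr (_ + _).
  rewrite /pseries_diffs c_odd -doubleS c_even mulr0 mul0r add0r.
  have -> : (2 * N.+1 - 1 = N.*2.+1)%N by rewrite mul2n doubleS subn1.
  rewrite doubleS expr_div_n factS natrM (exprS 2 N.*2.+1).
  have -> : (N.*2.+2)%:R = 2 * N.+1%:R :> R by rewrite -doubleS -mul2n natrM.
  have : N`!%:R != 0 :> R by rewrite pnatr_eq0 -lt0n fact_gt0.
  have : N.+1%:R != 0 :> R by rewrite pnatr_eq0.
  have : 2 ^+ N.*2.+1 != 0 :> R by rewrite expf_neq0// pnatr_eq0.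
  move: (2 ^+ _) (N.+1%:R) (N`!%:R) (z ^+ _) => p q r s p0 q0 r0.
  by field; rewrite p0 q0 r0.
exact: (cvg_comp _ _ cvg_double cz).
Qed.

Lemma is_derive_besselI0 z : is_derive z 1 besselI0 (besselI1 z).
Proof.
rewrite besselI0E besselI1E; apply: (@pseries_snd_diffs _ _ (`|z| + 1)).
- by apply: cvg_le => m; rewrite ger0_norm.
- exact: cvg_le.
- exact: cvg_le.
- by rewrite [ltRHS]ger0_norm ?addr_ge0// ltrDl.
Qed.

End BesselDerivative.

Section TwoStateProcess.
Context {d : measure_display} {Omega : measurableType d} {R : realType}.

(* P(A | B); every use below assumes 0 < P B *)
Definition cond_prob (P : probability Omega R) (A B : set Omega) : R :=
  fine (P (A `&` B)) / fine (P B).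

(* A process with values in {0, 1} is a family eps t w of booleans, false
   standing for 0 and true for 1; only its values at times t >= 0 are used. *)
Implicit Types eps : R -> Omega -> bool.

Definition at_state eps (t : R) (i : bool) : set Omega :=
  [set w | eps t w = i].

(* Needed for the time integral of the process to be a random variable; it
   holds in particular when the paths are right-continuous. *)
Definition measurable_process eps : Prop :=
  measurable_fun ([set z | 0 <= z.1] : set (measurableTypeR R * Omega))
    (fun z => eps z.1 z.2).

Definition past eps (s : R) : set_system Omega :=
  <<s [set A | exists u k, 0 <= u <= s /\ A = at_state eps u k] >>.

Definition markov_property (P : probability Omega R) eps : Prop :=
  forall (s h : R) (A : set Omega) (i j : bool),
    0 <= s -> 0 <= h -> past eps s A ->
    (0 < P (A `&` at_state eps s i))%E ->
    cond_prob P (at_state eps (s + h) j) (A `&` at_state eps s i) =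
    cond_prob P (at_state eps (s + h) j) (at_state eps s i).

Definition time_homogeneous (P : probability Omega R) eps : Prop :=
  forall (s s' h : R) (i j : bool),
    0 <= s -> 0 <= s' -> 0 <= h ->
    (0 < P (at_state eps s i))%E -> (0 < P (at_state eps s' i))%E ->
    cond_prob P (at_state eps (s + h) j) (at_state eps s i) =
    cond_prob P (at_state eps (s' + h) j) (at_state eps s' i).

Definition switching_intensity (P : probability Omega R) eps
    (i : bool) (lam : R) : Prop :=
  forall t : R, 0 <= t -> (0 < P (at_state eps t i))%E ->
    (fun h : R => cond_prob P (at_state eps (t + h) i) (at_state eps t i)) =
    (fun h : R => 1 - lam * h) +o_ (0^'+) (fun h : R => h).

Definition telegraph (a0 a1 : R) eps (t : R) (w : Omega) : R :=
  \int[lebesgue_measure]_(s in `[0, t]) (if eps s w then a1 else a0).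

(* The measure B |-> P(T(t) \in B, eps(t) = j | eps(0) = i). *)
Definition joint_law (P : probability Omega R) (a0 a1 : R) eps
    (t : R) (i j : bool) (B : set R) : R :=
  cond_prob P (telegraph a0 a1 eps t @^-1` B `&` at_state eps t j)
              (at_state eps 0 i).

End TwoStateProcess.

(* Main.v *)
Require Import Defs.
From HB Require Import structures.
From mathcomp Require Import all_boot all_order all_algebra.
From mathcomp Require Import all_classical all_reals all_analysis.
From mathcomp Require Import measurable_realfun.
From mathcomp Require Import ring lra zify.
Import Order.TTheory GRing.Theory Num.Theory.
Import numFieldNormedType.Exports.

(** Let [b] be the initial state, [b'] the other one, and [X_t] the time spent
    in [b] up to [t]. The displacement is the affine function
    [a_b' t + (a_b - a_b') X_t] of [X_t] ([telegraph_affine]), so it is enough to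
    find the law of [X_t] on each of the two events given by [eps(t)]. In terms of
    [X_t] these laws carry the four densities of the theorem: an atom at [t] plus
    [density_same] when [eps(t) = b], and [density_other] when [eps(t) = b'].

    Since [0 <= X_t <= t], such a law is determined by its moments, even when they
    are tilted by a fixed exponential ([eq_measure_of_moments], from the uniform
    approximation of Lipschitz functions by Bernstein polynomials). Take
    [r = lam_b - lam_b'] and
<<
      w_(k,j)(t) = exp (lam_b' t) E[exp (r X_t) X_t^k / k!; eps(0) = b, eps(t) = j].
>>
    With this tilt and this prefactor, the forward Kolmogorov equation for
    functions of [X_t] ([uderiv_expect_at]) turns into the triangular system
<<
      w_(k,b)'  = w_(k-1,b) + lam_b' w_(k,b'),      w_(k,b')' = lam_b w_(k,b),
>>
    whose solution is an explicit power series in [t] ([taylor_remainder],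
    [cvg_moment_same], [cvg_moment_other]); the terms of index [n] belong to the
    paths with [2 n], respectively [2 n + 1], switches. On the analytic side, the
    Bessel series can be integrated term by term against the same functions, each
    term being a beta integral, and this gives the same power series
    ([moment_density_same], [moment_density_other]); the atom supplies the term
    [n = 0] of the first one, where no switch has occurred.

    The forward equation uses the Markov property at time [s] for events that
    involve [X_s]. These are integrals over the past and not events of the form
    [eps(u) = i]; the Markov property is first extended to the moments of [X_s], by
    induction on the exponent ([markov_moment]), and then to its law by moment
    determination again ([markov_sojourn]). *)

Set Implicit Arguments.
Unset Strict Implicit.
Unset Printing Implicit Defensive.

Local Open Scope classical_set_scope.
Local Open Scope ring_scope.

(** * Bernstein polynomials *)

Section Bernstein.
Context {R : realType}.
Implicit Types (f g : nat -> R) (x : R).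

(** De Casteljau's recursion. The value at [x] is the mean of [f] at the number of
    successes in [n] independent trials of success probability [x]. *)
Fixpoint bernstein (n : nat) f : {poly R} :=
  if n is n'.+1 then
    'X * bernstein n' (f \o S) + (1 - 'X) * bernstein n' f
  else (f 0)%:P.

Lemma bernsteinS n f x : (bernstein n.+1 f).[x] =
  x * (bernstein n (f \o S)).[x] + (1 - x) * (bernstein n f).[x].
Proof. by rewrite /= !hornerE. Qed.

Lemma bernstein_lin n f g (a : R) x :
  (bernstein n (fun k => a * f k + g k)).[x] =
  a * (bernstein n f).[x] + (bernstein n g).[x].
Proof.
elim: n f g => [|n IH] f g; first by rewrite /= !hornerC.
by rewrite !bernsteinS (IH (f \o S) (g \o S)) IH; ring.
Qed.

Lemma bernstein_cst n (a : R) x : (bernstein n (fun=> a)).[x] = a.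
Proof.
elim: n => [|n IH]; first by rewrite /= hornerC.
by rewrite bernsteinS [_ \o _](_ : _ = (fun=> a))// IH; ring.
Qed.

Lemma le_bernstein n f g x : 0 <= x <= 1 -> (forall k, f k <= g k) ->
  (bernstein n f).[x] <= (bernstein n g).[x].
Proof.
move=> /andP[x0 x1]; elim: n f g => [|n IH] f g fg; first by rewrite /= !hornerC.
rewrite !bernsteinS lerD// ler_wpM2l ?subr_ge0//; first by apply: IH => k /=.
exact: IH.
Qed.

(** The second moment of the number of successes about [a]: its variance is
    [n x (1 - x)], and its mean [n x]. *)
Lemma bernstein_variance n (a x : R) :
  (bernstein n (fun k => (k%:R - a) ^+ 2)).[x] =
  n%:R * x * (1 - x) + (n%:R * x - a) ^+ 2.
Proof.
elim: n a => [|n IH] a; first by rewrite /= hornerC; ring.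
rewrite bernsteinS IH.
have -> : (fun k => (k%:R - a) ^+ 2) \o S = (fun k => (k%:R - (a - 1)) ^+ 2).
  by apply/funext => k /=; rewrite -natr1; congr (_ ^+ 2); ring.
by rewrite IH -natr1; ring.
Qed.

(** Chebyshev's argument: the number of successes over [n] has variance at most
    [1 / n], so the mean of [g] at it is close to [g x]. *)
Lemma lipschitz_poly_approx01 (g : R -> R) (L e : R) : 0 <= L -> 0 < e ->
  (forall x y, 0 <= x <= 1 -> 0 <= y <= 1 -> `|g x - g y| <= L * `|x - y|) ->
  exists p : {poly R}, forall x, 0 <= x <= 1 -> `|g x - p.[x]| <= e.
Proof.
move=> L0 e0 gL.
have L1 : 0 < L + 1 by rewrite ltr_wpDl.
have [s s0 sE] : exists2 s, 0 < s & s = e / (2 * (L + 1)).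
  by exists (e / (2 * (L + 1))); rewrite // divr_gt0// mulr_gt0.
(* The deviation [|k/n - x|] is at most [s + (k/n - x)^2 / s], whose mean is
   at most [2 s] once [n >= s^-2]. *)
pose n := (Num.truncn (s ^- 2)).+1.
have n0 : 0 < n%:R :> R by rewrite ltr0n.
have ns : s ^- 2 <= n%:R by rewrite ltW// truncnS_gt.
(* The recursion evaluates [f] only at [k <= n]; the truncation makes the bound
   on [g] available at every index. *)
pose c (k : nat) : R := Num.min 1 (k%:R / n%:R).
have c01 k : 0 <= c k <= 1.
  by rewrite /c le_min ler01 divr_ge0//= ge_min lexx.
exists (bernstein n (fun k => g (c k))) => x x01.
have dev k : `|g (c k) - g x| <= L * (s + s^-1 * (k%:R / n%:R - x) ^+ 2).
  apply: (le_trans (gL _ _ (c01 k) x01)); rewrite ler_wpM2l//.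
  set u := k%:R / n%:R.
  have cu : `|c k - x| <= `|u - x|.
    rewrite /c -/u; have [u1|u1] := leP 1 u => //.
    move: x01 => /andP[_ x1]; rewrite (@ger0_norm _ (1 - x)) ?subr_ge0//.
    by rewrite (le_trans _ (ler_norm _))// lerD2r.
  apply: (le_trans cu); rewrite -(real_normK (num_real (u - x))).
  set v := `|u - x|; have v0 : 0 <= v by exact: normr_ge0.
  rewrite -(ler_pM2l s0) mulrDr (mulrA s s^-1) divff ?gt_eqF// mul1r.
  by nra.
have devB : forall u : R, u = 1 \/ u = -1 ->
    u * ((bernstein n (fun k => g (c k))).[x] - g x) <= e.
  move=> u u1.
  have -> : u * ((bernstein n (fun k => g (c k))).[x] - g x) =
      (bernstein n (fun k => u * (g (c k)) + - (u * g x))).[x].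
    by rewrite bernstein_lin bernstein_cst; ring.
  apply: (@le_trans _ _ (bernstein n (fun k => (L / s / n%:R ^+ 2) *
      (k%:R - n%:R * x) ^+ 2 + L * s)).[x]).
    apply: le_bernstein => // k.
    have -> : u * g (c k) - u * g x = u * (g (c k) - g x) by ring.
    apply: (@le_trans _ _ `|g (c k) - g x|).
      case: u1 => ->; rewrite ?mul1r ?mulN1r; first exact: ler_norm.
      by rewrite -normrN ler_norm.
    apply: (le_trans (dev k)); rewrite le_eqVlt; apply/orP; left; apply/eqP.
    by field; rewrite gt_eqF//= gt_eqF.
  rewrite bernstein_lin bernstein_cst bernstein_variance subrr expr0n addr0.
  have -> : L / s / n%:R ^+ 2 * (n%:R * x * (1 - x)) + L * s =
      L * (x * (1 - x) / (s * n%:R) + s).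
    by field; rewrite gt_eqF//= gt_eqF.
  have sn : 1 <= s ^+ 2 * n%:R.
    by rewrite -ler_pdivrMl ?exprn_gt0// mulr1.
  have h1 : x * (1 - x) / (s * n%:R) <= s.
    rewrite ler_pdivrMr ?mulr_gt0//.
    move: x01 => /andP[x0 x1]; rewrite mulrA -expr2; apply: le_trans sn; nra.
  apply: (@le_trans _ _ (L * (s + s))).
    by rewrite ler_wpM2l// lerD2r.
  have -> : L * (s + s) = e * (L / (L + 1)).
    by rewrite sE; field; rewrite gt_eqF.
  by rewrite ger_pMr// ler_pdivrMr// mul1r lerDl.
rewrite distrC ler_norml; apply/andP; split.
  have := devB (-1) (or_intror erefl); lra.
have := devB 1 (or_introl erefl); lra.
Qed.

Lemma lipschitz_poly_approx (T : R) (g : R -> R) (L e : R) :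
  0 <= T -> 0 <= L -> 0 < e ->
  (forall x y, 0 <= x <= T -> 0 <= y <= T -> `|g x - g y| <= L * `|x - y|) ->
  exists p : {poly R}, forall x, 0 <= x <= T -> `|g x - p.[x]| <= e.
Proof.
rewrite le_eqVlt => /predU1P[<-|T0] L0 e0 gL.
  exists (g 0)%:P => x; rewrite -eq_le hornerC => /eqP <-.
  by rewrite subrr normr0 ltW.
have scale x : 0 <= x <= 1 -> 0 <= T * x <= T.
  by move=> /andP[x0 x1]; rewrite mulr_ge0 ?(ltW T0)//= ger_pMr.
have [||x y x01 y01|p pP] :=
    @lipschitz_poly_approx01 (fun x => g (T * x)) (L * T) e => //.
- by rewrite mulr_ge0// ltW.
- apply: (le_trans (gL _ _ (scale _ x01) (scale _ y01))).
  by rewrite -mulrBr normrM (ger0_norm (ltW T0)) mulrA.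
exists (p \Po (T^-1 *: 'X)) => x /andP[x0 xT].
rewrite horner_comp !hornerE mulrC.
have := pP (x / T).
rewrite mulrCA mulfV ?gt_eqF// mulr1; apply.
by rewrite divr_ge0//= ?(ltW T0)//= ler_pdivrMr// mul1r.
Qed.

End Bernstein.

(** * Determination of a bounded law by tilted moments *)

Section MomentDetermination.
Context {R : realType}.
Local Notation RR := (measurableTypeR R).

Lemma bounded_integrable d (T : measurableType d) (m : {measure set T -> \bar R})
    (D : set T) (f : T -> R) (M : R) :
  measurable D -> (m D < +oo)%E -> measurable_fun D f ->
  (forall x, D x -> `|f x| <= M) -> m.-integrable D (EFin \o f).
Proof.
move=> mD mDoo mf fM; apply: measurable_bounded_integrable => //.
exists M; split; first exact: num_real.
by move=> M' MM' x Dx; apply: le_trans (fM _ Dx) _; exact: ltW.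
Qed.

Lemma normr_Rintegral_le d (T : measurableType d)
    (m : {measure set T -> \bar R}) (D : set T) (f : T -> R) (M : R) :
  measurable D -> (m D < +oo)%E -> measurable_fun D f ->
  (forall x, D x -> `|f x| <= M) ->
  `|\int[m]_(x in D) f x| <= M * fine (m D).
Proof.
move=> mD mDoo mf fM.
apply: le_trans (le_normr_Rintegral mD (bounded_integrable mD mDoo mf fM)) _.
rewrite -Rintegral_cst//; apply: le_Rintegral => //.
  apply: (@bounded_integrable _ _ _ _ _ M) => //.
    exact: measurableT_comp.
  by move=> x Dx /=; rewrite normr_id fM.
apply: (@bounded_integrable _ _ _ _ _ `|M|) => //.
Qed.

Lemma le_Rintegral_subset d (T : measurableType d)
    (m : {measure set T -> \bar R}) (A B : set T) (f : T -> R) :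
  measurable A -> measurable B -> A `<=` B -> m.-integrable B (EFin \o f) ->
  (forall x, B x -> 0 <= f x) ->
  \int[m]_(x in A) f x <= \int[m]_(x in B) f x.
Proof.
move=> mA mB AB intf f0; have intA := integrableS mB mA AB intf.
rewrite /Rintegral fine_le ?integrable_fin_num//.
apply: ge0_subset_integral => //.
exact: measurable_int intf.
Qed.

Lemma measurable_expRM (r : R) (D : set R) : measurable_fun D (fun x => expR (r * x)).
Proof.
apply: measurableT_comp; first exact: measurable_expR.
by apply: measurable_funM => //; exact: measurable_cst.
Qed.

Lemma expR_dist_le (M a b : R) : a <= M -> b <= M ->
  `|expR a - expR b| <= expR M * `|a - b|.
Proof.
have key u v : u <= M -> v <= u -> expR u - expR v <= expR M * (u - v).
  move=> uM vu.
  have -> : expR u - expR v = expR u * (1 - expR (v - u)).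
    by rewrite mulrBr mulr1 -expRD addrCA subrr addr0.
  have := expR_ge1Dx (v - u) => h.
  apply: (@le_trans _ _ (expR u * (u - v))).
    by rewrite ler_wpM2l ?expR_ge0//; lra.
  by rewrite ler_wpM2r ?subr_ge0// ler_expR.
move=> aM bM; have [ab|/ltW ba] := leP b a.
  rewrite !ger0_norm ?subr_ge0 ?ler_expR//; exact: key.
by rewrite distrC (distrC a) !ger0_norm ?subr_ge0 ?ler_expR//; exact: key.
Qed.

Section Determination.
Variables (T r : R) (m1 m2 : {measure set RR -> \bar R}).
Hypotheses (T0 : 0 <= T) (m1oo : (m1 setT < +oo)%E) (m2oo : (m2 setT < +oo)%E).
Let J : set RR := `[0, T].
Hypotheses (m1J : m1 (~` J) = 0%E) (m2J : m2 (~` J) = 0%E).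
Hypothesis m12 : forall k : nat,
  \int[m1]_(x in J) (expR (r * x) * x ^+ k) =
  \int[m2]_(x in J) (expR (r * x) * x ^+ k).

Let mJ : measurable J. Proof. exact: measurable_itv. Qed.

Let Joo (m : {measure set RR -> \bar R}) : (m setT < +oo)%E -> (m J < +oo)%E.
Proof. by move=> moo; rewrite (le_lt_trans _ moo)// le_measure ?inE. Qed.

Let E := expR (`|r| * T).

Let E_ge x : J x -> expR (r * x) <= E.
Proof.
rewrite /J/= in_itv/= => /andP[x0 xT]; rewrite ler_expR.
by rewrite (@le_trans _ _ (`|r| * x))// ?ler_wpM2r// ?ler_norm// ler_wpM2l.
Qed.

Let poly_bounded (p : {poly R}) : exists M, forall x, J x -> `|p.[x]| <= M.
Proof.
elim/poly_ind: p => [|p c [M pM]]; first by exists 0 => x _; rewrite horner0 normr0.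
exists (M * T + `|c|) => x Jx; rewrite hornerMXaddC (le_trans (ler_normD _ _))//.
rewrite lerD2r normrM ler_pM ?pM//.
by move: Jx; rewrite /J/= in_itv/= => /andP[x0 xT]; rewrite ger0_norm.
Qed.

Let integrable_expRp (m : {measure set RR -> \bar R}) (p : {poly R}) :
  (m setT < +oo)%E -> m.-integrable J (EFin \o (fun x => expR (r * x) * p.[x])).
Proof.
move=> moo; have [M pM] := poly_bounded p.
apply: (@bounded_integrable _ _ _ _ _ (E * M)) => //; first exact: Joo.
  apply: measurable_funM; first exact: measurable_expRM.
  exact: measurable_poly.
move=> x Jx /=; rewrite normrM ler_pM// ?pM// ger0_norm ?expR_ge0//.
exact: E_ge.
Qed.

(* The auxiliary power of ['X] lets the induction peel off one coefficient at a
   time. *)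
Let eq_poly_moment (p : {poly R}) :
  \int[m1]_(x in J) (expR (r * x) * p.[x]) =
  \int[m2]_(x in J) (expR (r * x) * p.[x]).
Proof.
suff : forall k, \int[m1]_(x in J) (expR (r * x) * (p * 'X^k).[x]) =
    \int[m2]_(x in J) (expR (r * x) * (p * 'X^k).[x]).
  by move/(_ 0%N); rewrite expr0 mulr1.
elim/poly_ind: p => [|p c IH] k.
  have zero (m : {measure set RR -> \bar R}) :
      \int[m]_(x in J) (expR (r * x) * (0 * 'X^k : {poly R}).[x]) = 0.
    under eq_Rintegral do rewrite mul0r horner0 mulr0.
    by rewrite Rintegral_cst// mul0r.
  by rewrite !zero.
have splitI (m : {measure set RR -> \bar R}) : (m setT < +oo)%E ->
    \int[m]_(x in J) (expR (r * x) * ((p * 'X + c%:P) * 'X^k).[x]) =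
    \int[m]_(x in J) (expR (r * x) * (p * 'X^(k.+1)).[x]) +
    c * \int[m]_(x in J) (expR (r * x) * ('X^k : {poly R}).[x]).
  move=> moo; rewrite -RintegralZl//; last exact: integrable_expRp.
  rewrite -RintegralD//.
  - have pointwise (y : R) : expR (r * y) * ((p * 'X + c%:P) * 'X^k).[y] =
        expR (r * y) * (p * 'X^(k.+1)).[y] +
        c * (expR (r * y) * ('X^k : {poly R}).[y]).
      by rewrite !(hornerM, hornerD, hornerX, hornerC, hornerXn) exprS; ring.
    by apply: eq_Rintegral => x _; exact: pointwise.
  - exact: integrable_expRp.
  - under eq_fun do rewrite mulrCA -hornerZ.
    exact: integrable_expRp.
rewrite !splitI// IH; congr (_ + c * _).
under eq_Rintegral do rewrite hornerXn.
by rewrite m12; under [in RHS]eq_Rintegral do rewrite hornerXn.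
Qed.

(* A polynomial approximating [exp (- r x) f x] gives, after multiplication by
   [exp (r x)], an approximation of [f] with equal integrals. *)
Let eq_lipschitz_integral (f : R -> R) (L : R) : 0 <= L ->
  measurable_fun setT (f : RR -> R) -> (forall x, `|f x| <= 1) ->
  (forall x y, `|f x - f y| <= L * `|x - y|) ->
  \int[m1]_(x in J) f x = \int[m2]_(x in J) f x.
Proof.
move=> L0 mf f1 fL.
pose g x := expR (- r * x) * f x.
have E0 : 0 < E by exact: expR_gt0.
have gL x y : 0 <= x <= T -> 0 <= y <= T ->
    `|g x - g y| <= (E * `|r| + E * L) * `|x - y|.
  move=> /andP[x0 xT] /andP[y0 yT].
  have e_le z : 0 <= z -> z <= T -> - r * z <= `|r| * T.
    move=> z0 zT; rewrite (@le_trans _ _ (`|r| * z))// ?ler_wpM2l//.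
    by rewrite ler_wpM2r// -normrN ler_norm.
  have -> : g x - g y = (expR (- r * x) - expR (- r * y)) * f x +
      expR (- r * y) * (f x - f y) by rewrite /g; ring.
  rewrite (le_trans (ler_normD _ _))// [leRHS]mulrDl lerD// normrM.
    rewrite -[leRHS]mulr1 ler_pM//.
    apply: le_trans (expR_dist_le (e_le _ x0 xT) (e_le _ y0 yT)) _.
    by rewrite -mulrBr normrM normrN mulrA.
  rewrite -mulrA ler_pM// ger0_norm ?expR_ge0// ler_expR; exact: e_le.
pose C := E * (fine (m1 J) + fine (m2 J)) + 1.
have C0 : 0 < C.
  by rewrite ltr_wpDl// mulr_ge0 ?(ltW E0)// addr_ge0// fine_ge0.
apply/eqP; rewrite -subr_eq0 -normr_le0; apply/ler_addgt0Pr => e e0.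
have eC : 0 < e / C by rewrite divr_gt0.
have [|p pP] := @lipschitz_poly_approx _ T g _ (e / C) T0 _ eC gL.
  by rewrite addr_ge0 ?mulr_ge0// ?ltW.
have dev (m : {measure set RR -> \bar R}) : (m setT < +oo)%E ->
    `|\int[m]_(x in J) f x - \int[m]_(x in J) (expR (r * x) * p.[x])| <=
    E * (e / C) * fine (m J).
  move=> moo; rewrite -RintegralB//; last 2 first.
  - apply: (@bounded_integrable _ _ _ _ _ 1) => //; first exact: Joo.
    exact: measurable_funTS.
  - exact: integrable_expRp.
  apply: normr_Rintegral_le => //; first exact: Joo.
    apply: measurable_funB; first exact: measurable_funTS.
    apply: measurable_funM; first exact: measurable_expRM.
    exact: measurable_poly.
  move=> x Jx.
  have -> : f x - expR (r * x) * p.[x] = expR (r * x) * (g x - p.[x]).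
    by rewrite /g mulrBr mulrA -expRD mulNr subrr expR0 mul1r.
  rewrite normrM ler_pM//; first by rewrite ger0_norm ?expR_ge0// E_ge.
  by apply: pP; move: Jx; rewrite /J/= in_itv.
have -> : \int[m1]_(x in J) f x - \int[m2]_(x in J) f x =
    (\int[m1]_(x in J) f x - \int[m1]_(x in J) (expR (r * x) * p.[x])) -
    (\int[m2]_(x in J) f x - \int[m2]_(x in J) (expR (r * x) * p.[x])).
  by rewrite eq_poly_moment; ring.
rewrite add0r (le_trans (ler_normB _ _))//.
rewrite (le_trans (lerD (dev _ m1oo) (dev _ m2oo)))// -mulrDr.
rewrite mulrAC -[leRHS](@mulfVK _ C) ?gt_eqF// [leRHS]mulrC ler_pM2r//.
by rewrite lerDl.
Qed.

(* A Lipschitz ramp decreasing to the indicator of a half-line. *)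
Let ramp (y : R) (n : nat) (x : R) : R :=
  Num.max 0 (Num.min 1 (1 - n%:R * (x - y))).

Let ramp01 y n x : 0 <= ramp y n x <= 1.
Proof. by rewrite /ramp le_max lexx/= ge_max ler01/= ge_min lexx. Qed.

Let ramp_lipschitz y n x x' : `|ramp y n x - ramp y n x'| <= n%:R * `|x - x'|.
Proof.
have -> : n%:R * `|x - x'| =
    `|(1 - n%:R * (x - y)) - (1 - n%:R * (x' - y))|.
  have -> : (1 - n%:R * (x - y)) - (1 - n%:R * (x' - y)) = n%:R * (x' - x).
    by ring.
  by rewrite normrM normr_nat distrC.
rewrite /ramp; set u := 1 - _; set v := 1 - _.
have [uv|/ltW vu] := leP u v.
  rewrite distrC (distrC u) !ger0_norm ?subr_ge0//; last first.
    by rewrite ge_max le_max lexx/= le_max le_min !ge_min lexx uv !orbT.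
  by rewrite /Num.max /Num.min; do ! case: ifPn; rewrite -?leNgt; lra.
rewrite !ger0_norm ?subr_ge0//; last first.
  by rewrite ge_max le_max lexx/= le_max le_min !ge_min lexx vu !orbT.
by rewrite /Num.max /Num.min; do ! case: ifPn; rewrite -?leNgt; lra.
Qed.

Let measurable_ramp y n : measurable_fun setT (ramp y n : RR -> R).
Proof.
apply: measurable_maxr => //; apply: measurable_minr => //.
by apply: measurable_funB => //; apply: measurable_funM => //; exact: measurable_funB.
Qed.

Let ramp_cvg y x : (ramp y n x)%:E @[n --> \oo] --> (\1_(`]-oo, y] : set R) x)%:E.
Proof.
apply: cvg_near_cst.
have [xy|yx] := leP x y.
  near=> n; rewrite indicE mem_set/= ?in_itv//=; congr EFin.
  by rewrite /ramp min_l ?max_r// lerBrDr gerDl mulr_ge0_le0// subr_le0.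
have -> : (\1_(`]-oo, y] : set R) x) = 0 :> R.
  by rewrite indicE memNset//= in_itv/=; apply/negP; rewrite -ltNge.
near=> n; congr EFin.
rewrite /ramp max_l// ge_min; apply/orP; right.
rewrite subr_le0 -ler_pdivrMr ?subr_gt0//.
by near: n; exact: nbhs_infty_ger.
Unshelve. all: by end_near. Qed.

Let eq_measure_ray (y : R) : m1 (`]-oo, y]%classic) = m2 (`]-oo, y]%classic).
Proof.
have mY : measurable (`]-oo, y]%classic : set RR) by exact: measurable_itv.
have cvgI (m : {measure set RR -> \bar R}) : (m setT < +oo)%E ->
    m (~` J) = 0%E ->
    (\int[m]_(x in J) (ramp y n x)%:E)%E @[n --> \oo] --> m (`]-oo, y]%classic).
  move=> moo m0.
  have -> : m (`]-oo, y]%classic) =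
      (\int[m]_(x in J) (\1_(`]-oo, y] : set R) x)%:E)%E.
    rewrite integral_indic// [LHS](measureDI _ mY mJ).
    rewrite (@subset_measure0 _ _ _ m _ (~` J)) ?add0e//.
      exact: measurableD.
    exact: measurableC.
  have [|||||_ _] := @dominated_convergence _ _ _ m J mJ
    (fun n x => (ramp y n x)%:E) (fun x => (\1_(`]-oo, y] : set R) x)%:E)
    (cst 1%E) => //.
  - move=> n; apply/measurable_EFinP; apply: measurable_funTS.
    exact: measurable_ramp.
  - apply/measurable_EFinP; exact: measurable_indic.
  - by apply: aeW => x _; exact: ramp_cvg.
  - apply: (@bounded_integrable _ _ _ _ (cst 1) 1) => //; first exact: Joo.
    by move=> x _; rewrite normr1.
  - apply: aeW => x n _; have /andP[r0 r1] := ramp01 y n x.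
    by rewrite /= lee_fin ger0_norm.
have h1 := cvgI _ m1oo m1J; have h2 := cvgI _ m2oo m2J.
suff e12 : (fun n => (\int[m1]_(x in J) (ramp y n x)%:E)%E) =
   (fun n => (\int[m2]_(x in J) (ramp y n x)%:E)%E).
  by apply: (cvg_unique (@ereal_hausdorff R) h1); rewrite e12.
apply/funext => n.
have fin (m : {measure set RR -> \bar R}) : (m setT < +oo)%E ->
    (\int[m]_(x in J) (ramp y n x)%:E = (\int[m]_(x in J) ramp y n x)%R%:E)%E.
  move=> moo; rewrite /Rintegral fineK//; apply: integrable_fin_num => //.
  apply: (@bounded_integrable _ _ _ _ _ 1) => //; first exact: Joo.
    by apply: measurable_funTS; exact: measurable_ramp.
  by move=> x _; have /andP[r0 r1] := ramp01 y n x; rewrite ger0_norm.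
rewrite !fin//; congr EFin; apply: (@eq_lipschitz_integral _ n%:R) => //.
- by move=> x; have /andP[r0 r1] := ramp01 y n x; rewrite ger0_norm.
Qed.

(** The half-lines [(-oo, y]] have equal measures, their indicators being
    decreasing limits of Lipschitz functions, and they generate the Borel sets. *)
Lemma eq_measure_of_moments B : measurable B -> m1 B = m2 B.
Proof.
apply: (@measure_unique _ R RR (@ocitv R)
  (fun k => `](- k%:R), k%:R]%classic) _ _ _ _ m1 m2).
- by [].
- exact: ocitvI.
- by move=> k; exact: is_ocitv.
- rewrite -subTset => /= x _ /=.
  exists (Num.truncn `|x|).+1; rewrite //= in_itv/=.
  by have := truncnS_gt `|x|; rewrite ltr_norml => /andP[-> /ltW ->].
- move=> _ [[a b] _ <-] /=.
  have [ab|ba] := leP a b; last first.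
    by rewrite set_itv_ge ?measure0//= bnd_simp -leNgt ltW.
  have -> : `]a, b]%classic = `]-oo, b]%classic `\` `]-oo, a]%classic :> set R.
    apply/seteqP; split=> x /=; rewrite !in_itv/=.
      by move=> /andP[ax xb]; split=> //; apply/negP; rewrite -ltNge.
    by move=> [xb /negP]; rewrite -ltNge => ->.
  have mray c : measurable (`]-oo, c]%classic : set RR) by exact: measurable_itv.
  have ray_oo (m : {measure set RR -> \bar R}) : (m setT < +oo)%E ->
      (m (`]-oo, b]%classic) < +oo)%E.
    by move=> moo; rewrite (le_lt_trans _ moo)// le_measure ?inE.
  rewrite !measureD ?ray_oo// setIidr//; last 1 first.
  - move=> x /=.
    by rewrite !in_itv/= => /le_trans; apply.
  by congr (_ - _)%E; exact: eq_measure_ray.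
- by move=> k; rewrite (le_lt_trans _ m1oo)// le_measure ?inE//; exact: is_ocitv.
Qed.

End Determination.
End MomentDetermination.

(** * Occupation times of a measurable process *)

Section Occupation.
Context {d : measure_display} {Omega : measurableType d} {R : realType}.
Variables (P : probability Omega R) (eps : R -> Omega -> bool).
Hypothesis meps : measurable_process eps.
Local Notation RR := (measurableTypeR R).
Local Notation mu := (@lebesgue_measure R).

(** Times are restricted to be nonnegative: measurability of the process says
    nothing about negative ones. *)
Definition graph_at_state (b : bool) : set (RR * Omega) :=
  [set z | 0 <= z.1 /\ eps z.1 z.2 = b].

Lemma measurable_graph_at_state b : measurable (graph_at_state b).
Proof.
have mD : measurable ([set z | 0 <= z.1] : set (RR * Omega)).
  rewrite [X in measurable X](_ : _ = setT `&` (fst @^-1` `[0, +oo[%classic)).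
    by apply: measurable_fst => //; exact: measurable_itv.
  by rewrite setTI; apply/seteqP; split=> z /=; rewrite in_itv/= andbT.
rewrite (_ : graph_at_state b =
  [set z | 0 <= z.1] `&` (fun z => eps z.1 z.2) @^-1` [set b])//.
exact: meps.
Qed.

Lemma measurable_at_state t b : 0 <= t -> measurable (at_state eps t b).
Proof.
move=> t0.
have := measurable_xsection (t : RR) (measurable_graph_at_state b).
congr measurable; apply/seteqP; split=> w; rewrite /xsection/= inE /at_state/=.
  by move=> [].
by move=> e; split.
Qed.

Lemma measurable_time_at_state (I : set RR) w b :
  measurable I -> (forall u, I u -> 0 <= u) ->
  measurable (I `&` [set u | eps u w = b]).
Proof.
move=> mI I0.
have := measurableI _ _ mI (measurable_ysection w (measurable_graph_at_state b)).
congr measurable; apply/seteqP; split=> u; rewrite /ysection/= inE /at_state/=.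
  by move=> [Iu []].
by move=> [Iu]; split => //; split => //; exact: I0.
Qed.

Definition occupation (b : bool) (I : set R) (w : Omega) : R :=
  \int[mu]_(u in I) (eps u w == b)%:R.

Lemma measurable_indicator_state (I : set RR) w b :
  measurable I -> (forall u, I u -> 0 <= u) ->
  measurable_fun I (fun u : RR => (eps u w == b)%:R : R).
Proof.
move=> mI I0.
apply: (eq_measurable_fun (\1_(I `&` [set u | eps u w = b]) : RR -> R)).
  move=> u /[!inE] Iu; rewrite indicE; congr (nat_of_bool _)%:R.
  apply/idP/eqP => [|e]; first by rewrite inE => -[].
  by rewrite inE.
by apply: measurable_indic; exact: measurable_time_at_state.
Qed.

Lemma integrable_indicator_state (I : set RR) w b :
  measurable I -> (mu I < +oo)%E -> (forall u, I u -> 0 <= u) ->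
  mu.-integrable I (EFin \o (fun u : RR => (eps u w == b)%:R : R)).
Proof.
move=> mI Ioo I0; apply: (@bounded_integrable _ _ _ _ _ _ 1) => //.
  exact: measurable_indicator_state.
by move=> u _; rewrite normr_nat; case: (_ == _).
Qed.

Lemma EFin_occupation (I : set RR) w b :
  measurable I -> (mu I < +oo)%E -> (forall u, I u -> 0 <= u) ->
  (occupation b I w)%:E = (\int[mu]_(u in I) ((eps u w == b)%:R)%:E)%E.
Proof.
move=> mI Ioo I0; rewrite /occupation /Rintegral fineK//.
by apply: integrable_fin_num => //; exact: integrable_indicator_state.
Qed.

Lemma occupation_bounds (I : set RR) w b :
  measurable I -> (mu I < +oo)%E -> (forall u, I u -> 0 <= u) ->
  0 <= occupation b I w <= fine (mu I).
Proof.
move=> mI Ioo I0; apply/andP; split; first exact: Rintegral_ge0.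
rewrite -[leRHS]mul1r -Rintegral_cst//; apply: le_Rintegral => //.
- exact: integrable_indicator_state.
- by apply: (@bounded_integrable _ _ _ _ _ _ 1) => // u _; rewrite normr1.
- by move=> u _; case: (_ == _).
Qed.

(** Tonelli: weighting by the occupation time of a state amounts to
    integrating over time the restriction to the event of being in it. *)
Lemma integral_occupation (I : set RR) (A : set Omega) (Y : Omega -> R) b :
  measurable I -> (mu I < +oo)%E -> (forall u, I u -> 0 <= u) ->
  measurable A -> measurable_fun setT Y -> (forall w, 0 <= Y w) ->
  (\int[P]_(w in A) (Y w * occupation b I w)%:E =
   \int[mu]_(u in I) \int[P]_(w in A `&` at_state eps u b) (Y w)%:E)%E.
Proof.
move=> mI Ioo I0 mA mY Y0.
pose S := graph_at_state b `&` (I `*` A).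
have mS : measurable S.
  by apply: measurableI; [exact: measurable_graph_at_state|exact: measurableX].
pose f (z : RR * Omega) := (\1_S z * Y z.2)%:E.
have mf : measurable_fun setT f.
  apply/measurable_EFinP; apply: measurable_funM; first exact: measurable_indic.
  by apply: measurableT_comp => //; exact: measurable_snd.
have f0 z : (0 <= f z)%E by rewrite lee_fin mulr_ge0.
transitivity (\int[P]_w \int[mu]_u f (u, w))%E.
  rewrite [LHS]integral_mkcond; apply: eq_integral => w _.
  rewrite patchE; case: ifPn => wA; last first.
    rewrite [RHS]integral0_eq// => u _; rewrite /f indicE memNset ?mul0r//=.
    by move=> [_ [_ Aw]]; rewrite notin_setE in wA.
  have Zl : (\int[mu]_(u in I) ((Y w)%:E * ((eps u w == b)%:R)%:E) =
      (Y w)%:E * \int[mu]_(u in I) ((eps u w == b)%:R)%:E)%E.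
    rewrite ge0_integralZl ?lee_fin//.
    exact: measurable_int (integrable_indicator_state w b mI Ioo I0).
  rewrite EFinM EFin_occupation// -Zl.
  rewrite [LHS]integral_mkcond; apply: eq_integral => u _.
  rewrite patchE; case: ifPn => uI; last first.
    rewrite /f indicE memNset ?mul0r//=.
    by move=> [_ [Iu _]]; rewrite notin_setE in uI.
  rewrite /f indicE -EFinM mulrC; congr (_ * _)%:E; congr (nat_of_bool _)%:R.
  rewrite inE in wA; rewrite inE in uI.
  apply/eqP/idP => [e|]; last by rewrite inE => -[[]].
  by rewrite inE; split => //; split => //; exact: I0.
rewrite -(@fubini_tonelli _ _ _ _ _ mu P f)// [RHS]integral_mkcond.
apply: eq_integral => u _; rewrite patchE; case: ifPn => uI; last first.
  rewrite [LHS]integral0_eq// => w _; rewrite /f indicE memNset ?mul0r//=.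
  by move=> [_ [Iu _]]; rewrite notin_setE in uI.
rewrite [RHS]integral_mkcond; apply: eq_integral => w _.
rewrite inE in uI; rewrite patchE /f indicE; case: ifPn => [|wA].
  by rewrite inE => -[Aw e]; rewrite mem_set ?mul1r//; split=> //; split => //; exact: I0.
rewrite memNset ?mul0r//= => -[[_ e] [_ Aw]].
by move: wA; rewrite notin_setE; apply.
Qed.

Lemma measurable_occupation (I : set RR) b :
  measurable I -> (mu I < +oo)%E -> (forall u, I u -> 0 <= u) ->
  measurable_fun setT (occupation b I).
Proof.
move=> mI Ioo I0; apply/measurable_EFinP.
pose S := graph_at_state b `&` (I `*` setT).
have mS : measurable S.
  by apply: measurableI; [exact: measurable_graph_at_state|exact: measurableX].
apply: (eq_measurable_fun
    (fun w => (\int[mu]_u (\1_S (u, w) : R)%:E)%E)) => [w _|].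
  rewrite /= EFin_occupation// [RHS]integral_mkcond; apply: eq_integral => u _.
  rewrite patchE indicE; case: ifPn => uI; last first.
    by rewrite memNset//= => -[_ [Iu _]]; rewrite notin_setE in uI.
  rewrite inE in uI; congr (nat_of_bool _)%:R%:E.
  apply/idP/eqP => [|e]; first by rewrite inE => -[[]].
  by rewrite inE; split => //; split => //; exact: I0.
apply: (@measurable_fun_fubini_tonelli_G _ _ _ _ _ mu
  (fun z => (\1_S z : R)%:E)) => [|z]; last by rewrite lee_fin.
by apply/measurable_EFinP; exact: measurable_indic.
Qed.

Definition sojourn b t := occupation b `[0, t].

Let mitv (a c : R) : measurable (`[a, c]%classic : set RR).
Proof. exact: measurable_itv. Qed.

Let itv_oo (a c : R) : (mu `[a, c]%classic < +oo)%E.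
Proof. by rewrite lebesgue_measure_itv/=; case: ifP => _; rewrite ltry. Qed.

Let mu_itv (a c : R) : a <= c -> fine (mu `[a, c]%classic) = c - a.
Proof.
rewrite le_eqVlt => /orP[/eqP ->|ac]; rewrite lebesgue_measure_itv/= lte_fin.
  by rewrite ltxx subrr.
by rewrite ac.
Qed.

Let itv_ge0 (a c : R) : 0 <= a -> forall u, (`[a, c]%classic : set R) u -> 0 <= u.
Proof. by move=> a0 u /=; rewrite in_itv/= => /andP[/(le_trans a0)]. Qed.

Lemma measurable_sojourn b t : measurable_fun setT (sojourn b t).
Proof. by apply: measurable_occupation => //; exact: itv_ge0. Qed.

Lemma sojourn_bounds b t w : 0 <= t -> 0 <= sojourn b t w <= t.
Proof.
move=> t0; have := @occupation_bounds `[0, t]%classic w b (mitv _ _) (itv_oo _ _).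
by rewrite mu_itv// subr0; apply; exact: itv_ge0.
Qed.

Lemma sojournD b t h w : 0 <= t -> 0 <= h ->
  sojourn b (t + h) w = sojourn b t w + occupation b `[t, t + h] w.
Proof.
move=> t0 h0; pose f (u : RR) : R := (eps u w == b)%:R.
have intf : mu.-integrable `[0, t + h] (EFin \o f).
  by apply: integrable_indicator_state => //; exact: itv_ge0.
have := @Rintegral_itvB _ f (BLeft 0) (BRight (t + h)) t intf.
rewrite !bnd_simp t0 lerDl h0 => /(_ isT isT) e.
have int1 : mu.-integrable `]t, t + h] (EFin \o f).
  apply: integrableS intf => //.
  by apply: subset_itvr; rewrite bnd_simp.
have := etrans e (@Rintegral_itv_obnd_cbnd _ t (BRight (t + h)) f int1).
by move/eqP; rewrite subr_eq => /eqP e1; rewrite [RHS]addrC; exact: e1.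
Qed.

Lemma occupationC b t h w : 0 <= t -> 0 <= h ->
  occupation (~~ b) `[t, t + h] w = h - occupation b `[t, t + h] w.
Proof.
move=> t0 h0.
have hE : h = \int[mu]_(u in `[t, t + h]) 1.
  by rewrite Rintegral_cst// mu_itv ?lerDl// mul1r addrC addKr.
rewrite [X in X - _]hE /occupation -RintegralB//.
- by apply: eq_Rintegral => u _; case: (eps u w) b => -[] /=; rewrite ?subrr ?subr0.
- by apply: (@bounded_integrable _ _ _ _ _ _ 1 (mitv _ _) (itv_oo _ _)) => // u _;
    rewrite normr1.
- by apply: integrable_indicator_state => //; exact: itv_ge0.
Qed.

End Occupation.

(** * Laws on an event and transition probabilities *)

Section Law.
Context {d : measure_display} {T : measurableType d} {R : realType}.
Local Notation RR := (measurableTypeR R).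
Variables (m : {measure set T -> \bar R}) (D : set T) (mD : measurable D).
Variables (X : T -> RR) (mX : measurable_fun setT X).

(** Not normalised: its total mass is [m D]. *)
Definition law : {measure set RR -> \bar R}.
Proof. by refine (pushforward (mrestr m mD) X : {measure set _ -> \bar R}). Defined.

Lemma lawE (C : set R) : law C = m (X @^-1` C `&` D).
Proof. by []. Qed.

Hypothesis mDoo : (m D < +oo)%E.

Lemma law_lty : (law setT < +oo)%E.
Proof. by rewrite lawE preimage_setT setTI. Qed.

Lemma Rintegral_law (J : set RR) (f : RR -> R) (M : R) :
  measurable J -> (forall w, J (X w)) ->
  measurable_fun setT f -> (forall x, J x -> `|f x| <= M) ->
  \int[law]_(x in J) f x = \int[m]_(w in D) f (X w).
Proof.
move=> mJ XJ mf fM; congr fine.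
have mfX : measurable_fun setT (f \o X) by exact: measurableT_comp.
have XJT : X @^-1` J = setT by apply/seteqP; split=> // w _; exact: XJ.
have int : (mrestr m mD).-integrable setT (EFin \o (f \o X)).
  apply: (@bounded_integrable _ _ _ _ _ _ M) => //; last by move=> w _; exact: fM.
  by rewrite /= /mrestr setTI.
transitivity (\int[mrestr m mD]_w (f (X w))%:E)%E.
  rewrite -XJT -[RHS]/(\int[mrestr m mD]_(x in _) ((EFin \o f) \o X) x)%E.
  rewrite -integral_pushforward//; last by rewrite XJT.
  exact/measurable_EFinP.
rewrite [LHS](negligible_integral (measurableC mD))//; last first.
  by rewrite /= /mrestr setICl measure0.
rewrite setTD setCK; apply: eq_measure_integral => A mA AD.
by rewrite /= /mrestr setIidl.
Qed.

End Law.

Lemma Rintegral_mscale d (T : measurableType d) (R : realType)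
    (m : {measure set T -> \bar R}) (k : {nonneg R}) (D : set T) (f : T -> R) :
  measurable D -> m.-integrable D (EFin \o f) ->
  \int[mscale k m]_(x in D) f x = k%:num * \int[m]_(x in D) f x.
Proof.
move=> mD intf; have mf := measurable_int _ intf.
have pfin := integrable_pos_fin_num mD intf.
have nfin := integrable_neg_fin_num mD intf.
rewrite /Rintegral integralE [in RHS]integralE !ge0_integral_mscale//.
- by rewrite -(fineK pfin) -(fineK nfin) -!EFinM -!EFinB /= mulrBr.
- exact: measurable_funeneg.
- exact: measurable_funepos.
Qed.

Section Markov.
Context {d : measure_display} {Omega : measurableType d} {R : realType}.
Variables (P : probability Omega R) (eps : R -> Omega -> bool) (lam : bool -> R).
Hypothesis meps : measurable_process eps.
Hypothesis markov : markov_property P eps.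
Hypothesis homogeneous : time_homogeneous P eps.
Hypothesis intensity : forall i, switching_intensity P eps i (lam i).
Hypothesis lam_gt0 : forall i, 0 < lam i.
Local Notation RR := (measurableTypeR R).
Local Notation mu := (@lebesgue_measure R).

Let mstate t b : 0 <= t -> measurable (at_state eps t b).
Proof. exact: measurable_at_state. Qed.

Lemma past_measurable s A : past eps s A -> measurable A.
Proof.
apply: smallest_sub; first exact: sigma_algebra_measurable.
by move=> _ [u [k [/andP[u0 _] ->]]]; exact: mstate.
Qed.

Lemma past_at_state s u k : 0 <= u <= s -> past eps s (at_state eps u k).
Proof. by move=> us; apply: sub_sigma_algebra; exists u, k. Qed.

Lemma pastI s A B : past eps s A -> past eps s B -> past eps s (A `&` B).
Proof.
set G := [set A | exists u k, 0 <= u <= s /\ A = at_state eps u k].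
exact: (@measurableI _ (g_sigma_algebraType G)).
Qed.

Lemma at_stateC t b : at_state eps t (~~ b) = ~` at_state eps t b.
Proof.
by apply/seteqP; split=> w; rewrite /at_state /=; case: (eps t w) b => -[].
Qed.

Lemma measure_split_state A t b : measurable A -> 0 <= t ->
  P A = (P (A `&` at_state eps t b) + P (A `&` at_state eps t (~~ b)))%E.
Proof.
move=> mA t0; rewrite (measureDI P mA (mstate b t0)) addeC; congr (_ + P _)%E.
by rewrite at_stateC setDE.
Qed.

(** [p l j h] is the probability of being in [j] at a time [h] after [l]. The
    last clause is the Markov property without division, so that it also covers
    null events. *)
Definition transition (p : bool -> bool -> R -> R) : Prop :=
  [/\ forall l j h, 0 <= h -> 0 <= p l j h,
      forall l h, 0 <= h -> p l l h + p l (~~ l) h = 1,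
      forall l e, 0 < e -> exists2 dl, 0 < dl &
        forall h, 0 < h < dl -> `|p l l h - (1 - lam l * h)| <= e * h &
      forall s h A l j, 0 <= s -> 0 <= h -> past eps s A ->
        P (A `&` at_state eps s l `&` at_state eps (s + h) j) =
        ((p l j h)%:E * P (A `&` at_state eps s l))%E].

(* The part of [transition] that concerns one starting state [l]. *)
Let transition_from (l : bool) (q : bool -> R -> R) : Prop :=
  [/\ forall j h, 0 <= h -> 0 <= q j h,
      forall h, 0 <= h -> q l h + q (~~ l) h = 1,
      forall e, 0 < e -> exists2 dl, 0 < dl &
        forall h, 0 < h < dl -> `|q l h - (1 - lam l * h)| <= e * h &
      forall s h A j, 0 <= s -> 0 <= h -> past eps s A ->
        P (A `&` at_state eps s l `&` at_state eps (s + h) j) =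
        ((q j h)%:E * P (A `&` at_state eps s l))%E].

Let fineK_P A : measurable A -> (fine (P A))%:E = P A.
Proof. by move=> mA; rewrite fineK// fin_num_measure. Qed.

Let fine_gt0 A : measurable A -> (0 < P A)%E -> 0 < fine (P A).
Proof. by move=> mA; rewrite -[P A]fineK_P. Qed.

Let cond_probK A B : measurable A -> measurable B -> (0 < P B)%E ->
  ((cond_prob P A B)%:E * P B = P (A `&` B))%E.
Proof.
move=> mA mB B0; rewrite -[P B]fineK_P// -EFinM /cond_prob mulfVK ?fineK_P//.
  exact: measurableI.
by rewrite gt_eqF// fine_gt0.
Qed.

Let transition_from_visited l s0 : 0 <= s0 -> (0 < P (at_state eps s0 l))%E ->
  transition_from l
    (fun j h => cond_prob P (at_state eps (s0 + h) j) (at_state eps s0 l)).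
Proof.
move=> s00 Ps0; set q := fun _ _ => _; split.
- by move=> j h h0; rewrite divr_ge0// fine_ge0.
- move=> h h0; rewrite /q /cond_prob -mulrDl -fineD ?fin_num_measure//;
    [|apply: measurableI; apply: mstate => //; exact: addr_ge0..].
  rewrite [X in fine X](_ : _ = P (at_state eps s0 l)).
    by rewrite divff// gt_eqF// fine_gt0//; exact: mstate.
  have := @measure_split_state _ (s0 + h) l (mstate l s00) (addr_ge0 s00 h0).
  by rewrite !(setIC (at_state eps s0 l)) => ->.
- move=> e e0; have /eqaddoP/(_ e e0) := intensity s00 Ps0.
  rewrite near_simpl => -[dl /= dl0 H]; exists dl => // h /andP[h0 hdl].
  have := H h; rewrite /= sub0r normrN gtr0_norm// => /(_ hdl h0); exact.
move=> s h A j s_ge0 h0 pA.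
have sh0 : 0 <= s + h by exact: addr_ge0.
have mA := past_measurable pA.
have mAl : measurable (A `&` at_state eps s l).
  by apply: measurableI => //; exact: mstate.
have [PA|PA] := leP (P (A `&` at_state eps s l)) 0.
  have PA0 : P (A `&` at_state eps s l) = 0%E by apply/eqP; rewrite eq_le PA measure_ge0.
  rewrite PA0 mule0; apply/eqP; rewrite eq_le measure_ge0 andbT -PA0.
  exact: measureIl mAl (mstate j sh0).
have Ps : (0 < P (at_state eps s l))%E.
  apply: (lt_le_trans PA); apply: le_measure; rewrite ?inE//; exact: mstate.
rewrite setIC -cond_probK//; last exact: mstate.
by congr (_%:E * _)%E; rewrite markov// (homogeneous j s_ge0 s00).
Qed.

(* A state that is never visited can be given any transition law. *)
Let transition_from_unvisited l :
  ~ (exists2 s0, 0 <= s0 & (0 < P (at_state eps s0 l))%E) ->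
  exists q, transition_from l q.
Proof.
move=> unvisited.
pose m (h : R) := Num.max 0 (1 - lam l * h).
exists (fun j h => if j == l then m h else 1 - m h); split.
- move=> j h h0; case: ifP => _; first by rewrite le_max lexx.
  rewrite subr_ge0 ge_max ler01/= gerBl mulr_ge0//; exact/ltW.
- move=> h h0; have -> : (~~ l == l) = false by case: (l).
  by rewrite eqxx addrC subrK.
- move=> e e0; exists (lam l)^-1; first by rewrite invr_gt0.
  move=> h /andP[h0 hl]; rewrite eqxx /m max_r.
    by rewrite subrr normr0 mulr_ge0// ltW.
  by rewrite subr_ge0 mulrC -ler_pdivlMr// div1r ltW.
move=> s h A j s0 h0 pA.
have P0 : P (at_state eps s l) = 0%E.
  apply/eqP; rewrite eq_le measure_ge0 andbT leNgt; apply/negP => H.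
  by apply: unvisited; exists s.
have zero B : measurable B -> B `<=` at_state eps s l -> P B = 0%E.
  by move=> mB Bs; apply: (subset_measure0 mB _ Bs P0); exact: mstate.
have mA := past_measurable pA.
have mAl : measurable (A `&` at_state eps s l).
  by apply: measurableI => //; exact: mstate.
have zA : P (A `&` at_state eps s l) = 0%E by apply: zero => // w [].
rewrite zA mule0 zero//; first last.
  by move=> w [[]].
by apply: measurableI => //; apply: mstate; exact: addr_ge0.
Qed.

(** Homogeneity allows reading the probabilities off at any time at which the
    starting state has positive probability. *)
Lemma transition_exists : exists p, transition p.
Proof.
have H l : exists q, transition_from l q.
  have [[s0 s00 Ps0]|] := pselect (exists2 s0, 0 <= s0 & (0 < P (at_state eps s0 l))%E).
    by eexists; exact: transition_from_visited s00 Ps0.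
  exact: transition_from_unvisited.
have [q0 [q01 q02 q03 q04]] := H false.
have [q1 [q11 q12 q13 q14]] := H true.
exists (fun l => if l then q1 else q0); split; [by case..|].
by move=> s h A [] j; [exact: q14|exact: q04].
Qed.

End Markov.

(** * The Markov property for sojourn times *)

Section SojournMarkov.
Context {d : measure_display} {Omega : measurableType d} {R : realType}.
Variables (P : probability Omega R) (eps : R -> Omega -> bool) (lam : bool -> R).
Hypothesis meps : measurable_process eps.
Variable p : bool -> bool -> R -> R.
Hypothesis ptrans : transition P eps lam p.
Variable b : bool.
Local Notation RR := (measurableTypeR R).
Local Notation mu := (@lebesgue_measure R).
Local Notation X := (sojourn eps b).

Let mX t : measurable_fun setT (X t : Omega -> RR).
Proof. exact: measurable_sojourn. Qed.

Let mstate t i : 0 <= t -> measurable (at_state eps t i).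
Proof. exact: measurable_at_state. Qed.

Let X_ge0 s w : 0 <= s -> 0 <= X s w.
Proof. by move=> s0; have /andP[] := sojourn_bounds meps b w s0. Qed.

(** A power of the sojourn time integrates over time, by Tonelli, the lower
    power restricted to the event of being in [b]; that event can be merged
    into the past, which gives an induction on the exponent. *)
Lemma markov_moment k s h A l j : 0 <= s -> 0 <= h -> past eps s A ->
  (\int[P]_(w in A `&` at_state eps s l `&` at_state eps (s + h) j)
     (X s w ^+ k)%:E =
   (p l j h)%:E * \int[P]_(w in A `&` at_state eps s l) (X s w ^+ k)%:E)%E.
Proof.
move=> s0 h0; have [p0 _ _ pM] := ptrans.
have mAl B : past eps s B -> measurable (B `&` at_state eps s l).
  by move=> pB; apply: measurableI (past_measurable meps pB) (mstate l s0).
have mAlj B : past eps s B ->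
    measurable (B `&` at_state eps s l `&` at_state eps (s + h) j).
  by move=> pB; apply: measurableI (mAl _ pB) (mstate j (addr_ge0 s0 h0)).
elim: k A => [|k IH] A pA.
  rewrite !(eq_integral (cst 1%E)); try by move=> w _; rewrite expr0.
  by rewrite (integral_cst P (mAlj _ pA)) (integral_cst P (mAl _ pA)) !mul1e; exact: pM.
have mY : measurable_fun setT (fun w => X s w ^+ k).
  exact: (measurable_funX k (mX s)).
have Y0 w : 0 <= X s w ^+ k by rewrite exprn_ge0// X_ge0.
have mu_oo : (mu `[0%R, s]%classic < +oo)%E.
  by rewrite lebesgue_measure_itv/=; case: ifP => _; rewrite ltry.
have s_ge0 u : (`[0%R, s]%classic : set RR) u -> 0 <= u.
  by rewrite /= in_itv/= => /andP[].
have ms : measurable (`[0%R, s]%classic : set RR) by exact: measurable_itv.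
have p0' : (0 <= (p l j h)%:E)%E by rewrite lee_fin p0.
rewrite -ge0_integralZl//; last 3 first.
- exact: mAl.
- apply/measurable_EFinP; apply: measurable_funTS; exact: (measurable_funX k.+1 (mX s)).
- by move=> w _; rewrite lee_fin exprn_ge0// X_ge0.
transitivity (\int[P]_(w in A `&` at_state eps s l)
    ((p l j h * X s w ^+ k) * X s w)%:E)%E; last first.
  by apply: eq_integral => w _; rewrite -EFinM exprSr mulrA.
under eq_integral do rewrite exprSr.
rewrite (integral_occupation P meps b ms mu_oo s_ge0 (mAlj _ pA) mY Y0).
rewrite (integral_occupation P meps b ms mu_oo s_ge0 (mAl _ pA)); last 2 first.
- by apply: measurable_funM => //; exact: measurable_cst.
- by move=> w; rewrite mulr_ge0// p0.
apply: eq_integral => u /[!inE]/=; rewrite in_itv/= => us.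
have pAu := pastI pA (past_at_state b us).
have -> : A `&` at_state eps s l `&` at_state eps (s + h) j `&` at_state eps u b =
    (A `&` at_state eps u b) `&` at_state eps s l `&` at_state eps (s + h) j.
  by rewrite (setIAC _ _ (at_state eps u b)) (setIAC A).
have -> : A `&` at_state eps s l `&` at_state eps u b =
    (A `&` at_state eps u b) `&` at_state eps s l by rewrite setIAC.
rewrite IH//; under [in RHS]eq_integral do rewrite EFinM.
rewrite ge0_integralZl//; first exact: mAl.
  by apply/measurable_EFinP; apply: measurable_funTS.
by move=> w _; rewrite lee_fin.
Qed.

Let P_fin D : measurable D -> (P D < +oo)%E.
Proof. by move=> mD; rewrite ltey_eq fin_num_measure. Qed.

(** The Markov property at time [s] holds for the sojourn time up to [s], whose
    conditional laws are determined by their moments. *)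
Lemma markov_sojourn (f : RR -> R) (M : R) s h A l j :
  0 <= s -> 0 <= h -> past eps s A ->
  measurable_fun setT f -> (forall x, 0 <= x <= s -> `|f x| <= M) ->
  \int[P]_(w in A `&` at_state eps s l `&` at_state eps (s + h) j) f (X s w) =
  p l j h * \int[P]_(w in A `&` at_state eps s l) f (X s w).
Proof.
move=> s0 h0 pA mf fM; have [p0 _ _ _] := ptrans.
have mAl : measurable (A `&` at_state eps s l).
  by apply: measurableI (past_measurable meps pA) (mstate l s0).
have mAlj : measurable (A `&` at_state eps s l `&` at_state eps (s + h) j).
  by apply: measurableI mAl (mstate j (addr_ge0 s0 h0)).
pose J : set RR := `[0, s]%classic.
have mJ : measurable J by exact: measurable_itv.
have XJ w : J (X s w) by rewrite /J/= in_itv/= sojourn_bounds.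
have XJC : X s @^-1` (~` J) = set0.
  by apply/seteqP; split=> // w /=; apply; exact: XJ.
have fM' x : J x -> `|f x| <= M by rewrite /J/= in_itv/=; exact: fM.
(* Both sides integrate [f] for measures on [[0, s]] with the same moments. *)
pose m1 := law P mAlj (mX s).
pose m2 : {measure set RR -> \bar R} :=
  mscale (NngNum (p0 l j h h0)) (law P mAl (mX s)).
have lawAl_oo : (law P mAl (mX s) J < +oo)%E.
  apply: le_lt_trans _ (law_lty mAl (mX s) (P_fin mAl)).
  by apply: le_measure; rewrite ?inE.
have m2E (g : RR -> R) N : measurable_fun setT g ->
    (forall x, J x -> `|g x| <= N) ->
    \int[m2]_(x in J) g x = p l j h * \int[P]_(w in A `&` at_state eps s l) g (X s w).
  move=> mg gN; rewrite /m2 Rintegral_mscale//.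
    by rewrite (Rintegral_law mAl (mX s) (P_fin mAl) mJ XJ mg gN).
  by apply: (@bounded_integrable _ _ _ _ _ _ N) => //; exact: measurable_funTS.
have m12 C : measurable C -> m1 C = m2 C.
  apply: (@eq_measure_of_moments _ s 0) => //.
  - have := law_lty mAlj (mX s) (P_fin mAlj). exact.
  - by rewrite /m2/= /mscale/= lte_mul_pinfty ?lee_fin ?p0// (law_lty mAl (mX s) (P_fin mAl)).
  - by rewrite /m1 lawE -/J XJC set0I measure0.
  - have lawJC : law P mAl (mX s) (~` J) = 0%E by rewrite lawE XJC set0I measure0.
    rewrite (_ : m2 _ = ((p l j h)%:E * law P mAl (mX s) (~` J))%E)//.
    by rewrite lawJC mule0.
  move=> k; under eq_Rintegral do rewrite mul0r expR0 mul1r.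
  under [RHS]eq_Rintegral do rewrite mul0r expR0 mul1r.
  have mexp : measurable_fun setT (fun x : RR => x ^+ k : R).
    exact: measurable_funX.
  have bexp x : J x -> `|x ^+ k| <= s ^+ k.
    rewrite /J/= in_itv/= => /andP[x0 xs].
    by rewrite normrX ger0_norm// lerXn2r ?nnegrE// (le_trans x0).
  rewrite (m2E _ _ mexp bexp) (Rintegral_law mAlj (mX s) (P_fin mAlj) mJ XJ mexp bexp).
  rewrite /Rintegral markov_moment// fineM//.
  apply: integrable_fin_num => //.
  apply: (@bounded_integrable _ _ _ _ _ _ (s ^+ k)) => //; first exact: P_fin.
    by apply: measurable_funTS; exact: (measurable_funX k (mX s)).
  by move=> w _; apply: bexp; exact: XJ.
rewrite -(m2E _ _ mf fM') -(Rintegral_law mAlj (mX s) (P_fin mAlj) mJ XJ mf fM').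
by congr fine; apply: eq_measure_integral => C mC _; exact: m12.
Qed.

End SojournMarkov.

(** * Uniform right derivatives *)

Section Monomial.
Context {R : realType}.
Local Notation RR := (measurableTypeR R).

(** With this normalisation the derivative of a monomial is the previous one, the
    derivative of the one of index 0 being 0. *)
Definition monomial (n : nat) (x : R) : R := x ^+ n / n`!%:R.

Definition monomial_pred (n : nat) (x : R) : R :=
  if n is m.+1 then monomial m x else 0.

Lemma monomial_ge0 n (x : R) : 0 <= x -> 0 <= monomial n x.
Proof. by move=> x0; rewrite divr_ge0// exprn_ge0. Qed.

Lemma measurable_monomial n : measurable_fun setT (monomial n : RR -> R).
Proof. by apply: measurable_funM; [exact: measurable_funX|exact: measurable_cst]. Qed.

Lemma monomialM n k (x : R) : monomial n x * monomial k x =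
  'C(n + k, k)%:R * monomial (n + k) x.
Proof.
have fn : n`!%:R != 0 :> R by rewrite pnatr_eq0 -lt0n fact_gt0.
have fk : k`!%:R != 0 :> R by rewrite pnatr_eq0 -lt0n fact_gt0.
have fnk : (n + k)`!%:R != 0 :> R by rewrite pnatr_eq0 -lt0n fact_gt0.
have : 'C(n + k, k)%:R * (k`!%:R * n`!%:R) = (n + k)`!%:R :> R.
  by rewrite -!natrM -(bin_fact (leq_addl n k)) addnK.
rewrite /monomial exprD => E.
have -> : 'C(n + k, k)%:R = (n + k)`!%:R / (k`!%:R * n`!%:R) :> R.
  by rewrite -E mulfK// mulf_neq0.
by field; rewrite fn fk fnk.
Qed.

Lemma monomial_le_expR k (x : R) : 0 <= x -> monomial k x <= expR x.
Proof.
move=> x0; case: k => [|k].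
  rewrite /monomial expr0 fact0 divr1; apply: le_trans (expR_ge1Dx x).
  by rewrite lerDl.
by apply: le_trans (expR_ge1Dxn k x0); rewrite lerDr.
Qed.

End Monomial.

Section UniformDerivative.
Context {R : realType}.
Variable T : R.
Implicit Types f g : R -> R.

(** On [[0, T]], [f] has right difference quotients converging uniformly to the
    bounded function [f']. This is the form in which the Kolmogorov equations
    come out of the process: the error of a time step [h] is [o(h)], uniformly in
    the time at which the step starts. *)
Definition uderiv f f' : Prop :=
  (exists B, forall x, 0 <= x <= T -> `|f x| <= B /\ `|f' x| <= B) /\
  (forall e, 0 < e -> exists2 dl, 0 < dl & forall x h,
     0 <= x -> x + h <= T -> 0 < h < dl -> `|f (x + h) - f x - h * f' x| <= e * h).

Lemma uderiv_ext f f' g g' : (forall x, 0 <= x <= T -> f x = g x) ->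
  (forall x, 0 <= x <= T -> f' x = g' x) -> uderiv f f' -> uderiv g g'.
Proof.
move=> fg fg' [[B fB] df]; split.
  by exists B => x xT; rewrite -fg// -fg'//; exact: fB.
move=> e /df[dl dl0 H]; exists dl => // x h x0 xhT hdl.
have /andP[h0 _] := hdl.
by rewrite -!fg -?fg' ?H//; apply/andP; split => //; lra.
Qed.

Lemma uderiv_lip f f' : uderiv f f' -> exists2 B, 0 <= B & exists2 dl, 0 < dl &
  forall x h, 0 <= x -> x + h <= T -> 0 < h < dl -> `|f (x + h) - f x| <= B * h.
Proof.
move=> [[B fB] /(_ 1 ltr01)[dl dl0 H]]; exists (`|B| + 1); first by rewrite addr_ge0.
exists dl => // x h x0 xhT hdl; have /andP[h0 _] := hdl.
have := H x h x0 xhT hdl.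
have [_] : `|f x| <= B /\ `|f' x| <= B by apply: fB; apply/andP; split=> //; lra.
set D := f (x + h) - f x => f'B DB.
have -> : D = (D - h * f' x) + h * f' x by ring.
rewrite (le_trans (ler_normD _ _))// mulrDl addrC lerD//.
rewrite normrM gtr0_norm// mulrC ler_wpM2r ?(ltW h0)//.
exact: le_trans f'B (ler_norm _).
Qed.

Lemma uderiv_cst (c : R) : uderiv (fun=> c) (fun=> 0).
Proof.
split; first by exists `|c| => x _; rewrite normr0.
move=> e e0; exists 1 => // x h _ _ /andP[h0 _].
by rewrite mulr0 !subr0 subrr normr0 mulr_ge0// ltW.
Qed.

Lemma uderiv_id : uderiv (fun x => x) (fun=> 1).
Proof.
split.
  exists (`|T| + 1) => x /andP[x0 xT]; rewrite normr1 lerDr; split => //.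
  by rewrite ger0_norm// (le_trans xT)// (le_trans (ler_norm _))// lerDl.
move=> e e0; exists 1 => // x h _ _ /andP[h0 _].
rewrite (_ : x + h - x - h * 1 = 0); last by ring.
by rewrite normr0 mulr_ge0// ltW.
Qed.

Lemma uderivD f f' g g' : uderiv f f' -> uderiv g g' ->
  uderiv (fun x => f x + g x) (fun x => f' x + g' x).
Proof.
move=> [[B fB] df] [[C gC] dg]; split.
  exists (B + C) => x xT; have [f1 f2] := fB _ xT; have [g1 g2] := gC _ xT.
  by split; rewrite (le_trans (ler_normD _ _))// lerD.
move=> e e0; have e2 : 0 < e / 2 by rewrite divr_gt0.
have [d1 d10 H1] := df _ e2; have [d2 d20 H2] := dg _ e2.
exists (Num.min d1 d2); first by rewrite lt_min d10.
move=> x h x0 xh /andP[h0]; rewrite lt_min => /andP[h1 h2].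
have {}H1 := H1 x h x0 xh; have {}H2 := H2 x h x0 xh.
rewrite h0 h1 in H1; rewrite h0 h2 in H2.
have -> : f (x + h) + g (x + h) - (f x + g x) - h * (f' x + g' x) =
  (f (x + h) - f x - h * f' x) + (g (x + h) - g x - h * g' x) by ring.
rewrite (le_trans (ler_normD _ _))//.
by rewrite (le_trans (lerD (H1 isT) (H2 isT)))//; lra.
Qed.

Lemma uderivM f f' g g' : uderiv f f' -> uderiv g g' ->
  uderiv (fun x => f x * g x) (fun x => f' x * g x + f x * g' x).
Proof.
move=> Uf Ug; have [L L0 [d3 d30 H3]] := uderiv_lip Uf.
have [M M0 [d4 d40 H4]] := uderiv_lip Ug.
have [[B0 fB0] df] := Uf; have [[C0 gC0] dg] := Ug.
pose B := `|B0| + `|C0| + 1.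
have B1 : 1 <= B by rewrite lerDr addr_ge0.
have fB x : 0 <= x <= T -> [/\ `|f x| <= B, `|f' x| <= B, `|g x| <= B & `|g' x| <= B].
  move=> xT; have [f1 f2] := fB0 _ xT; have [g1 g2] := gC0 _ xT.
  have := ler_norm B0; have := ler_norm C0.
  by split; rewrite /B; have := normr_ge0 B0; have := normr_ge0 C0; lra.
split.
  exists (B * B + B * B) => x /fB[f1 f2 g1 g2]; split.
    by rewrite normrM (le_trans (ler_pM _ _ f1 g1))// lerDl mulr_ge0//; lra.
  by rewrite (le_trans (ler_normD _ _))// !normrM lerD// ler_pM.
move=> e e0.
have e3 : 0 < e / (3 * B) by rewrite divr_gt0// mulr_gt0//; lra.
have LM : 0 < 3 * (L * M + 1).
  by rewrite mulr_gt0// ltr_wpDl// mulr_ge0.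
have [d1 d10 H1] := df _ e3; have [d2 d20 H2] := dg _ e3.
exists (Num.min (Num.min d1 d2) (Num.min (Num.min d3 d4) (e / (3 * (L * M + 1))))).
  by rewrite !lt_min d10 d20 d30 d40 divr_gt0.
move=> x h x0 xh /andP[h0]; rewrite !lt_min => /andP[/andP[h1 h2] /andP[/andP[h3 h4] h5]].
have := H1 x h x0 xh; rewrite h0 h1 => /(_ isT) {}H1.
have := H2 x h x0 xh; rewrite h0 h2 => /(_ isT) {}H2.
have := H3 x h x0 xh; rewrite h0 h3 => /(_ isT) {}H3.
have := H4 x h x0 xh; rewrite h0 h4 => /(_ isT) {}H4.
have [|f1 f2 g1 g2] := fB x; first by apply/andP; split => //; lra.
set Df := f (x + h) - f x in H1 H3; set Dg := g (x + h) - g x in H2 H4.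
have -> : f (x + h) * g (x + h) - f x * g x - h * (f' x * g x + f x * g' x) =
  (Df - h * f' x) * g x + f x * (Dg - h * g' x) + Df * Dg.
  by rewrite /Df /Dg; ring.
have t1 : `|(Df - h * f' x) * g x| <= e / 3 * h.
  rewrite normrM (le_trans (ler_pM _ _ H1 g1))// le_eqVlt; apply/orP; left.
  by apply/eqP; field; rewrite gt_eqF//; lra.
have t2 : `|f x * (Dg - h * g' x)| <= e / 3 * h.
  rewrite normrM (le_trans (ler_pM _ _ f1 H2))// le_eqVlt; apply/orP; left.
  by apply/eqP; field; rewrite gt_eqF//; lra.
have t3 : `|Df * Dg| <= e / 3 * h.
  rewrite normrM (le_trans (ler_pM _ _ H3 H4))// mulrACA mulrA ler_wpM2r ?ltW//.
  have : h * (3 * (L * M + 1)) < e by rewrite -ltr_pdivlMr.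
  have : 0 <= L * M by rewrite mulr_ge0.
  nra.
rewrite (le_trans (ler_normD _ _))//.
have := le_trans (ler_normD _ _) (lerD t1 t2); lra.
Qed.

Lemma uderivZ (a : R) f f' : uderiv f f' ->
  uderiv (fun x => a * f x) (fun x => a * f' x).
Proof.
move=> /(uderivM (uderiv_cst a)); apply: uderiv_ext => // x _.
by rewrite mul0r add0r.
Qed.

Lemma uderiv_sum (n : nat) (f f' : nat -> R -> R) :
  (forall i, uderiv (f i) (f' i)) ->
  uderiv (fun x => \sum_(i < n) f i x) (fun x => \sum_(i < n) f' i x).
Proof.
move=> ff'; elim: n => [|n IH].
  by apply: uderiv_ext (uderiv_cst 0) => x _; rewrite big_ord0.
by apply: uderiv_ext (uderivD IH (ff' n)) => x _; rewrite big_ord_recr.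
Qed.

Lemma uderiv_expR (a : R) : uderiv (fun x => expR (a * x)) (fun x => a * expR (a * x)).
Proof.
have [T0|T0] := ltP T 0.
  split; first by exists 0 => x /andP[x0 xT]; lra.
  by move=> e e0; exists 1 => // x h x0 xh /andP[h0 _]; lra.
pose E := expR (`|a| * T).
have E0 : 0 < E by exact: expR_gt0.
have eE x : 0 <= x <= T -> expR (a * x) <= E.
  move=> /andP[x0 xT]; rewrite ler_expR (@le_trans _ _ (`|a| * x))//.
    by rewrite ler_wpM2r// ler_norm.
  by rewrite ler_wpM2l.
split.
  exists ((`|a| + 1) * E) => x xT; split.
    rewrite ger0_norm ?expR_ge0// (le_trans (eE _ xT))// ler_peMl ?(ltW E0)//.
    by rewrite lerDr.
  rewrite normrM (ger0_norm (expR_ge0 _)) ler_pM ?expR_ge0 ?lerDl//.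
  exact: eE.
move=> e e0.
have a1 : 0 < `|a| + 1 by rewrite ltr_wpDl.
have D0 : 0 < 2 * E * (`|a| + 1) ^+ 2 by rewrite !mulr_gt0// exprn_gt0.
exists (Num.min (e / (2 * E * (`|a| + 1) ^+ 2)) (1 / (2 * (`|a| + 1)))).
  by rewrite lt_min !divr_gt0// mulr_gt0.
move=> x h x0 xh /andP[h0]; rewrite lt_min => /andP[h1 h2].
have -> : expR (a * (x + h)) - expR (a * x) - h * (a * expR (a * x)) =
    expR (a * x) * (expR (a * h) - 1 - a * h).
  by rewrite mulrDr expRD; ring.
have ah : `|a * h| <= 1 / 2.
  rewrite normrM (gtr0_norm h0).
  move: h2; rewrite ltr_pdivlMr ?mulr_gt0// => h2.
  by have := normr_ge0 a; nra.
have key : `|expR (a * h) - 1 - a * h| <= 2 * (a * h) ^+ 2.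
  set u := a * h in ah *.
  have := expR_ge1Dx u; have := expR_ge1Dx (- u).
  rewrite expRN => l1 l2; move: ah; rewrite ler_norml => /andP[u1 u2].
  rewrite ger0_norm; last by lra.
  have E1 := expR_gt0 u.
  have : expR u * (1 - u) <= 1.
    by rewrite -ler_pdivlMl// mulr1.
  nra.
rewrite normrM ger0_norm ?expR_ge0//.
apply: (@le_trans _ _ (E * (2 * (a * h) ^+ 2))).
  by rewrite ler_pM ?expR_ge0//; apply: eE; apply/andP; split => //; lra.
have : h * (2 * E * (`|a| + 1) ^+ 2) < e by rewrite -ltr_pdivlMr.
have a2 : a ^+ 2 <= (`|a| + 1) ^+ 2.
  rewrite -(real_normK (num_real a)) lerXn2r ?nnegrE ?lerDl// ltW//.
move=> he; have -> : E * (2 * (a * h) ^+ 2) = (h * (2 * E * a ^+ 2)) * h by ring.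
rewrite ler_wpM2r ?ltW//.
have : h * (2 * E * a ^+ 2) <= h * (2 * E * (`|a| + 1) ^+ 2).
  by rewrite ler_wpM2l ?(ltW h0)// ler_wpM2l// mulr_ge0// ltW.
lra.
Qed.

Lemma uderiv_exprn (n : nat) : uderiv (fun x => x ^+ n.+1) (fun x => n.+1%:R * x ^+ n).
Proof.
elim: n => [|n IH].
  by apply: uderiv_ext uderiv_id => x _; rewrite ?expr1// expr0 mulr1.
apply: uderiv_ext (uderivM uderiv_id IH) => x _; first by rewrite -exprS.
by rewrite -[in RHS]natr1 mul1r mulrDl mul1r addrC mulrCA -exprS.
Qed.

Lemma uderiv_monomial n : uderiv (monomial n) (monomial_pred n).
Proof.
case: n => [|n].
  by apply: uderiv_ext (uderiv_cst 1) => x _; rewrite /monomial /monomial_pred ?fact0 ?divr1.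
apply: uderiv_ext (uderivZ (n.+1`!%:R)^-1 (uderiv_exprn n)) => x _.
  by rewrite /monomial mulrC.
rewrite /monomial_pred /monomial factS natrM invfM.
have n0 : n.+1%:R != 0 :> R by rewrite pnatr_eq0.
by rewrite mulrACA mulVf// mul1r mulrC.
Qed.

(** Cut [[0, x]] into [n] equal steps: the increments of [f] are dominated by
    those of [q] up to an error that is small compared with the step. *)
Lemma uderiv_le f f' q q' : uderiv f f' -> uderiv q q' ->
  (forall x, 0 <= x <= T -> `|f' x| <= q' x) ->
  forall x, 0 <= x <= T -> `|f x - f 0| <= q x - q 0.
Proof.
move=> [_ df] [_ dq] fq x /andP[]; rewrite le_eqVlt => /predU1P[<- _|x0 xT].
  by rewrite !subrr normr0.
apply/ler_addgt0Pr => e e0.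
have ex : 0 < e / (2 * x) by rewrite divr_gt0// mulr_gt0.
have [d1 d10 H1] := df _ ex; have [d2 d20 H2] := dq _ ex.
pose D := Num.min d1 d2.
have D0 : 0 < D by rewrite lt_min d10.
pose n := (Num.truncn (x / D)).+1.
have n0 : 0 < n%:R :> R by rewrite ltr0n.
pose h := x / n%:R.
have h0 : 0 < h by rewrite divr_gt0.
have hD : h < D.
  by rewrite /h ltr_pdivrMr// mulrC -ltr_pdivrMr// truncnS_gt.
have nh : n%:R * h = x by rewrite /h mulrC mulfVK// gt_eqF.
have step k : (k <= n)%N ->
    `|f (k%:R * h) - f 0| <= q (k%:R * h) - q 0 + k%:R * h * (e / x).
  elim: k => [_|k IH kn]; first by rewrite !mul0r !subrr normr0 add0r.
  have k0 : 0 <= k%:R * h by rewrite mulr_ge0// ltW.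
  have khT : k%:R * h + h <= T.
    rewrite (le_trans _ xT)// -nh -[X in _ + X]mul1r -mulrDl natr1 ler_wpM2r ?(ltW h0)//.
    by rewrite ler_nat.
  have hd1 : 0 < h < d1 by rewrite h0/=; move: hD; rewrite lt_min => /andP[].
  have hd2 : 0 < h < d2 by rewrite h0/=; move: hD; rewrite lt_min => /andP[].
  have {}IH := IH (ltnW kn).
  have -> : k.+1%:R * h = k%:R * h + h by rewrite -natr1 mulrDl mul1r.
  set y := k%:R * h in k0 khT IH *.
  have := H1 y h k0 khT hd1; have := H2 y h k0 khT hd2.
  have yT : 0 <= y <= T by rewrite k0/=; lra.
  have := fq y yT; rewrite !ler_norml => /andP[a1 a2] /andP[b1 b2] /andP[c1 c2].
  have -> : (y + h) * (e / x) = y * (e / x) + 2 * (e / (2 * x) * h).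
    by field; rewrite gt_eqF.
  move: IH; rewrite ler_norml => /andP[i1 i2].
  have m1 : h * f' y <= h * q' y by rewrite ler_wpM2l// ltW.
  have m2 : h * - q' y <= h * f' y by rewrite ler_wpM2l// ltW.
  by rewrite mulrN in m2; apply/andP; split; lra.
have := step n (leqnn n); rewrite nh => /le_trans; apply.
by rewrite mulrC mulfVK// gt_eqF.
Qed.

End UniformDerivative.

(** * The forward Kolmogorov equation *)

(** One time step of the Kolmogorov equation: [G1] and [G2] are the
    contributions of the two states occupied at the beginning of the step. *)
Lemma kolmogorov_error (R : realType)
    (h e e1 L B l1 l2 p1' p2' p3' F1 F2 F1' F2' u1 u2 G1 G2 : R) :
  0 < h -> 0 < e1 -> e1 <= 1 -> e1 * (2 * (4 + 4 * B)) <= e ->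
  0 <= B -> 1 <= L -> 0 < l1 -> l1 <= L - 1 -> 0 < l2 -> l2 <= L - 1 ->
  h * (2 * (4 * (B * L) + 1)) < e ->
  `|u1| <= 1 -> `|u2| <= 1 ->
  `|F1| <= B -> `|F2| <= B -> `|F1'| <= B -> `|F2'| <= B ->
  `|G1 - p1' * (F1 + h * u1 * F1')| <= (e1 + B * (L * h)) * h ->
  `|G2 - p2' * (F2 + h * u2 * F2')| <= (e1 + B * (L * h)) * h ->
  `|p1' - (1 - l1 * h)| <= e1 * h -> `|p3' - (1 - l2 * h)| <= e1 * h ->
  p3' + p2' = 1 ->
  `|G1 + G2 - F1 - h * (u1 * F1' - l1 * F1 + l2 * F2)| <= e * h.
Proof.
move=> h0 e10 e11 e1c B0 L1 l10 Lj l20 Lnj h6' u1b u2b b1 b2 b1' b2' S1 S2 r1 r2 q2.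
have p2E : p2' = 1 - p3' by lra.
have -> : G1 + G2 - F1 - h * (u1 * F1' - l1 * F1 + l2 * F2) =
    (G1 - p1' * (F1 + h * u1 * F1')) + (G2 - p2' * (F2 + h * u2 * F2')) +
    ((p1' - (1 - l1 * h)) * F1 + - ((p3' - (1 - l2 * h)) * F2)) +
    ((h * (p1' - 1)) * (u1 * F1') + (h * p2') * (u2 * F2')).
  by rewrite p2E; ring.
have t3 : `|(p1' - (1 - l1 * h)) * F1 + - ((p3' - (1 - l2 * h)) * F2)|
    <= 2 * (e1 * h * B).
  rewrite (le_trans (ler_normD _ _))// normrN !normrM.
  have := ler_pM (normr_ge0 _) (normr_ge0 _) r1 b1.
  have := ler_pM (normr_ge0 _) (normr_ge0 _) r2 b2; lra.
have Lh : 0 <= L * h by rewrite mulr_ge0 ?(ltW h0)//; lra.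
have lamh1 : l1 * h <= (L - 1) * h by rewrite ler_wpM2r// ltW.
have lamh2 : l2 * h <= (L - 1) * h by rewrite ler_wpM2r// ltW.
have lamh3 : 0 <= l1 * h by rewrite mulr_ge0// ltW.
have lamh4 : 0 <= l2 * h by rewrite mulr_ge0// ltW.
have e1h : e1 * h <= h by rewrite ger_pMl.
have pp1 : `|p1' - 1| <= L * h.
  by move: r1; rewrite !ler_norml => /andP[a1 a2]; clear -a1 a2 e1h h0 lamh1 lamh2 lamh3 lamh4;
    apply/andP; split; lra.
have pp2 : `|p2'| <= L * h.
  by move: r2; rewrite p2E !ler_norml => /andP[a1 a2]; apply/andP; split; lra.
have uF u F : `|u| <= 1 -> `|F| <= B -> `|u * F| <= B.
  by move=> u1' F1b; rewrite normrM -[leRHS]mul1r ler_pM.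
have t4 : `|(h * (p1' - 1)) * (u1 * F1') + (h * p2') * (u2 * F2')|
    <= 2 * (h * (L * h) * B).
  rewrite (le_trans (ler_normD _ _))// ![`|_ * (_ * _)|]normrM ![`|h * _|]normrM.
  rewrite (gtr0_norm h0).
  have m1 := ler_wpM2l (ltW h0) pp1; have m2 := ler_wpM2l (ltW h0) pp2.
  have h_ge0 := ltW h0.
  have n1 := ler_pM (mulr_ge0 h_ge0 (normr_ge0 _)) (normr_ge0 _) m1 (uF _ _ u1b b1').
  have n2 := ler_pM (mulr_ge0 h_ge0 (normr_ge0 _)) (normr_ge0 _) m2 (uF _ _ u2b b2').
  by lra.
have final : (e1 + B * (L * h)) * h + (e1 + B * (L * h)) * h + 2 * (e1 * h * B) +
    2 * (h * (L * h) * B) <= e * h.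
  have -> : (e1 + B * (L * h)) * h + (e1 + B * (L * h)) * h + 2 * (e1 * h * B) +
    2 * (h * (L * h) * B) = (2 * e1 + 2 * (e1 * B) + 4 * (B * L) * h) * h by ring.
  rewrite ler_wpM2r ?(ltW h0)//.
  have : 0 <= e1 * B by rewrite mulr_ge0// ltW.
  clear -e1c h6' h0 e10; lra.
apply: le_trans final.
rewrite (le_trans (ler_normD _ _))// lerD// (le_trans (ler_normD _ _))// lerD//.
by rewrite (le_trans (ler_normD _ _))// lerD.
Qed.

Section Kolmogorov.
Context {d : measure_display} {Omega : measurableType d} {R : realType}.
Variables (P : probability Omega R) (eps : R -> Omega -> bool) (lam : bool -> R).
Hypothesis meps : measurable_process eps.
Hypothesis lam_gt0 : forall i, 0 < lam i.
Variable p : bool -> bool -> R -> R.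
Hypothesis ptrans : transition P eps lam p.
Variable b : bool.
Local Notation RR := (measurableTypeR R).
Local Notation mu := (@lebesgue_measure R).
Local Notation X := (sojourn eps b).
Local Notation start := (at_state eps 0 b).

Let mX t : measurable_fun setT (X t : Omega -> RR).
Proof. exact: measurable_sojourn. Qed.

Let mstate t i : 0 <= t -> measurable (at_state eps t i).
Proof. exact: measurable_at_state. Qed.

Let P_fin D : measurable D -> (P D < +oo)%E.
Proof. by move=> mD; rewrite ltey_eq fin_num_measure. Qed.

Let past_start s : 0 <= s -> past eps s start.
Proof. by move=> s0; apply: past_at_state; rewrite lexx. Qed.

Let mstart : measurable start. Proof. exact: mstate. Qed.

Let mstart_state t j : 0 <= t -> measurable (start `&` at_state eps t j).
Proof. by move=> t0; apply: measurableI mstart (mstate j t0). Qed.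

(** An expectation over an event and not a conditional one. *)
Definition expect_at (phi : R -> R) (j : bool) (t : R) : R :=
  \int[P]_(w in start `&` at_state eps t j) phi (X t w).

Lemma expect_at_bound (phi : RR -> R) B j t : 0 <= t ->
  measurable_fun setT phi -> (forall x, 0 <= x <= t -> `|phi x| <= B) ->
  `|expect_at phi j t| <= B.
Proof.
move=> t0 mphi phiB.
have B0 : 0 <= B by rewrite (le_trans (normr_ge0 (phi 0)))// phiB// lexx.
have mD := mstart_state j t0.
have H := @normr_Rintegral_le _ _ _ P _ (fun w => phi (X t w)) B mD (P_fin mD).
apply: le_trans (H _ _) _.
- exact: measurable_funTS (measurableT_comp mphi (mX t)).
- by move=> w _; apply: phiB; rewrite sojourn_bounds.
rewrite -[leRHS]mulr1 ler_wpM2l// -lee_fin fineK ?fin_num_measure//.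
exact: probability_le1.
Qed.

Let p_leave_le l : exists2 dl, 0 < dl & forall h, 0 < h < dl ->
  p l (~~ l) h <= (lam l + 1) * h.
Proof.
have [_ p1 po _] := ptrans; have [dl dl0 H] := po l 1 ltr01.
exists dl => // h hdl; have /andP[h0 _] := hdl.
have := H h hdl; have := p1 l h (ltW h0).
by rewrite ler_norml => <- /andP[+ _]; lra.
Qed.

Let measurable_prob_state (A : set Omega) (I : set RR) i :
  measurable A -> (forall u, I u -> 0 <= u) -> measurable I ->
  measurable_fun I (fun u : RR => P (A `&` at_state eps u i)).
Proof.
move=> mA I0 mI.
pose S := graph_at_state eps i `&` (setT `*` A).
have mS : measurable S.
  by apply: measurableI; [exact: measurable_graph_at_state|exact: measurableX].
apply: (eq_measurable_fun (P \o xsection S)); last first.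
  by apply: measurable_funTS; exact: measurable_fun_xsection.
move=> u /[!inE] Iu /=; congr (P _); apply/seteqP; split=> w.
  by rewrite /xsection/= inE => -[[_ e] [_ Aw]].
by move=> [Aw e]; rewrite /xsection/= inE; split => //; split => //; exact: I0.
Qed.

(** At each time of the interval the state differs from [l] with probability at
    most [C]. With [C] of order [h], the mean time spent out of [l] is of order
    [h ^ 2], hence negligible in a time step. *)
Lemma integral_occupation_leave (A : set Omega) l C t h :
  past eps t A -> 0 <= t -> 0 < h ->
  (forall v, 0 < v <= h -> p l (~~ l) v <= C) -> 0 <= C ->
  \int[P]_(w in A `&` at_state eps t l) occupation eps (~~ l) `[t, t + h] w <= C * h.
Proof.
move=> pA t0 h0 pC C0; have [p0 _ _ pM] := ptrans.
have mA := past_measurable meps pA.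
have mAl : measurable (A `&` at_state eps t l).
  by apply: measurableI => //; exact: mstate.
pose I : set RR := `[t, t + h]%classic.
have mI : measurable I by exact: measurable_itv.
have muI : mu I = h%:E.
  by rewrite /I lebesgue_measure_itv/= lte_fin ltrDl h0 -EFinB addrC addKr.
have Ioo : (mu I < +oo)%E by rewrite muI ltry.
have I0 u : I u -> 0 <= u by rewrite /I/= in_itv/= => /andP[/(le_trans t0)].
have m1 : measurable_fun [set: Omega] (cst 1 : Omega -> R) by exact: measurable_cst.
have H := @integral_occupation _ _ _ P eps meps I _ (cst 1) (~~ l) mI Ioo I0 mAl m1
  (fun=> ler01).
have intP u : I u ->
    (\int[P]_(w in A `&` at_state eps t l `&` at_state eps u (~~ l))
       (cst 1 w : R)%:E =
     P (A `&` at_state eps t l `&` at_state eps u (~~ l)))%E.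
  move=> Iu; apply: etrans (integral_cst P _ 1%E) (mul1e _).
  by apply: measurableI => //; apply: mstate; exact: I0.
have occI : (\int[P]_(w in A `&` at_state eps t l)
    (occupation eps (~~ l) I w)%:E <= (C * h)%:E)%E.
  under eq_integral do rewrite -[occupation _ _ _ _]mul1r.
  rewrite H.
  apply: (@le_trans _ _ (\int[mu]_(u in I) C%:E)%E); last first.
    have -> : (\int[mu]_(u in I) C%:E = C%:E * mu I)%E by exact: integral_cst.
    by rewrite muI -EFinM.
  apply: ge0_le_integral => //.
  - by move=> u _; apply: integral_ge0 => w _; rewrite lee_fin.
  - apply: (eq_measurable_fun
        (fun u : RR => P (A `&` at_state eps t l `&` at_state eps u (~~ l)))).
      by move=> u /[!inE] Iu; rewrite intP.
    exact: measurable_prob_state.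
  move=> u Iu; have u0 := I0 _ Iu.
  have mAlu : measurable (A `&` at_state eps t l `&` at_state eps u (~~ l)).
    by apply: measurableI => //; exact: mstate.
  rewrite intP//.
  have : t <= u by move: Iu; rewrite /I/= in_itv/= => /andP[].
  rewrite le_eqVlt => /predU1P[<-|tu].
    rewrite (_ : _ `&` _ = set0) ?measure0 ?lee_fin//.
    by apply/seteqP; split=> // w [[_]]; rewrite /at_state/= => ->; case: (l).
  have -> : u = t + (u - t) by rewrite addrC subrK.
  rewrite pM ?subr_ge0 ?(ltW tu)//.
  have pl : p l (~~ l) (u - t) <= C.
    apply: pC; rewrite subr_gt0 tu/=.
    by move: Iu; rewrite /I/= in_itv/= => /andP[_]; lra.
  apply: (@le_trans _ _ (C%:E * 1)%E); last by rewrite mule1.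
  apply: lee_pmul => //; first by rewrite lee_fin p0// subr_ge0 ltW.
  exact: probability_le1.
have fin : (\int[P]_(w in A `&` at_state eps t l)
    (occupation eps (~~ l) I w)%:E \is a fin_num)%E.
  rewrite ge0_fin_numE; first exact: le_lt_trans occI (ltry _).
  apply: integral_ge0 => w _; rewrite lee_fin.
  by have /andP[] := @occupation_bounds _ _ _ _ meps I w (~~ l) mI Ioo I0.
by rewrite -lee_fin /Rintegral fineK.
Qed.

Variables (T : R) (phi phi' : R -> R).
Hypotheses (mphi : measurable_fun setT (phi : RR -> R))
  (mphi' : measurable_fun setT (phi' : RR -> R)).
Hypothesis Uphi : uderiv T phi phi'.

Let integrable_comp (g : RR -> R) B (D : set Omega) s : measurable D -> 0 <= s ->
  measurable_fun setT g -> (forall x, 0 <= x <= s -> `|g x| <= B) ->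
  P.-integrable D (EFin \o (fun w => g (X s w))).
Proof.
move=> mD s0 mg gB; apply: (@bounded_integrable _ _ _ _ _ _ B) => //.
- exact: P_fin.
- exact: measurable_funTS (measurableT_comp mg (mX s)).
- by move=> w _; apply: gB; rewrite sojourn_bounds.
Qed.

(* The contribution to one time step of the paths that start it in state [l]. *)
Let step_error l j t h e B C : 0 <= t -> 0 < h -> t + h <= T -> 0 <= e -> 0 <= C ->
  (forall x, 0 <= x <= T -> `|phi x| <= B /\ `|phi' x| <= B) ->
  (forall x k, 0 <= x -> x + k <= T -> 0 < k <= h ->
     `|phi (x + k) - phi x - k * phi' x| <= e * k) ->
  (forall v, 0 < v <= h -> p l (~~ l) v <= C) ->
  `|\int[P]_(w in start `&` at_state eps t l `&` at_state eps (t + h) j)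
       phi (X (t + h) w) -
    p l j h * (expect_at phi l t + h * (l == b)%:R * expect_at phi' l t)|
  <= (e + B * C) * h.
Proof.
move=> t0 h0 thT e0 C0 phiB dphi pC.
have th0 : 0 <= t + h by rewrite addr_ge0// ltW.
have tT : t <= T by rewrite (le_trans _ thT)// lerDl ltW.
have mD := mstart_state l t0.
have mDj : measurable (start `&` at_state eps t l `&` at_state eps (t + h) j).
  by apply: measurableI => //; exact: mstate.
have bphi x : 0 <= x <= T -> `|phi x| <= B by move=> /phiB[].
have bphi' x : 0 <= x <= T -> `|phi' x| <= B by move=> /phiB[].
have B0 : 0 <= B.
  by rewrite (le_trans (normr_ge0 (phi 0)))// bphi// lexx (le_trans t0).
have le_tT x : 0 <= x <= t -> 0 <= x <= T.
  by move=> /andP[-> /= /le_trans]; exact.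
have le_thT x : 0 <= x <= t + h -> 0 <= x <= T.
  by move=> /andP[-> /= /le_trans]; exact.
pose c : R := h * (l == b)%:R.
pose psi (x : RR) : R := phi x + c * phi' x.
have mpsi : measurable_fun setT psi.
  by apply: measurable_funD => //; apply: measurable_funM => //; exact: measurable_cst.
have bpsi x : 0 <= x <= t -> `|psi x| <= B + `|c| * B.
  move=> /le_tT xT; rewrite (le_trans (ler_normD _ _))// lerD ?bphi//.
  by rewrite normrM ler_wpM2l// bphi'.
have EQ : p l j h * (expect_at phi l t + c * expect_at phi' l t) =
    \int[P]_(w in start `&` at_state eps t l `&` at_state eps (t + h) j) psi (X t w).
  rewrite (@markov_sojourn _ _ _ P eps lam meps p ptrans b psi _ t h start l j
    t0 (ltW h0) (past_start t0) mpsi bpsi).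
  congr (_ * _); rewrite /expect_at -RintegralZl//; last first.
    by apply: (@integrable_comp _ B) => // x /le_tT; exact: bphi'.
  rewrite -RintegralD//.
    by apply: (@integrable_comp _ B) => // x /le_tT; exact: bphi.
  apply: (@integrable_comp (fun x => c * phi' x) (`|c| * B)) => //.
    by apply: measurable_funM => //; exact: measurable_cst.
  by move=> x /le_tT xT; rewrite normrM ler_wpM2l// bphi'.
rewrite EQ -RintegralB//; last 2 first.
- by apply: (@integrable_comp _ B) => // x /le_thT; exact: bphi.
- by apply: (@integrable_comp _ (B + `|c| * B)).
have int1 : P.-integrable (start `&` at_state eps t l `&` at_state eps (t + h) j)
    (EFin \o (fun w => phi (X (t + h) w) - psi (X t w))).
  apply: (@bounded_integrable _ _ _ _ _ _ (B + (B + `|c| * B))) => //.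
  - exact: P_fin.
  - apply: measurable_funTS; apply: measurable_funB.
      exact: (measurableT_comp mphi (mX (t + h))).
    exact: (measurableT_comp mpsi (mX t)).
  - move=> w _; rewrite (le_trans (ler_normB _ _))// lerD//.
      by apply: bphi; apply: le_thT; exact: sojourn_bounds.
    by apply: bpsi; exact: sojourn_bounds.
apply: le_trans (le_normr_Rintegral mDj int1) _.
pose I : set RR := `[t, t + h]%classic.
have mI : measurable I by exact: measurable_itv.
have muI : mu I = h%:E.
  by rewrite /I lebesgue_measure_itv/= lte_fin ltrDl h0 -EFinB addrC addKr.
have Ioo : (mu I < +oo)%E by rewrite muI ltry.
have I0 u : I u -> 0 <= u by rewrite /I/= in_itv/= => /andP[/(le_trans t0)].
have occb i w : 0 <= occupation eps i I w <= h.
  by have := occupation_bounds meps w i mI Ioo I0; rewrite muI.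
have mocc : measurable_fun setT (occupation eps (~~ l) I) by exact: measurable_occupation.
(* During the step [X] moves by [c], that is by [h] if [l = b] and by 0
   otherwise, up to the time spent out of [l]. *)
have pointwise w : at_state eps t l w ->
    `|phi (X (t + h) w) - psi (X t w)| <= e * h + B * occupation eps (~~ l) I w.
  move=> _.
  have Xt := sojourn_bounds meps b w t0; have /andP[Xt0 Xtt] := Xt.
  have := sojournD meps b w t0 (ltW h0); rewrite -/I => ->.
  set k := occupation eps b I w.
  have /andP[k0 kh] := occb b w; rewrite -/k in k0 kh.
  have dev : `|k - c| = occupation eps (~~ l) I w.
    rewrite /c; have [lb|] := eqVneq l b; rewrite ?mulr1 ?mulr0 ?subr0.
      rewrite lb /I (occupationC meps b w t0 (ltW h0)) -/I -/k.
      by rewrite distrC ger0_norm// subr_ge0.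
    move=> lb; rewrite ger0_norm// /k; congr (occupation _ _ _ _).
    by case: (l) (b) lb => -[].
  have -> : phi (X t w + k) - psi (X t w) =
    (phi (X t w + k) - phi (X t w) - k * phi' (X t w)) + (k - c) * phi' (X t w).
    by rewrite /psi; ring.
  rewrite (le_trans (ler_normD _ _))// lerD//; last first.
    by rewrite normrM dev mulrC ler_wpM2r// ?bphi' ?le_tT//; have /andP[] := occb (~~ l) w.
  have [->|kn0] := eqVneq k 0.
    by rewrite addr0 subrr mul0r subr0 normr0 mulr_ge0// ltW.
  apply: (@le_trans _ _ (e * k)); last by rewrite ler_wpM2l.
  by apply: dphi => //; [lra|rewrite lt0r kn0 k0].
have int_occ D : measurable D -> P.-integrable D (EFin \o occupation eps (~~ l) I).
  move=> mD'; apply: (@bounded_integrable _ _ _ _ _ _ h) => //; first exact: P_fin.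
    exact: measurable_funTS.
  by move=> w _; have /andP[u0 u1] := occb (~~ l) w; rewrite ger0_norm.
have int_bnd D : measurable D ->
    P.-integrable D (EFin \o (fun w => e * h + B * occupation eps (~~ l) I w)).
  move=> mD'; apply: (@bounded_integrable _ _ _ _ _ _ (e * h + B * h)) => //.
  - exact: P_fin.
  - apply: measurable_funTS; apply: measurable_funD => //.
    by apply: measurable_funM => //; exact: measurable_cst.
  - move=> w _; have /andP[u0 u1] := occb (~~ l) w.
    have eh0 : 0 <= e * h by rewrite mulr_ge0// ltW.
    rewrite ger0_norm; first by rewrite lerD2l ler_wpM2l.
    by rewrite addr_ge0// mulr_ge0.
apply: (@le_trans _ _ (\int[P]_(w in start `&` at_state eps t l)
    (e * h + B * occupation eps (~~ l) I w))).
  apply: (@le_trans _ _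
      (\int[P]_(w in start `&` at_state eps t l `&` at_state eps (t + h) j)
       (e * h + B * occupation eps (~~ l) I w))).
    apply: le_Rintegral => //.
    - exact: integrable_norm.
    - exact: int_bnd.
    - by move=> w [[_ wl] _]; exact: pointwise.
  apply: le_Rintegral_subset => //.
  - exact: int_bnd.
  - move=> w _; have /andP[u0 u1] := occb (~~ l) w.
    by rewrite addr_ge0 ?mulr_ge0// ltW.
rewrite RintegralD//; last 2 first.
- by apply: (@bounded_integrable _ _ _ _ _ _ `|e * h|) => //; exact: P_fin.
- apply: (@bounded_integrable _ _ _ _ _ _ (B * h)) => //; first exact: P_fin.
    apply: measurable_funTS.
    by apply: measurable_funM => //; exact: measurable_cst.
  move=> w _; have /andP[u0 u1] := occb (~~ l) w.
  by rewrite ger0_norm ?mulr_ge0// ler_wpM2l.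
rewrite mulrDl lerD//.
  rewrite Rintegral_cst// -[leRHS]mulr1 ler_wpM2l ?mulr_ge0 ?(ltW h0)//.
  by rewrite -lee_fin fineK ?fin_num_measure//; exact: probability_le1.
rewrite RintegralZl//; last exact: int_occ.
rewrite -mulrA ler_wpM2l//.
exact: integral_occupation_leave (past_start t0) t0 h0 pC C0.
Qed.

(** The state is split at the beginning of a time step. Up to [o(h)], the factor
    [p j j h = 1 - lam j h] gives the loss, [p (~~ j) j h = lam (~~ j) h] the gain,
    and [X] moves by [h] only while the state is [b], whence the derivative of
    [phi]. *)
Lemma uderiv_expect_at j : uderiv T (expect_at phi j)
  (fun t => (j == b)%:R * expect_at phi' j t - lam j * expect_at phi j t +
            lam (~~ j) * expect_at phi (~~ j) t).
Proof.
have [T0|T0] := ltP T 0.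
  split; first by exists 0 => x /andP[x0 xT]; lra.
  by move=> e e0; exists 1 => // x h x0 xh /andP[h0 _]; lra.
have [[B phiB] dphi] := Uphi; have [p0 p1 po pM] := ptrans.
have B0 : 0 <= B.
  have [|+ _] := phiB 0; first by rewrite lexx.
  exact: le_trans.
have Fb i t : 0 <= t <= T -> `|expect_at phi i t| <= B.
  move=> /andP[t0 tT]; apply: expect_at_bound => // x /andP[x0 xt].
  by have [] := phiB x; rewrite // x0 (le_trans xt).
have Fb' i t : 0 <= t <= T -> `|expect_at phi' i t| <= B.
  move=> /andP[t0 tT]; apply: expect_at_bound => // x /andP[x0 xt].
  by have [] := phiB x; rewrite // x0 (le_trans xt).
have [L [Lj Lnj L1]] : exists L, [/\ lam j <= L - 1, lam (~~ j) <= L - 1 & 1 <= L].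
  have l0 := lam_gt0 j; have l1 := lam_gt0 (~~ j).
  by exists (lam j + lam (~~ j) + 1); split; lra.
have L0 : 0 <= L by exact: le_trans ler01 L1.
split.
  exists (B + B + (B + B) * L) => t tT; split.
    rewrite (le_trans (Fb _ _ tT))// -addrA lerDl addr_ge0//.
    by rewrite mulr_ge0 ?addr_ge0//; lra.
  have lamB i : (i == j) || (i == ~~ j) -> `|lam i * expect_at phi i t| <= L * B.
    move=> ij; rewrite normrM gtr0_norm// ler_pM ?Fb//; first exact: ltW.
    by case/orP: ij => /eqP ->; lra.
  have u1 : `|(j == b)%:R * expect_at phi' j t| <= B.
    rewrite normrM normr_nat -[leRHS]mul1r ler_pM ?Fb'//.
    by case: (j == b).
  rewrite (le_trans (ler_normD _ _))//.
  have := lamB j; rewrite eqxx => /(_ isT) l1.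
  have := lamB (~~ j); rewrite eqxx orbT => /(_ isT) l2.
  have := le_trans (ler_normB _ _) (lerD u1 l1); lra.
move=> e e0.
pose c := 4 + 4 * B; have c0 : 0 < c by rewrite /c; lra.
pose e1 := Num.min 1 (e / (2 * c)).
have e10 : 0 < e1 by rewrite lt_min ltr01 divr_gt0// mulr_gt0.
have e11 : e1 <= 1 by rewrite ge_min lexx.
have e1c : e1 * (2 * c) <= e.
  by rewrite -ler_pdivlMr ?mulr_gt0// ge_min lexx orbT.
have [d1 d10 H1] := dphi _ e10.
have [d2 d20 H2] := po j _ e10.
have [d3 d30 H3] := po (~~ j) _ e10.
have [d4 d40 H4] := p_leave_le j.
have [d5 d50 H5] := p_leave_le (~~ j).
pose d6 := e / (2 * (4 * (B * L) + 1)).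
have BL : 0 <= B * L by rewrite mulr_ge0.
have d60 : 0 < d6 by rewrite divr_gt0// mulr_gt0// ltr_wpDl// mulr_ge0.
exists (Num.min (Num.min (Num.min d1 d2) (Num.min d3 d4)) (Num.min d5 d6)).
  by rewrite !lt_min d10 d20 d30 d40 d50 d60.
move=> t h t0 thT /andP[h0]; rewrite !lt_min.
move=> /andP[/andP[/andP[h1 h2] /andP[h3 h4]] /andP[h5 h6]].
have tT : 0 <= t <= T by rewrite t0/=; lra.
have th0 : 0 <= t + h by rewrite addr_ge0// ltW.
have step l dl : (l == j) || (l == ~~ j) -> h < dl ->
    (forall v, 0 < v < dl -> p l (~~ l) v <= (lam l + 1) * v) ->
    `|\int[P]_(w in start `&` at_state eps t l `&` at_state eps (t + h) j)
       phi (X (t + h) w) -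
    p l j h * (expect_at phi l t + h * (l == b)%:R * expect_at phi' l t)|
    <= (e1 + B * (L * h)) * h.
  move=> lj hdl Hl; apply: step_error => //.
  - exact: ltW.
  - by rewrite mulr_ge0// ltW.
  - move=> x k x0 xk /andP[k0 kh]; apply: H1 => //.
    by rewrite k0 (le_lt_trans kh).
  - move=> v /andP[v0 vh]; apply: le_trans (Hl v _) _.
      by rewrite v0 (le_lt_trans vh).
    rewrite ler_pM// ?(ltW v0)//; first by rewrite addr_ge0// ltW.
    by case/orP: lj => /eqP ->; rewrite -lerBrDr.
have S1 := step j d4 _ h4 H4; rewrite eqxx in S1; have {}S1 := S1 isT.
have S2 := step (~~ j) d5 _ h5 H5; rewrite eqxx orbT in S2; have {}S2 := S2 isT.
have r1 := H2 h; rewrite h0 h2 in r1; have {}r1 := r1 isT.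
have r2 := H3 h; rewrite h0 h3 in r2; have {}r2 := r2 isT.
have q2 := p1 (~~ j) h (ltW h0); rewrite negbK in q2.
have split_state : expect_at phi j (t + h) =
    \int[P]_(w in start `&` at_state eps t j `&` at_state eps (t + h) j)
       phi (X (t + h) w) +
    \int[P]_(w in start `&` at_state eps t (~~ j) `&` at_state eps (t + h) j)
       phi (X (t + h) w).
  rewrite /expect_at -Rintegral_setU.
  - congr (Rintegral _ _ _); rewrite -setIUl -setIUr at_stateC setUv setIT.
    by [].
  - exact: measurableI (mstart_state j t0) (mstate j th0).
  - exact: measurableI (mstart_state (~~ j) t0) (mstate j th0).
  - apply: (@integrable_comp _ B) => //.
      apply: measurableU.
        exact: measurableI (mstart_state j t0) (mstate j th0).
      exact: measurableI (mstart_state (~~ j) t0) (mstate j th0).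
    move=> x /andP[x0 xt]; have [] := phiB x => //.
    by rewrite x0 (le_trans xt).
  - apply/disj_setPS => w [[[_ a1] _] [[_ a2] _]].
    by move: a1 a2; rewrite /at_state/= => ->; case: (j).
have h6' : h * (2 * (4 * (B * L) + 1)) < e.
  by rewrite -ltr_pdivlMr// mulr_gt0// ltr_wpDl// mulr_ge0.
rewrite split_state.
have := Fb j t tT; have := Fb (~~ j) t tT.
have := Fb' j t tT; have := Fb' (~~ j) t tT.
move: S1 S2 r1 r2 q2.
set G1 := Rintegral _ _ _; set G2 := Rintegral _ _ _.
set F1 := expect_at phi j t; set F2 := expect_at phi (~~ j) t.
set F1' := expect_at phi' j t; set F2' := expect_at phi' (~~ j) t.
set p1' := p j j h; set p2' := p (~~ j) j h; set p3' := p (~~ j) (~~ j) h.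
move=> S1 S2 r1 r2 q2 b2' b1' b2 b1.
set u1 : R := (j == b)%:R in S1 *; set u2 : R := (~~ j == b)%:R in S2 *.
have u1b : `|u1| <= 1 by rewrite normr_nat; case: (_ == _).
have u2b : `|u2| <= 1 by rewrite normr_nat; case: (_ == _).
exact: (@kolmogorov_error _ h e e1 L B _ _ p1' p2' p3' F1 F2 F1' F2' u1 u2 G1 G2).
Qed.

End Kolmogorov.

(** * Taylor series of the triangular system *)

Section TaylorSystem.
Context {R : realType}.
Variables (a c0 : R).
Hypotheses (a_ge0 : 0 <= a) (c0_ge0 : 0 <= c0).

(** Taylor coefficients at 0 of the solution of
    [u_k' = u_(k-1) + a v_k], [v_k' = c0 u_k] with [u_0(0) = 1] and all other
    initial values 0; the flag [true] stands for [u]. *)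
Definition taylor_coef (m k : nat) (same : bool) : R :=
  if same then
    if (k <= m)%N && ~~ odd (m - k) then
      (a * c0) ^+ (m - k)./2 * 'C((m - k)./2 + k, k)%:R else 0
  else
    if (k < m)%N && odd (m - k) then
      c0 * ((a * c0) ^+ (m - k)./2 * 'C((m - k)./2 + k, k)%:R) else 0.

Lemma taylor_coef0 k same : taylor_coef 0 k same = (same && (k == 0))%:R.
Proof.
by case: k same => [|k] []; rewrite /taylor_coef//= ?expr0 ?bin0 ?mulr1.
Qed.

Lemma taylor_coef_false m k :
  taylor_coef m.+1 k false = c0 * taylor_coef m k true.
Proof.
rewrite /taylor_coef ltnS; case: leqP => //= km; last by rewrite mulr0.
rewrite subSn//= uphalf_half; case: odd => //=; first by rewrite mulr0.
Qed.

Lemma taylor_coef_true m k : taylor_coef m.+1 k true =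
  (if k is k'.+1 then taylor_coef m k' true else 0) + a * taylor_coef m k false.
Proof.
rewrite /taylor_coef; have [km|mk] := leqP k m.
  rewrite (leq_trans km)// subSn//= negbK uphalf_half.
  have [n nE] : exists n, (m - k)%N = n by eexists.
  have lt_km : odd (m - k) -> (k < m)%N.
    by rewrite ltn_neqAle km andbT; case: eqP => // ->; rewrite subnn.
  case: k km nE lt_km => [|k] km nE lt_km.
    case: (boolP (odd _)) => o; last by rewrite andbF mulr0 addr0.
    by rewrite lt_km//= add1n !bin0 !mulr1 add0r exprS mulrA.
  have -> : (m - k = (m - k.+1).+1)%N by rewrite subnSK.
  rewrite (ltnW km)/= negbK uphalf_half.
  case: (boolP (odd _)) => o; last by rewrite andbF mulr0 addr0.
  rewrite lt_km//= add1n addSn addnS binS natrD exprS.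
  by rewrite addSn; ring.
case: k mk => [|k] //; rewrite ltnS leq_eqVlt => /predU1P[->|mk].
  have -> : (k.+1 < k)%N = false by lia.
  by rewrite !leqnn !subnn/= mulr0 addr0 !binn.
have -> : (k < m.+1)%N = false by lia.
have -> : (k <= m)%N = false by lia.
have -> : (k.+1 < m)%N = false by lia.
by rewrite mulr0 addr0.
Qed.

Variables (T B pi : R) (w : nat -> bool -> R -> R).
Hypothesis w_bound : forall k j t, 0 <= t <= T -> `|w k j t| <= B.
Hypothesis w0_true : forall k, w k true 0 = pi * (k == 0)%:R.
Hypothesis w0_false : forall k, w k false 0 = 0.
Hypothesis Uw_true : forall k, uderiv T (w k true)
  (fun t => (if k is k'.+1 then w k' true t else 0) + a * w k false t).
Hypothesis Uw_false : forall k, uderiv T (w k false) (fun t => c0 * w k true t).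

Let K := 1 + a + c0.

Let partial M k j (t : R) := \sum_(m < M) taylor_coef m k j * monomial m t.

Let uderiv_partial M k j : uderiv T (partial M.+1 k j)
  (fun t => \sum_(m < M) taylor_coef m.+1 k j * monomial m t).
Proof.
have H := @uderiv_sum _ T M.+1 (fun m t => taylor_coef m k j * monomial m t)
  (fun m t => taylor_coef m k j * monomial_pred m t)
  (fun m => uderivZ _ (uderiv_monomial T m)).
apply: uderiv_ext H => // t _.
by rewrite big_ord_recl/= mulr0 add0r.
Qed.

(** Induction on [M]: the derivatives of the remainders of order [M.+1] are
    combinations of those of order [M] with coefficients of total size at most
    [K], and all remainders of positive order vanish at 0. *)
Lemma taylor_remainder M k j t : 0 <= t <= T ->
  `|w k j t - pi * partial M k j t| <= B * K ^+ M * monomial M t.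
Proof.
have K0 : 0 <= K by rewrite !addr_ge0.
elim: M k j t => [|M IH] k j t tT.
  rewrite /partial big_ord0 mulr0 subr0 /monomial expr0 fact0 divr1 !mulr1.
  exact: w_bound.
have B0 : 0 <= B by apply: le_trans (w_bound 0 true tT).
pose q (x : R) := B * K ^+ M.+1 * monomial M.+1 x.
pose q' (x : R) := B * K ^+ M.+1 * monomial M x.
have Uq : uderiv T q q' by exact: uderivZ (uderiv_monomial T M.+1).
have Upart := uderivZ (- pi) (uderiv_partial M k j).
pose f (x : R) := w k j x + - pi * partial M.+1 k j x.
have f00 : f 0 = 0.
  have -> : f 0 = w k j 0 + - pi * taylor_coef 0 k j.
    rewrite /f /partial big_ord_recl big1 => [|i _].
      by rewrite addr0 /monomial expr0 fact0 divr1 mulr1.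
    by rewrite /monomial expr0n/= mul0r mulr0.
  by rewrite taylor_coef0; case: (j); rewrite ?w0_true ?w0_false/=; ring.
have q00 : q 0 = 0 by rewrite /q /monomial expr0n/= mul0r mulr0.
have IHp k' j' x : 0 <= x <= T ->
    `|w k' j' x + - pi * partial M k' j' x| <= B * K ^+ M * monomial M x.
  by move=> xT; rewrite mulNr; exact: IH.
have KM : 0 <= B * K ^+ M by rewrite mulr_ge0// exprn_ge0.
suff fq : forall x, 0 <= x <= T -> `|f x - f 0| <= q x - q 0.
  by have := fq t tT; rewrite f00 q00 !subr0 /f mulNr.
case: j @f f00 Upart => f f00 Upart.
  apply: (uderiv_le (uderivD (Uw_true k) Upart) Uq) => x xT.
  have /andP[x0 _] := xT.
  have Sx : \sum_(m < M) taylor_coef m.+1 k true * monomial m x =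
      (if k is k'.+1 then partial M k' true x else 0) + a * partial M k false x.
    rewrite /partial mulr_sumr; case: (k) => [|k'].
      by rewrite add0r; apply: eq_bigr => i _; rewrite taylor_coef_true add0r mulrA.
    transitivity (\sum_(m < M) (taylor_coef m k' true * monomial m x +
        a * (taylor_coef m k'.+1 false * monomial m x))); last by rewrite big_split.
    by apply: eq_bigr => i _; rewrite taylor_coef_true mulrDl mulrA.
  rewrite Sx.
  have -> : (if k is k'.+1 then w k' true x else 0) + a * w k false x +
      - pi * ((if k is k'.+1 then partial M k' true x else 0) + a * partial M k false x) =
      (if k is k'.+1 then w k' true x + - pi * partial M k' true x else 0) +
      a * (w k false x + - pi * partial M k false x).
    by case: (k) => [|k']; ring.
  rewrite (le_trans (ler_normD _ _))//.
  have mB : 0 <= B * K ^+ M * monomial M x by rewrite mulr_ge0// monomial_ge0.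
  have n1 : `|if k is k'.+1 then w k' true x + - pi * partial M k' true x else 0| <=
      B * K ^+ M * monomial M x.
    by case: (k) => [|k']; rewrite ?normr0//; exact: IHp.
  have n2 : `|a * (w k false x + - pi * partial M k false x)| <=
      a * (B * K ^+ M * monomial M x).
    by rewrite normrM ger0_norm// ler_wpM2l//; exact: IHp.
  apply: (le_trans (lerD n1 n2)).
  have -> : q' x = (1 + a) * (B * K ^+ M * monomial M x) +
     c0 * (B * K ^+ M * monomial M x) by rewrite /q' exprS /K; ring.
  by rewrite -{1}[B * _ * _]mul1r -mulrDl lerDl mulr_ge0.
apply: (uderiv_le (uderivD (Uw_false k) Upart) Uq) => x xT.
have /andP[x0 _] := xT.
have mB : 0 <= B * K ^+ M * monomial M x by rewrite mulr_ge0// monomial_ge0.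
have -> : \sum_(m < M) taylor_coef m.+1 k false * monomial m x =
    c0 * partial M k true x.
  by rewrite /partial mulr_sumr; apply: eq_bigr => i _; rewrite taylor_coef_false mulrA.
have -> : c0 * w k true x + - pi * (c0 * partial M k true x) =
   c0 * (w k true x + - pi * partial M k true x) by ring.
rewrite normrM ger0_norm//.
apply: (@le_trans _ _ (c0 * (B * K ^+ M * monomial M x))).
  by rewrite ler_wpM2l//; exact: IHp.
have -> : q' x = c0 * (B * K ^+ M * monomial M x) +
   (1 + a) * (B * K ^+ M * monomial M x) by rewrite /q' exprS /K; ring.
by rewrite lerDl mulr_ge0// addr_ge0.
Qed.

Let partial_true N k t : partial (N.*2 + k) k true t =
  \sum_(n < N) (a * c0) ^+ n * 'C(n + k, k)%:R * monomial (n.*2 + k) t.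
Proof.
rewrite /partial; elim: N => [|N IH].
  rewrite big_ord0 double0 add0n big1// => i _.
  by rewrite /taylor_coef leqNgt ltn_ord mul0r.
rewrite doubleS !addSn !big_ord_recr/= IH -addrA; congr (_ + _).
rewrite /taylor_coef leq_addl addnK odd_double/= doubleK.
by rewrite -addSn addnK/= odd_double/= andbF mul0r addr0.
Qed.

Let partial_false N k t : partial (N.*2 + k).+1 k false t =
  \sum_(n < N) c0 * ((a * c0) ^+ n * 'C(n + k, k)%:R) * monomial (n.*2 + k).+1 t.
Proof.
rewrite /partial; elim: N => [|N IH].
  rewrite big_ord0 double0 add0n big1// => i _.
  by rewrite /taylor_coef ltnNge -ltnS ltn_ord mul0r.
rewrite doubleS !addSn 2![in LHS]big_ord_recr [in RHS]big_ord_recr/= IH -addrA.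
congr (_ + _).
rewrite /taylor_coef ltnS leq_addl -!addSn !addnK/= odd_double/= uphalf_double.
by rewrite andbF mul0r addr0.
Qed.

Let cvg_partial k j (M : nat -> nat) t : 0 <= t <= T ->
  (forall N, (N <= M N)%N) ->
  pi * partial (M N) k j t @[N --> \oo] --> w k j t.
Proof.
move=> tT MN; have /andP[t0 _] := tT.
have cM : M N @[N --> \oo] --> \oo.
  apply/cvgnyPge => A; near=> n; apply: leq_trans (MN n).
  by near: n; exact: nbhs_infty_ge.
have H : (B * exp_coeff (K * t) (M N)) @[N --> \oo] --> B * 0.
  apply: cvgM; first exact: cvg_cst.
  apply: (cvg_comp _ _ cM).
  exact: cvg_exp_coeff.
apply/cvgrPdist_le => e e0.
move/cvgrPdist_le : H => /(_ e e0); rewrite mulr0; apply: filterS => N.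
rewrite sub0r normrN => /(le_trans _); apply.
apply: le_trans (ler_norm _); apply: le_trans (taylor_remainder _ _ _ tT) _.
by rewrite /exp_coeff/= /monomial exprMn !mulrA.
Unshelve. all: by end_near. Qed.

(** Only the indices [m = n.*2 + k] have nonzero coefficients; they are the
    indices [(n.*2 + k).+1] in the other case. *)
Lemma cvg_taylor_true k t : 0 <= t <= T ->
  pi * (\sum_(n < N) (a * c0) ^+ n * 'C(n + k, k)%:R * monomial (n.*2 + k) t)
    @[N --> \oo] --> w k true t.
Proof.
move=> tT; under eq_fun do rewrite -partial_true; apply: cvg_partial => // N.
by rewrite -addnn -addnA leq_addr.
Qed.

Lemma cvg_taylor_false k t : 0 <= t <= T ->
  pi * (\sum_(n < N)
     c0 * ((a * c0) ^+ n * 'C(n + k, k)%:R) * monomial (n.*2 + k).+1 t)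
    @[N --> \oo] --> w k false t.
Proof.
move=> tT; under eq_fun do rewrite -partial_false; apply: cvg_partial => // N.
by rewrite -addnn -addnA -addnS leq_addr.
Qed.

End TaylorSystem.

(** * Tilted moments of the sojourn time *)

Section Moments.
Context {d : measure_display} {Omega : measurableType d} {R : realType}.
Variables (P : probability Omega R) (eps : R -> Omega -> bool) (lam : bool -> R).
Hypothesis meps : measurable_process eps.
Hypothesis lam_gt0 : forall i, 0 < lam i.
Variable p : bool -> bool -> R -> R.
Hypothesis ptrans : transition P eps lam p.
Variable b : bool.
Local Notation RR := (measurableTypeR R).
Local Notation mu := (@lebesgue_measure R).
Local Notation X := (sojourn eps b).
Local Notation start := (at_state eps 0 b).

(** Spending [x] in [b] and [t - x] in the other state without switching costs
    [exp (- lam b x - lam (~~ b) (t - x))]; the exponential factor, times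
    [exp (lam (~~ b) t)], compensates it. *)
Definition tilt (k : nat) (x : R) : R :=
  expR ((lam b - lam (~~ b)) * x) * monomial k x.

Let tilt_pred (k : nat) (x : R) : R := if k is k'.+1 then tilt k' x else 0.

Lemma uderiv_tilt T k : uderiv T (tilt k)
  (fun x => (lam b - lam (~~ b)) * tilt k x + tilt_pred k x).
Proof.
apply: uderiv_ext (uderivM (uderiv_expR T (lam b - lam (~~ b))) (uderiv_monomial T k)).
  by [].
by move=> x _; case: k => [|k]; rewrite /tilt_pred /monomial_pred /tilt; ring.
Qed.

Lemma measurable_tilt k : measurable_fun setT (tilt k : RR -> R).
Proof.
apply: measurable_funM; first exact: measurable_expRM.
exact: measurable_monomial.
Qed.

Lemma tilt_ge0 k x : 0 <= x -> 0 <= tilt k x.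
Proof. by move=> x0; rewrite mulr_ge0 ?expR_ge0 ?monomial_ge0. Qed.

Lemma tilt_bound k t x : 0 <= x <= t ->
  `|tilt k x| <= expR (`|lam b - lam (~~ b)| * t) * expR t.
Proof.
move=> /andP[x0 xt]; rewrite ger0_norm ?tilt_ge0// ler_pM ?expR_ge0//.
- exact: monomial_ge0.
- rewrite ler_expR (@le_trans _ _ (`|lam b - lam (~~ b)| * x))//.
    by rewrite ler_wpM2r// ler_norm.
  by rewrite ler_wpM2l.
- by rewrite (le_trans (monomial_le_expR _ x0))// ler_expR.
Qed.

Let expect_at_lin (a : R) (f g : RR -> R) B C j t : 0 <= t ->
  measurable_fun setT f -> measurable_fun setT g ->
  (forall x, 0 <= x <= t -> `|f x| <= B) -> (forall x, 0 <= x <= t -> `|g x| <= C) ->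
  expect_at P eps b (fun x => a * f x + g x) j t =
  a * expect_at P eps b f j t + expect_at P eps b g j t.
Proof.
move=> t0 mf mg fB gC.
have mX : measurable_fun setT (X t : Omega -> RR) by exact: measurable_sojourn.
have mD : measurable (start `&` at_state eps t j).
  by apply: measurableI; apply: measurable_at_state.
have Xt w := sojourn_bounds meps b w t0.
have int (h : RR -> R) N : measurable_fun setT h ->
    (forall x, 0 <= x <= t -> `|h x| <= N) ->
    P.-integrable (start `&` at_state eps t j) (EFin \o (fun w => h (X t w))).
  move=> mh hN; apply: (@bounded_integrable _ _ _ _ _ _ N) => //.
  - by rewrite ltey_eq fin_num_measure.
  - exact: measurable_funTS (measurableT_comp mh mX).
  - by move=> w _; exact: hN.
rewrite /expect_at -RintegralZl//; last exact: int fB.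
rewrite -RintegralD//; last exact: int gC.
apply: (int (fun x => a * f x) (`|a| * B)) => [|x xt].
  by apply: measurable_funM => //; exact: measurable_cst.
by rewrite normrM ler_wpM2l// fB.
Qed.

Let expect_at0 j t : expect_at P eps b (fun=> 0) j t = 0.
Proof.
rewrite /expect_at /Rintegral integral0_eq//.
Qed.

Let pi : R := fine (P start).

(* Its derivative has lost the diagonal terms of the Kolmogorov equation. *)
Let weighted (k : nat) (same : bool) (t : R) : R :=
  expR (lam (~~ b) * t) * expect_at P eps b (tilt k) (if same then b else ~~ b) t.

Let weighted_pred (k : nat) (t : R) : R := if k is k'.+1 then weighted k' true t else 0.

Let expect_tilt_deriv k j t : 0 <= t ->
  expect_at P eps b (fun x => (lam b - lam (~~ b)) * tilt k x + tilt_pred k x) j t =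
  (lam b - lam (~~ b)) * expect_at P eps b (tilt k) j t +
  expect_at P eps b (tilt_pred k) j t.
Proof.
move=> t0.
apply: (@expect_at_lin _ _ _ (expR (`|lam b - lam (~~ b)| * t) * expR t)
  (expR (`|lam b - lam (~~ b)| * t) * expR t)) => //.
- exact: measurable_tilt.
- by case: k => [|k]; [exact: measurable_cst|exact: measurable_tilt].
- by move=> x; exact: tilt_bound.
- case: k => [|k] x xt; last exact: tilt_bound.
  by rewrite normr0 mulr_ge0 ?expR_ge0.
Qed.

Let measurable_tilt' k : measurable_fun setT
  ((fun x => (lam b - lam (~~ b)) * tilt k x + tilt_pred k x) : RR -> R).
Proof.
apply: measurable_funD.
  by apply: measurable_funM; [exact: measurable_cst|exact: measurable_tilt].
by case: k => [|k]; [exact: measurable_cst|exact: measurable_tilt].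
Qed.

Let uderiv_weighted_true T k : uderiv T (weighted k true)
  (fun t => weighted_pred k t + lam (~~ b) * weighted k false t).
Proof.
have U := @uderiv_expect_at _ _ _ P eps lam meps lam_gt0 p ptrans b T (tilt k) _
  (measurable_tilt k) (measurable_tilt' k) (uderiv_tilt T k) b.
apply: uderiv_ext (uderivM (uderiv_expR T (lam (~~ b))) U) => [//|t tT].
have /andP[t0 _] := tT.
rewrite expect_tilt_deriv// eqxx /weighted /weighted_pred.
by case: k {U} => [|k]; rewrite /tilt_pred ?expect_at0 /weighted/=; ring.
Qed.

Let uderiv_weighted_false T k : uderiv T (weighted k false)
  (fun t => lam b * weighted k true t).
Proof.
have U := @uderiv_expect_at _ _ _ P eps lam meps lam_gt0 p ptrans b T (tilt k) _
  (measurable_tilt k) (measurable_tilt' k) (uderiv_tilt T k) (~~ b).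
apply: uderiv_ext (uderivM (uderiv_expR T (lam (~~ b))) U) => [//|t tT].
have -> : (~~ b == b) = false by case: (b).
by rewrite negbK /weighted/=; ring.
Qed.

Let weighted_bound T k same t : 0 <= t <= T -> `|weighted k same t| <=
  expR (lam (~~ b) * T) * (expR (`|lam b - lam (~~ b)| * T) * expR T).
Proof.
move=> /andP[t0 tT]; rewrite normrM ger0_norm ?expR_ge0// ler_pM ?expR_ge0//.
  by rewrite ler_expR ler_wpM2l// ltW.
apply: (@expect_at_bound _ _ _ P eps meps) => //; first exact: measurable_tilt.
by move=> x /andP[x0 xt]; apply: tilt_bound; rewrite x0 (le_trans xt).
Qed.

Let weighted0 k same : weighted k same 0 = if same then pi * (k == 0)%:R else 0.
Proof.
rewrite /weighted mulr0 expR0 mul1r /expect_at; case: same => /=.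
  rewrite setIid; transitivity (\int[P]_(w in start) (k == 0)%:R : R).
    apply: eq_Rintegral => w _.
    have := sojourn_bounds meps b w (lexx 0); rewrite -eq_le => /eqP <-.
    rewrite /tilt mulr0 expR0 mul1r /monomial.
    by case: k => [|k]; rewrite ?expr0 ?fact0 ?divr1// expr0n mul0r.
  rewrite Rintegral_cst//; first by rewrite mulrC.
  exact: measurable_at_state.
rewrite (_ : start `&` _ = set0) ?Rintegral_set0//.
by rewrite at_stateC setICr.
Qed.

(** The term of index [n] is the contribution of the paths with [2 n] switches,
    and with [2 n + 1] switches in [cvg_moment_other]. *)
Lemma cvg_moment_same k t : 0 <= t ->
  pi * (\sum_(n < N) (lam (~~ b) * lam b) ^+ n * 'C(n + k, k)%:R *
    monomial (n.*2 + k) t) @[N --> \oo] -->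
  expR (lam (~~ b) * t) * expect_at P eps b (tilt k) b t.
Proof.
move=> t0; have tt : 0 <= t <= t by rewrite t0 lexx.
apply: (@cvg_taylor_true _ (lam (~~ b)) (lam b) _ _ t _ pi weighted
  _ _ _ _ _ k t tt).
- exact: ltW.
- exact: ltW.
- by move=> k' j s; exact: weighted_bound.
- by move=> k'; exact: weighted0.
- by move=> k'; exact: weighted0.
- by move=> k'; exact: uderiv_weighted_true.
- by move=> k'; exact: uderiv_weighted_false.
Qed.

Lemma cvg_moment_other k t : 0 <= t ->
  pi * (\sum_(n < N) lam b * ((lam (~~ b) * lam b) ^+ n * 'C(n + k, k)%:R) *
    monomial (n.*2 + k).+1 t) @[N --> \oo] -->
  expR (lam (~~ b) * t) * expect_at P eps b (tilt k) (~~ b) t.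
Proof.
move=> t0; have tt : 0 <= t <= t by rewrite t0 lexx.
apply: (@cvg_taylor_false _ (lam (~~ b)) (lam b) _ _ t _ pi weighted
  _ _ _ _ _ k t tt).
- exact: ltW.
- exact: ltW.
- by move=> k' j s; exact: weighted_bound.
- by move=> k'; exact: weighted0.
- by move=> k'; exact: weighted0.
- by move=> k'; exact: uderiv_weighted_true.
- by move=> k'; exact: uderiv_weighted_false.
Qed.

End Moments.

(** * Densities, affine changes of variable, beta integrals *)

Section Density.
Context {R : realType}.
Local Notation RR := (measurableTypeR R).
Local Notation mu := (@lebesgue_measure R).

Lemma ge0_integral_law d (T : measurableType d) (m : {measure set T -> \bar R})
    (D : set T) (mD : measurable D) (X : T -> RR) (mX : measurable_fun setT X)
    (J : set RR) (f : RR -> \bar R) :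
  measurable J -> measurable_fun J f -> (forall x, J x -> 0 <= f x)%E ->
  (\int[law m mD mX]_(x in J) f x = \int[m]_(w in D `&` X @^-1` J) f (X w))%E.
Proof.
move=> mJ mf f0.
have mXJ : measurable (X @^-1` J) by rewrite -[X in measurable X]setTI; exact: mX.
have mfX : measurable_fun (X @^-1` J) (f \o X).
  apply: (measurable_comp mJ) => //; first by move=> _ [w Jw <-].
  exact: measurable_funTS.
rewrite [LHS]ge0_integral_pushforward//; last by move=> x /[!inE]; exact: f0.
rewrite (@ge0_negligible_integral _ _ _ (mrestr m mD) (X @^-1` J) (~` D))//.
- rewrite setDE setCK setIC; apply: eq_measure_integral => A mA AD.
  by rewrite /= /mrestr setIidl// => w /AD[].
- exact: measurableC.
- by move=> w; exact: f0.
- by rewrite /= /mrestr setICl measure0.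
Qed.

(** The measure with density [q], as the law of the abscissa of a point spread
    uniformly under the graph of [q]. *)
Definition undergraph (q : R -> R) : set (RR * RR) := [set z | 0 <= z.2 < q z.1].

Lemma measurable_undergraph (q : RR -> R) : measurable_fun setT q ->
  measurable (undergraph q).
Proof.
move=> mq.
have m1 : measurable_fun setT (fun z : RR * RR => q z.1).
  exact: (measurableT_comp mq measurable_fst).
have m2 : measurable_fun setT (fun z : RR * RR => z.2 : R).
  exact: measurable_snd.
have h1 : measurable (setT `&` (fun z : RR * RR => (0 : R) <= z.2) @^-1` [set true]).
  exact: (measurable_fun_ler (measurable_cst (0 : R)) m2).
have h2 : measurable (setT `&` (fun z : RR * RR => z.2 < q z.1) @^-1` [set true]).
  exact: (measurable_fun_ltr m2 m1).
have := measurableI _ _ h1 h2.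
congr measurable; apply/seteqP; split=> z; rewrite /undergraph/=.
  by move=> [[_ ->] [_ ->]].
by move=> /andP[-> ->].
Qed.

Definition density_measure (q : RR -> R) (mq : measurable_fun setT q) :
    {measure set RR -> \bar R} :=
  law (mu \x mu)%E (measurable_undergraph mq) measurable_fst.

(** Tonelli on the region under the graph. *)
Lemma ge0_integral_density (q : RR -> R) (mq : measurable_fun setT q)
    (J : set RR) (g : RR -> R) :
  (forall x, 0 <= q x) ->
  measurable J -> measurable_fun setT g -> (forall x, J x -> 0 <= g x) ->
  (\int[density_measure mq]_(x in J) (g x)%:E =
   \int[mu]_(x in J) (g x * q x)%:E)%E.
Proof.
move=> q0 mJ mg g0.
rewrite ge0_integral_law//; last first.
  by apply/measurable_EFinP; exact: measurable_funTS.
have mU := measurable_undergraph mq.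
have mUJ : measurable (undergraph q `&` fst @^-1` J).
  by apply: measurableI => //; rewrite -[X in measurable X]setTI; exact: measurable_fst.
pose f (z : RR * RR) := (\1_(undergraph q `&` fst @^-1` J) z * g z.1)%:E.
have f0 z : (0 <= f z)%E.
  rewrite lee_fin indicE; case: (boolP (_ \in _)) => [|_]; last by rewrite mul0r.
  by rewrite inE => -[_ Jz]; rewrite mul1r g0.
have mf : measurable_fun setT f.
  apply/measurable_EFinP; apply: measurable_funM; first exact: measurable_indic.
  exact: (measurableT_comp mg measurable_fst).
transitivity (\int[(mu \x mu)%E]_z f z)%E.
  rewrite [LHS]integral_mkcond; apply: eq_integral => z _.
  by rewrite patchE /f indicE; case: ifPn => _; rewrite ?mul1r ?mul0r.
rewrite fubini_tonelli1// [RHS]integral_mkcond; apply: eq_integral => x _.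
rewrite patchE; case: ifPn => [|xJ]; last first.
  rewrite /fubini_F integral0_eq// => y _.
  rewrite /f indicE memNset ?mul0r// => -[_ /=].
  by rewrite notin_setE in xJ.
rewrite inE => Jx; rewrite /fubini_F.
transitivity (\int[mu]_y ((g x)%:E * (\1_(`[0, q x[ : set R) y)%:E))%E.
  apply: eq_integral => y _; rewrite /f !indicE mulrC EFinM/=.
  congr (_ * (nat_of_bool _)%:R%:E)%E.
  apply/idP/idP; rewrite !inE/= in_itv/=; first by move=> [].
  by move=> h; split.
rewrite ge0_integralZl ?lee_fin ?g0//; last first.
  apply/measurable_EFinP; exact: (measurable_indic (measurable_itv _)).
have -> : (\int[mu]_y (\1_(`[0%R, q x[ : set R) y)%:E = mu `[0%R, q x[)%E.
  by rewrite integral_indic ?setIT.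
rewrite lebesgue_measure_itv/= lte_fin.
case: ltP => [_|qx]; first by rewrite -EFinB subr0.
have -> : q x = 0 by apply/eqP; rewrite eq_le qx q0.
by rewrite mule0 mulr0.
Qed.

Lemma density_measureE (q : RR -> R) (mq : measurable_fun setT q) (C : set RR) :
  (forall x, 0 <= q x) -> measurable C ->
  density_measure mq C = (\int[mu]_(x in C) (q x)%:E)%E.
Proof.
move=> q0 mC; transitivity (\int[density_measure mq]_(x in C) (1 : R)%:E)%E.
  by rewrite integral_cst// mul1e.
rewrite (@ge0_integral_density q mq C (cst 1))//.
by under eq_integral do rewrite mul1r.
Qed.

(** Uniqueness of Lebesgue measure, checked on half-open intervals. *)
Lemma lebesgue_measure_affine (k c : R) (A : set RR) : k != 0 -> measurable A ->
  mu A = (`|k|%:E * mu ((fun u : RR => (k * u + c)%R : RR) @^-1` A))%E.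
Proof.
move=> k0 mA.
have maff : measurable_fun setT (fun u : RR => (k * u + c)%R : RR).
  by apply: measurable_funD => //; apply: measurable_funM => //; exact: measurable_cst.
pose m : {measure set RR -> \bar R} :=
  mscale (NngNum (normr_ge0 k)) (law mu measurableT maff).
have mE (B : set RR) : m B = (`|k|%:E * mu ((fun u : RR => (k * u + c)%R : RR) @^-1` B))%E.
  by rewrite -[X in mu X]setIT.
rewrite (@lebesgue_measure_unique _ m)// => _ [[x y] _ <-]/=.
rewrite mE.
have [k_gt0|k_lt0] := ltP 0 k.
  have -> : (fun u : RR => (k * u + c)%R : RR) @^-1` `]x, y] =
      `](x - c) / k, (y - c) / k]%classic.
    apply/seteqP; split=> u /=; rewrite !in_itv/=.
      by rewrite -ltrBlDr -lerBrDr ltr_pdivrMr// ler_pdivlMr// !(mulrC u).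
    by rewrite -ltrBlDr -lerBrDr ltr_pdivrMr// ler_pdivlMr// !(mulrC u).
  rewrite !lebesgue_measure_itv/= !lte_fin ltr_pM2r ?invr_gt0// ltrD2r.
  case: ifP => xy; last by rewrite mule0.
  rewrite -!EFinB -EFinM gtr0_norm//; congr (_%:E); by field.
have {}k_lt0 : k < 0 by rewrite lt_neqAle k0.
have -> : (fun u : RR => (k * u + c)%R : RR) @^-1` `]x, y] =
    `[(y - c) / k, (x - c) / k[%classic.
  apply/seteqP; split=> u /=; rewrite !in_itv/=.
    by rewrite -ltrBlDr -lerBrDr ltr_ndivlMr// ler_ndivrMr// !(mulrC u) andbC.
  by rewrite -ltrBlDr -lerBrDr ltr_ndivlMr// ler_ndivrMr// !(mulrC u) andbC.
rewrite !lebesgue_measure_itv/= !lte_fin ltr_nM2r ?invr_lt0// ltrD2r.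
case: ifP => xy; last by rewrite mule0.
rewrite -!EFinB -EFinM ltr0_norm//; congr (_%:E); by field.
Qed.

Lemma ge0_integral_affine (k c : R) (A : set RR) (f : RR -> \bar R) :
  k != 0 -> measurable A -> measurable_fun setT f -> (forall x, 0 <= f x)%E ->
  (\int[mu]_(x in A) f x =
   `|k|%:E * \int[mu]_(u in (fun u : RR => (k * u + c)%R : RR) @^-1` A) f (k * u + c)%R)%E.
Proof.
move=> k0 mA mf f0.
have maff : measurable_fun setT (fun u : RR => (k * u + c)%R : RR).
  by apply: measurable_funD => //; apply: measurable_funM => //; exact: measurable_cst.
pose m : {measure set RR -> \bar R} :=
  mscale (NngNum (normr_ge0 k)) (law mu measurableT maff).
rewrite (eq_measure_integral m) => [|B mB _]; last first.
  apply: etrans (lebesgue_measure_affine c k0 mB) _.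
  by rewrite -[X in mu X]setIT.
rewrite ge0_integral_mscale//; last exact: measurable_funTS.
rewrite ge0_integral_law//; last exact: measurable_funTS.
by rewrite setTI.
Qed.

(** Euler's beta integral, rescaled from [[0, 1]] to [[0, t]]. *)
Lemma integral_beta (t : R) a b : 0 < t ->
  (\int[mu]_(x in `]0%R, t[) (monomial a x * monomial b (t - x))%:E =
   (monomial (a + b).+1 t)%:E)%E.
Proof.
move=> t0.
have m1 (n : nat) := @measurable_monomial R n.
have mI : measurable_fun setT (\1_(`[0, t]%classic : set RR) : RR -> R).
  by apply: measurable_indic; exact: measurable_itv.
pose f (x : RR) : \bar R :=
  ((\1_(`[0, t]%classic : set RR) x) * (monomial a x * monomial b (t - x)))%:E.
have mfr : measurable_fun setT (fun x : RR => monomial a x * monomial b (t - x) : R).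
  apply: measurable_funM => //; apply: (measurableT_comp (m1 b)).
  by apply: measurable_funB => //; exact: measurable_cst.
have mf : measurable_fun setT f.
  apply/measurable_EFinP; exact: measurable_funM.
have f0 x : (0 <= f x)%E.
  rewrite lee_fin indicE; case: (boolP (_ \in _)) => [|_]; last by rewrite mul0r.
  rewrite inE/= in_itv/= => /andP[x0 xt].
  by rewrite mul1r !mulr_ge0 ?invr_ge0 ?exprn_ge0 ?subr_ge0.
transitivity (\int[mu]_(x in setT) f x)%E.
  rewrite integral_itv_obnd_cbnd; last by apply: measurable_funTS; apply/measurable_EFinP.
  rewrite integral_itv_bndo_bndc; last by apply: measurable_funTS; apply/measurable_EFinP.
  rewrite [LHS]integral_mkcond; apply: eq_integral => x _.
  by rewrite patchE /f indicE; case: ifPn => _; rewrite ?mul1r ?mul0r.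
rewrite (@ge0_integral_affine t 0 setT f)// ?gt_eqF// preimage_setT.
pose g (u : RR) : R := ((@XMonemX R a b) \_ `[0, 1]) u.
have g0 u : 0 <= g u.
  rewrite /g patchE; case: ifPn => //; rewrite inE/= => u01; exact: XMonemX_ge0.
have mg : measurable_fun setT g.
  have := measurable_int _ (@integrable_XMonemX_restrict R a.+1 b.+1).
  by move/measurable_EFinP.
have maff : measurable_fun setT (fun u : RR => (t * u + 0)%R : RR).
  by apply: measurable_funD => //; apply: measurable_funM => //; exact: measurable_cst.
have fa : a`!%:R != 0 :> R by rewrite pnatr_eq0 -lt0n fact_gt0.
have fb : b`!%:R != 0 :> R by rewrite pnatr_eq0 -lt0n fact_gt0.
have fab : (a + b).+1`!%:R != 0 :> R by rewrite pnatr_eq0 -lt0n fact_gt0.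
pose K := t ^+ (a + b).+1 / (a`!%:R * b`!%:R).
have K0 : 0 <= K by rewrite divr_ge0 ?mulr_ge0// exprn_ge0// ltW.
transitivity (\int[mu]_u (K%:E * (g u)%:E))%E.
  rewrite -ge0_integralZl//; last exact: (measurableT_comp mf maff).
  apply: eq_integral => u _; rewrite /f /g patchE addr0 -!EFinM; congr (_%:E).
  have -> : \1_(`[0, t]%classic : set RR) (t * u) = (u \in `[0, 1]%classic)%:R :> R.
    rewrite indicE; congr (nat_of_bool _)%:R; apply/idP/idP; rewrite !inE/= !in_itv/=.
      by rewrite pmulr_rge0// ger_pMr.
    by rewrite pmulr_rge0// ger_pMr.
  case: ifP => _; last by rewrite mul0r !mulr0.
  rewrite mul1r gtr0_norm// /K /monomial.
  rewrite -[XMonemX a b u]/(u ^+ a * (1 - u) ^+ b).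
  have -> : t - t * u = t * (1 - u) by ring.
  rewrite !exprMn exprS exprD.
  by field; rewrite fa fb.
rewrite ge0_integralZl ?lee_fin//; last first.
- by move=> u _; rewrite lee_fin.
- exact/measurable_EFinP.
have := @EFin_beta_fun R a.+1 b.+1; rewrite /= => <-.
rewrite beta_fun_fact -EFinM natrM; congr (_%:E).
by rewrite /K /monomial; field; rewrite fa fb fab.
Qed.

Lemma integral_series (D : set RR) (f : RR -> R) (g : nat -> RR -> R)
    (a : nat -> R) (A : R) :
  measurable D -> (forall n, measurable_fun D (g n)) ->
  (forall n x, D x -> 0 <= g n x) ->
  (forall x, D x -> (\sum_(n < N) g n x) @[N --> \oo] --> f x) ->
  (forall n, \int[mu]_(x in D) (g n x)%:E = (a n)%:E)%E ->
  (\sum_(n < N) a n) @[N --> \oo] --> A ->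
  (\int[mu]_(x in D) (f x)%:E = A%:E)%E.
Proof.
move=> mD mg g0 gf ga aA.
have lim (u : nat -> R) (L : R) : (\sum_(n < N) u n) @[N --> \oo] --> L ->
    (\sum_(0 <= n <oo) (u n)%:E = L%:E)%E.
  move=> uL; apply: cvg_lim => //.
  have -> : (fun N => \sum_(0 <= n < N) (u n)%:E)%E =
      (fun N => (\sum_(n < N) u n)%:E).
    by apply/funext => N; rewrite sumEFin big_mkord.
  by apply: cvg_EFin; [exact: nearW|exact: uL].
transitivity (\int[mu]_(x in D) \sum_(0 <= n <oo) (g n x)%:E)%E.
  by apply: eq_integral => x /[!inE] Dx; rewrite (lim _ _ (gf x Dx)).
rewrite integral_nneseries//.
- under eq_eseriesr do rewrite ga.
  exact: lim.
- by move=> n; exact/measurable_EFinP.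
Qed.

End Density.

(** * Moments of the Bessel densities *)

Section BesselSeries.
Context {R : realType}.
Local Notation RR := (measurableTypeR R).
Local Notation mu := (@lebesgue_measure R).

Let half_double (z : R) : 2 * z / 2 = z.
Proof. by field. Qed.

Let sqrt_even (s : R) n : 0 <= s -> Num.sqrt s ^+ (2 * n) = s ^+ n.
Proof. by move=> s0; rewrite exprM sqr_sqrtr. Qed.

Let fact_inv_le1 n : (n`!%:R : R)^-1 <= 1.
Proof. by rewrite invf_le1 ?ltr0n ?fact_gt0// ler1n fact_gt0. Qed.

(** The argument [2 sqrt s] of the Bessel functions in the densities makes them
    power series in [s]. *)
Lemma cvg_besselI0 (s : R) : 0 <= s ->
  (\sum_(n < N) s ^+ n / n`!%:R ^+ 2) @[N --> \oo] --> besselI0 (2 * Num.sqrt s).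
Proof.
move=> s0; pose u n := s ^+ n / n`!%:R ^+ 2.
have cu : cvgn (series u).
  apply: series_le_cvg (is_cvg_series_exp_coeff s) => [n|n|n].
  - by rewrite divr_ge0 ?exprn_ge0.
  - by rewrite exp_coeff_ge0.
  rewrite /exp_coeff/= /u ler_wpM2l ?exprn_ge0// expr2 invfM.
  by rewrite ger_pMr ?fact_inv_le1 ?invr_gt0 ?ltr0n ?fact_gt0.
have -> : (fun N => \sum_(n < N) s ^+ n / n`!%:R ^+ 2) = series u.
  by apply/funext => N; rewrite /series/= big_mkord.
suff -> : besselI0 (2 * Num.sqrt s) = limn (series u) by exact: cu.
rewrite /besselI0.
have h : (fun N => \sum_(1 <= n < N)
    (2 * Num.sqrt s / 2) ^+ (2 * n) / n`!%:R ^+ 2) @ \oo --> limn (series u) - 1.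
  rewrite -cvg_shiftS.
  have -> : (fun N => \sum_(1 <= n < N.+1)
      (2 * Num.sqrt s / 2) ^+ (2 * n) / n`!%:R ^+ 2) = (fun N => series u N.+1 - 1).
    apply/funext => N; rewrite /series/= [in RHS]big_ltn// /u expr0 fact0 expr1n divr1.
    rewrite addrAC subrr add0r; apply: eq_bigr => n _.
    by rewrite half_double sqrt_even.
  apply: cvgB; last exact: cvg_cst.
  by rewrite cvg_shiftS.
by rewrite (cvg_lim _ h)// addrC subrK.
Qed.

Lemma cvg_besselI1 (s : R) : 0 <= s ->
  (\sum_(n < N) Num.sqrt s * s ^+ n / (n`!%:R * n.+1`!%:R)) @[N --> \oo] -->
  besselI1 (2 * Num.sqrt s).
Proof.
move=> s0; pose u n := Num.sqrt s * s ^+ n / (n`!%:R * n.+1`!%:R).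
have cu : cvgn (series u).
  have cs : cvgn (series (Num.sqrt s *: exp_coeff s)).
    exact: is_cvg_seriesZ (is_cvg_series_exp_coeff s).
  apply: series_le_cvg cs => [n|n|n].
  - by rewrite divr_ge0 ?mulr_ge0 ?exprn_ge0 ?sqrtr_ge0.
  - by rewrite mulr_ge0 ?sqrtr_ge0 ?exp_coeff_ge0.
  rewrite [leRHS]/(_ * (s ^+ n / n`!%:R)) /u -mulrA ler_wpM2l ?sqrtr_ge0//.
  rewrite ler_wpM2l ?exprn_ge0// invfM.
  by rewrite ger_pMr ?fact_inv_le1 ?invr_gt0 ?ltr0n ?fact_gt0.
have -> : (fun N => \sum_(n < N) Num.sqrt s * s ^+ n / (n`!%:R * n.+1`!%:R)) = series u.
  by apply/funext => N; rewrite /series/= big_mkord.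
suff -> : besselI1 (2 * Num.sqrt s) = limn (series u) by exact: cu.
rewrite /besselI1; apply: cvg_lim => //; rewrite -cvg_shiftS.
have -> // : (fun N => \sum_(1 <= n < N.+1)
    (2 * Num.sqrt s / 2) ^+ (2 * n - 1) / (n.-1`!%:R * n`!%:R)) = series u.
apply/funext => N; rewrite /series/= big_add1/=; apply: eq_bigr => n _.
have -> : (2 * n.+1 - 1 = (2 * n).+1)%N by lia.
by rewrite half_double exprS sqrt_even.
Qed.

End BesselSeries.

Section BesselDensities.
Context {R : realType}.
Local Notation RR := (measurableTypeR R).
Local Notation mu := (@lebesgue_measure R).
(* The intensities of the initial and of the other state. *)
Variables (la lb t : R).
Hypotheses (la0 : 0 < la) (lb0 : 0 < lb) (t0 : 0 < t).

(** Density of the time [x] spent in the initial state up to [t], when the state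
    at [t] is the other one, and in [density_same] when it is the initial one. *)
Definition density_other (x : R) : R :=
  la * expR (- la * x - lb * (t - x)) *
  besselI0 (2 * Num.sqrt (la * lb * x * (t - x))) * \1_(`]0, t[ : set R) x.

Definition density_same (x : R) : R :=
  Num.sqrt (la * lb) * Num.sqrt (x / (t - x)) *
  expR (- la * x - lb * (t - x)) *
  besselI1 (2 * Num.sqrt (la * lb * x * (t - x))) * \1_(`]0, t[ : set R) x.

Let c := lb * la.
Let c0 : 0 <= c. Proof. by rewrite mulr_ge0// ltW. Qed.
Let D : set RR := `]0, t[%classic.
Let mD : measurable D. Proof. exact: measurable_itv. Qed.

Let mmonomial n : measurable_fun setT (monomial n : RR -> R).
Proof. exact: measurable_monomial. Qed.

Let measurable_monomialB n : measurable_fun setT (fun x : RR => monomial n (t - x) : R).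
Proof.
apply: (measurableT_comp (mmonomial n)).
by apply: measurable_funB => //; exact: measurable_cst.
Qed.

Let tiltE k (x : R) : expR (lb * t) *
  (expR ((la - lb) * x) * monomial k x * expR (- la * x - lb * (t - x))) = monomial k x.
Proof.
rewrite [_ * monomial k x * _]mulrAC mulrA -expRD -expRD.
by rewrite (_ : lb * t + _ = 0) ?expR0 ?mul1r//; ring.
Qed.

(* A summand, up to the factor [monomial m (t - x)] and a constant. *)
Let term k n (x : R) : R := c ^+ n * 'C(n + k, k)%:R * monomial (n + k) x.

Let termE k n x : term k n x = c ^+ n * (monomial n x * monomial k x).
Proof. by rewrite /term monomialM mulrA. Qed.

Let cvg_density_other k x : D x ->
  (\sum_(n < N) la * (term k n x * monomial n (t - x))) @[N --> \oo] -->
  expR (lb * t) * (expR ((la - lb) * x) * monomial k x * density_other x).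
Proof.
move=> Dx; have := Dx; rewrite /D/= in_itv/= => /andP[x0 xt].
have s0 : 0 <= la * lb * x * (t - x) by rewrite !mulr_ge0 ?subr_ge0// ltW.
have H : (la * monomial k x *
    \sum_(n < N) (la * lb * x * (t - x)) ^+ n / n`!%:R ^+ 2) @[N --> \oo] -->
    la * monomial k x * besselI0 (2 * Num.sqrt (la * lb * x * (t - x))).
  by apply: cvgM; [exact: cvg_cst|exact: cvg_besselI0].
have -> : expR (lb * t) * (expR ((la - lb) * x) * monomial k x * density_other x) =
    la * monomial k x * besselI0 (2 * Num.sqrt (la * lb * x * (t - x))).
  rewrite /density_other indicE mem_set// mulr1.
  by rewrite -[in RHS](tiltE k x); ring.
apply: cvg_trans H; apply: near_eq_cvg; apply: nearW => N /=.
rewrite mulr_sumr; apply: eq_bigr => n _.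
rewrite termE /c; move: (monomial k x) => m; rewrite /monomial !exprMn.
by field; rewrite pnatr_eq0 -lt0n fact_gt0.
Qed.

Let cvg_density_same k x : D x ->
  (\sum_(n < N) term k n.+1 x * monomial n (t - x)) @[N --> \oo] -->
  expR (lb * t) * (expR ((la - lb) * x) * monomial k x * density_same x).
Proof.
move=> Dx; have := Dx; rewrite /D/= in_itv/= => /andP[x0 xt].
have tx0 : 0 < t - x by rewrite subr_gt0.
have s0 : 0 <= la * lb * x * (t - x) by rewrite !mulr_ge0 ?subr_ge0// ltW.
(* The two square roots in front of the Bessel function combine with the one in
   the series of [besselI1]. *)
pose K := Num.sqrt (la * lb) * Num.sqrt (x / (t - x)).
have KE : K * Num.sqrt (la * lb * x * (t - x)) = c * x.
  have y0 : 0 <= la * lb by rewrite mulr_ge0// ltW.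
  have z0 : 0 <= x / (t - x) by rewrite divr_ge0// ltW.
  rewrite /K -sqrtrM// -sqrtrM ?(mulr_ge0 y0 z0)//.
  have -> : la * lb * (x / (t - x)) * (la * lb * x * (t - x)) = (c * x) ^+ 2.
    by rewrite /c; field; rewrite gt_eqF.
  by rewrite sqrtr_sqr ger0_norm// mulr_ge0// ltW.
have H : (K * monomial k x * \sum_(n < N) Num.sqrt (la * lb * x * (t - x)) *
      (la * lb * x * (t - x)) ^+ n / (n`!%:R * n.+1`!%:R)) @[N --> \oo] -->
    K * monomial k x * besselI1 (2 * Num.sqrt (la * lb * x * (t - x))).
  by apply: cvgM; [exact: cvg_cst|exact: cvg_besselI1].
have -> : expR (lb * t) * (expR ((la - lb) * x) * monomial k x * density_same x) =
    K * monomial k x * besselI1 (2 * Num.sqrt (la * lb * x * (t - x))).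
  rewrite /density_same indicE mem_set// mulr1 -/K.
  by rewrite -[in RHS](tiltE k x); ring.
apply: cvg_trans H; apply: near_eq_cvg; apply: nearW => N /=.
rewrite mulr_sumr; apply: eq_bigr => n _.
have -> : K * monomial k x * (Num.sqrt (la * lb * x * (t - x)) *
      (la * lb * x * (t - x)) ^+ n / (n`!%:R * n.+1`!%:R)) =
    (c * x) * monomial k x *
      ((la * lb * x * (t - x)) ^+ n / (n`!%:R * n.+1`!%:R)) by rewrite -KE; ring.
rewrite termE /c; move: (monomial k x) => m; rewrite /monomial !exprMn !exprS.
field.
by rewrite !pnatr_eq0 -!lt0n !fact_gt0.
Qed.

Let measurable_term k n : measurable_fun setT (fun x : RR => term k n x : R).
Proof. by apply: measurable_funM => //; exact: measurable_cst. Qed.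

Let term_ge0 k n m x : D x -> 0 <= term k n x * monomial m (t - x).
Proof.
rewrite /D/= in_itv/= => /andP[x0 xt].
by rewrite !mulr_ge0 ?exprn_ge0 ?monomial_ge0 ?subr_ge0// ltW.
Qed.

(** Both densities inherit measurability and positivity from the partial sums of
    their expansions. *)
Let density_of_series (q : RR -> R) (g : nat -> RR -> R) :
  (forall x, ~ D x -> q x = 0) ->
  (forall n, measurable_fun setT (g n)) -> (forall n x, D x -> 0 <= g n x) ->
  (forall x, D x -> (\sum_(n < N) g n x) @[N --> \oo] -->
     expR (lb * t) * (expR ((la - lb) * x) * monomial 0 x * q x)) ->
  measurable_fun setT q /\ forall x, 0 <= q x.
Proof.
move=> qD mg g0 gq.
pose h N (x : RR) : R :=
  expR (- (lb * t)) * expR ((lb - la) * x) * (\sum_(n < N) g n x) * \1_D x.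
have hq x : h N x @[N --> \oo] --> q x.
  have [Dx|nDx] := pselect (D x); last first.
    rewrite qD//; have -> : h ^~ x = cst 0; last exact: cvg_cst.
    by apply/funext => N; rewrite /h indicE memNset// mulr0.
  have -> : h ^~ x = fun N =>
      expR (- (lb * t)) * expR ((lb - la) * x) * (\sum_(n < N) g n x).
    by apply/funext => N; rewrite /h indicE mem_set// mulr1.
  have -> : q x = expR (- (lb * t)) * expR ((lb - la) * x) *
      (expR (lb * t) * (expR ((la - lb) * x) * monomial 0 x * q x)).
    rewrite /monomial expr0 fact0 divr1 mulr1.
    have -> : (lb - la) * x = - ((la - lb) * x) by ring.
    rewrite !expRN; field.
    by rewrite !gt_eqF ?expR_gt0.
  by apply: cvgM; [exact: cvg_cst|exact: gq].
split.
  apply: (@measurable_fun_cvg _ _ _ _ h) => [N|x _]; last exact: hq.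
  apply: measurable_funM; last exact: measurable_indic.
  apply: measurable_funM; last exact: measurable_sum.
  by apply: measurable_funM; [exact: measurable_cst|exact: measurable_expRM].
move=> x; have [Dx|nDx] := pselect (D x); last by rewrite qD.
apply: (cvgr_to_ge (hq x)); apply: nearW => N.
by rewrite !mulr_ge0 ?expR_ge0// sumr_ge0// => n _; exact: g0.
Qed.

Let density_other_spec :
  measurable_fun setT (density_other : RR -> R) /\ forall x, 0 <= density_other x.
Proof.
apply: (@density_of_series _
  (fun n x => la * (term 0 n x * monomial n (t - x)))) => [x nDx|n|n x Dx|x Dx].
- by rewrite /density_other indicE memNset// mulr0.
- by apply: measurable_funM; [exact: measurable_cst|exact: measurable_funM].
- by rewrite mulr_ge0 ?term_ge0// ltW.
- exact: cvg_density_other.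
Qed.

Let density_same_spec :
  measurable_fun setT (density_same : RR -> R) /\ forall x, 0 <= density_same x.
Proof.
apply: (@density_of_series _
  (fun n x => term 0 n.+1 x * monomial n (t - x))) => [x nDx|n|n x Dx|x Dx].
- by rewrite /density_same indicE memNset// mulr0.
- exact: measurable_funM.
- exact: term_ge0.
- exact: cvg_density_same.
Qed.

Lemma measurable_density_other : measurable_fun setT (density_other : RR -> R).
Proof. by case: density_other_spec. Qed.

Lemma density_other_ge0 x : 0 <= density_other x.
Proof. by case: density_other_spec. Qed.

Lemma measurable_density_same : measurable_fun setT (density_same : RR -> R).
Proof. by case: density_same_spec. Qed.

Lemma density_same_ge0 x : 0 <= density_same x.
Proof. by case: density_same_spec. Qed.

Let integral_term k n m :
  (\int[mu]_(x in D) (term k n x * monomial m (t - x))%:E =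
   (c ^+ n * 'C(n + k, k)%:R * monomial (n + k + m).+1 t)%:E)%E.
Proof.
rewrite (EFinM _ (monomial _ t)) -(@integral_beta _ t (n + k) m t0).
rewrite -ge0_integralZl_EFin//.
- by apply: eq_integral => x _; rewrite /term -mulrA EFinM.
- move=> x /=; rewrite in_itv/= => /andP[x0 xt].
  by rewrite lee_fin mulr_ge0// monomial_ge0// ?subr_ge0 ltW.
- by apply: measurable_funTS; apply/measurable_EFinP; exact: measurable_funM.
- by rewrite mulr_ge0// exprn_ge0.
Qed.

(** The left-hand side is a tilted moment of [density_other]. The exponential
    factors cancel ([tiltE]), and what remains is a power series in [x (t - x)]
    times a monomial. *)
Lemma moment_density_other k (L : R) :
  (\sum_(n < N) la * (c ^+ n * 'C(n + k, k)%:R) * monomial (n.*2 + k).+1 t)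
    @[N --> \oo] --> L ->
  (\int[mu]_(x in D) (expR (lb * t) *
     (expR ((la - lb) * x) * monomial k x * density_other x))%:E = L%:E)%E.
Proof.
move=> cL; apply: (@integral_series _ D _
  (fun n x => la * (term k n x * monomial n (t - x)))
  (fun n => la * (c ^+ n * 'C(n + k, k)%:R) * monomial (n.*2 + k).+1 t)) => //.
- move=> n; apply: measurable_funM; first exact: measurable_cst.
  by apply: measurable_funTS; exact: measurable_funM.
- by move=> n x Dx; rewrite mulr_ge0 ?term_ge0// ltW.
- by move=> x Dx; exact: cvg_density_other.
- move=> n; transitivity (la%:E * \int[mu]_(x in D) (term k n x * monomial n (t - x))%:E)%E.
    rewrite -ge0_integralZl_EFin//; last exact: ltW.
    + by move=> x Dx; rewrite lee_fin term_ge0.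
    + by apply/measurable_EFinP; apply: measurable_funTS; exact: measurable_funM.
  rewrite integral_term -EFinM; congr EFin.
  rewrite -[RHS]mulrA; congr (_ * (_ * monomial _ _)).
  by rewrite -addnn; lia.
Qed.

(** The expansion of [density_same] starts with two switches, hence the difference
    with the full series. *)
Lemma moment_density_same k (L : R) :
  (\sum_(n < N) c ^+ n * 'C(n + k, k)%:R * monomial (n.*2 + k) t)
    @[N --> \oo] --> L ->
  (\int[mu]_(x in D) (expR (lb * t) *
     (expR ((la - lb) * x) * monomial k x * density_same x))%:E =
   (L - monomial k t)%:E)%E.
Proof.
move=> cL; apply: (@integral_series _ D _
  (fun n x => term k n.+1 x * monomial n (t - x))
  (fun n => c ^+ n.+1 * 'C(n.+1 + k, k)%:R * monomial (n.+1.*2 + k) t)) => //.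
- by move=> n; apply: measurable_funTS; exact: measurable_funM.
- by move=> n x Dx; rewrite term_ge0.
- by move=> x Dx; exact: cvg_density_same.
- move=> n; rewrite integral_term; congr (_ * monomial _ _)%:E.
  by rewrite -addnn; lia.
- have -> : (fun N => \sum_(n < N) c ^+ n.+1 * 'C(n.+1 + k, k)%:R * monomial (n.+1.*2 + k) t) =
    (fun N => \sum_(n < N.+1) c ^+ n * 'C(n + k, k)%:R * monomial (n.*2 + k) t - monomial k t).
    apply/funext => N; rewrite big_ord_recl/= expr0 mul1r double0 add0n binn mul1r.
    by rewrite addrAC subrr add0r.
  by apply: cvgB; [move: cL; rewrite -cvg_shiftS|exact: cvg_cst].
Qed.

End BesselDensities.

(** * The law of the sojourn time *)

Section SojournLaw.
Context {d : measure_display} {Omega : measurableType d} {R : realType}.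
Variables (P : probability Omega R) (eps : R -> Omega -> bool) (lam : bool -> R).
Hypothesis meps : measurable_process eps.
Variables (b : bool) (t : R).
Hypothesis t0 : 0 < t.
Local Notation RR := (measurableTypeR R).
Local Notation mu := (@lebesgue_measure R).
Local Notation X := (sojourn eps b).
Local Notation start := (at_state eps 0 b).
Local Notation tilt := (tilt lam b).
Local Notation pi := (fine (P start)).

Let J : set RR := `[0, t]%classic.
Let D : set RR := `]0, t[%classic.
Let mJ : measurable J. Proof. exact: measurable_itv. Qed.
Let mD : measurable D. Proof. exact: measurable_itv. Qed.
Let DJ : D `<=` J.
Proof. by move=> x; rewrite /D /J/= !in_itv/= => /andP[/ltW -> /ltW ->]. Qed.

Let tilt_J k x : J x -> 0 <= tilt k x.
Proof. by rewrite /J/= in_itv/= => /andP[x0 _]; exact: tilt_ge0. Qed.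

Let moment_tilt (m : {measure set RR -> \bar R}) k : (m setT < +oo)%E ->
  \int[m]_(x in J) (expR ((lam b - lam (~~ b)) * x) * x ^+ k) =
  k`!%:R * \int[m]_(x in J) tilt k x.
Proof.
move=> moo; rewrite -RintegralZl//; last first.
  apply: (@bounded_integrable _ _ _ _ _ _
    (expR (`|lam b - lam (~~ b)| * t) * expR t)) => //.
  - by apply: le_lt_trans moo; rewrite le_measure ?inE.
  - by apply: measurable_funTS; exact: measurable_tilt.
  - by move=> x Jx; apply: tilt_bound; move: Jx; rewrite /J/= in_itv.
apply: eq_Rintegral => x _; rewrite /tilt /monomial; field.
by rewrite pnatr_eq0 -lt0n fact_gt0.
Qed.

Let integral_support (q g : RR -> R) : (forall x, ~ D x -> q x = 0) ->
  (\int[mu]_(x in J) (g x * q x)%:E = \int[mu]_(x in D) (g x * q x)%:E)%E.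
Proof.
move=> qD; rewrite integral_mkcond [RHS]integral_mkcond; apply: eq_integral => x _.
rewrite !patchE; have [xD|xD] := boolP (x \in D).
  by rewrite inE in xD; rewrite mem_set//; exact: DJ.
by rewrite notin_setE in xD; rewrite (qD _ xD) mulr0 if_same.
Qed.

(** A candidate with an atom at [t], for the paths that never leave the initial
    state, and a density [q] is identified by its tilted moments. *)
Lemma sojourn_law (j : bool) (a : {nonneg R}) (q : RR -> R) :
  0 < pi -> measurable_fun setT q -> (forall x, 0 <= q x) ->
  (forall x, ~ D x -> q x = 0) ->
  (forall k, pi%:E * ((a%:num * tilt k t)%:E + \int[mu]_(x in D) (tilt k x * q x)%:E) =
    (expect_at P eps b (tilt k) j t)%:E)%E ->
  forall C : set RR, measurable C ->
  P (X t @^-1` C `&` (start `&` at_state eps t j)) =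
  (pi%:E * (a%:num%:E * \d_t C + \int[mu]_(x in C) (q x)%:E))%E.
Proof.
move=> pi0 mq q0 qD moments C mC.
have mE : measurable (start `&` at_state eps t j).
  by apply: measurableI; apply: measurable_at_state => //; exact: ltW.
have mX : measurable_fun setT (X t : Omega -> RR) by exact: measurable_sojourn.
have XJ w : J (X t w).
  by have := sojourn_bounds meps b w (ltW t0); rewrite /J/= in_itv.
pose m1 := law P mE mX.
pose mq' := density_measure mq.
pose m2 : {measure set RR -> \bar R} :=
  mscale (NngNum (ltW pi0)) (measure_add (mscale a (dirac (t : RR))) mq').
have m2E (B : set RR) : measurable B -> m2 B =
    (pi%:E * (a%:num%:E * \d_t B + \int[mu]_(x in B) (q x)%:E))%E.
  move=> mB; rewrite -(density_measureE mq)//.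
  rewrite -[LHS]/(pi%:E * measure_add (mscale a (dirac (t : RR))) mq' B)%E.
  by rewrite measure_addE.
have Eoo : (P (start `&` at_state eps t j) < +oo)%E.
  exact: le_lt_trans (probability_le1 _ mE) (ltry _).
have qoo : (\int[mu]_(x in D) (tilt 0 x * q x)%:E < +oo)%E.
  have := moments 0; case: (\int[mu]_(x in D) _)%E => [r|//|//] /=.
    by rewrite ltry.
  by rewrite addey// gt0_muley// lte_fin.
(* Finiteness of the candidate also comes from its moment of index 0, since the
   tilt is bounded below. *)
have q_lty : (\int[mu]_x (q x)%:E < +oo)%E.
  have -> : (\int[mu]_x (q x)%:E = \int[mu]_(x in D) (q x)%:E)%E.
    rewrite [RHS]integral_mkcond; apply: eq_integral => x _; rewrite patchE.
    by case: ifPn => // xD; rewrite notin_setE in xD; rewrite qD.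
  pose K := expR (`|lam b - lam (~~ b)| * t).
  have K_tilt x : D x -> q x <= K * (tilt 0 x * q x).
    move=> /DJ; rewrite /J/= in_itv/= => /andP[x0 xt].
    rewrite mulrA ler_peMl// /tilt /monomial expr0 fact0 divr1 mulr1 -expRD.
    rewrite -expR0 ler_expR -lerBlDr sub0r (le_trans (ler_norm _))// normrN normrM.
    by rewrite (ger0_norm x0) ler_wpM2l.
  have mtq : measurable_fun D (fun x : RR => (tilt 0 x * q x)%:E).
    apply/measurable_EFinP; apply: measurable_funTS; apply: measurable_funM => //.
    exact: measurable_tilt.
  have tq0 x : D x -> (0 <= (tilt 0 x * q x)%:E)%E.
    by move=> /DJ Jx; rewrite lee_fin mulr_ge0// tilt_J.
  apply: (@le_lt_trans _ _ (K%:E * \int[mu]_(x in D) (tilt 0 x * q x)%:E)%E).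
    rewrite -ge0_integralZl_EFin//; last exact: expR_ge0.
    apply: ge0_le_integral => //.
    - by move=> x Dx; rewrite lee_fin.
    - by apply/measurable_EFinP; exact: measurable_funTS.
    - by apply: emeasurable_funM => //; exact: measurable_cst.
  by rewrite lte_mul_pinfty// lee_fin expR_ge0.
have m2oo : (m2 setT < +oo)%E.
  rewrite m2E// lte_mul_pinfty ?lee_fin ?(ltW pi0)//.
  by rewrite lte_add_pinfty// diracE mem_set// mule1 ltry.
rewrite -m2E// -[LHS]/(m1 C).
apply: (@eq_measure_of_moments _ t (lam b - lam (~~ b))) => //.
- exact: ltW.
- exact: law_lty.
- rewrite /m1 lawE (_ : _ `&` _ = set0) ?measure0//.
  by apply/seteqP; split=> // w [/= /(_ (XJ w))].
- rewrite m2E; last exact: measurableC.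
  rewrite integral0_eq => [|x /= Jx]; last by rewrite qD// => /DJ.
  by rewrite diracE memNset ?mule0 ?adde0 ?mule0//= in_itv/= lexx ltW//= => /(_ isT).
move=> k; rewrite !moment_tilt//; last exact: law_lty.
congr (_ * _).
transitivity (expect_at P eps b (tilt k) j t).
  apply: (@Rintegral_law _ _ _ _ _ mE _ mX Eoo _ _
    (expR (`|lam b - lam (~~ b)| * t) * expR t)) => //.
  - exact: measurable_tilt.
  - by move=> x Jx; apply: tilt_bound; move: Jx; rewrite /J/= in_itv.
have mtilt : measurable_fun J (EFin \o (tilt k : RR -> R)).
  by apply/measurable_EFinP; apply: measurable_funTS; exact: measurable_tilt.
rewrite -[LHS]/(fine (_)%:E) -moments; congr fine.
rewrite ge0_integral_mscale//; last by move=> x Jx; rewrite lee_fin tilt_J.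
rewrite ge0_integral_measure_add//; last by move=> x Jx; rewrite lee_fin tilt_J.
rewrite ge0_integral_mscale//; last by move=> x Jx; rewrite lee_fin tilt_J.
rewrite integral_dirac// diracE mem_set ?mul1e; last first.
  by rewrite /J/= in_itv/= lexx ltW.
rewrite ge0_integral_density//; last 2 first.
- exact: measurable_tilt.
- exact: tilt_J.
by rewrite integral_support// EFinM.
Qed.

End SojournLaw.

Section MarkovSojournLaw.
Context {d : measure_display} {Omega : measurableType d} {R : realType}.
Variables (P : probability Omega R) (eps : R -> Omega -> bool) (lam : bool -> R).
Hypothesis meps : measurable_process eps.
Hypothesis lam_gt0 : forall i, 0 < lam i.
Variable p : bool -> bool -> R -> R.
Hypothesis ptrans : transition P eps lam p.
Variables (b : bool) (t : R).
Hypothesis t0 : 0 < t.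
Hypothesis start_gt0 : 0 < fine (P (at_state eps 0 b)).
Local Notation RR := (measurableTypeR R).
Local Notation mu := (@lebesgue_measure R).
Local Notation X := (sojourn eps b).
Local Notation start := (at_state eps 0 b).
Local Notation pi := (fine (P start)).

Let e := expR (lam (~~ b) * t).
Let e_gt0 : 0 < e. Proof. exact: expR_gt0. Qed.

Let cvg_divpi (u : nat -> R) (L : R) :
  pi * u N @[N --> \oo] --> e * L -> u @ \oo --> e * (L / pi).
Proof.
move=> uL.
have H : pi^-1 * (pi * u N) @[N --> \oo] --> pi^-1 * (e * L).
  by apply: cvgM => //; exact: cvg_cst.
have -> : e * (L / pi) = pi^-1 * (e * L) by ring.
by apply: cvg_trans H; apply: near_eq_cvg; apply: nearW => N /=; rewrite mulKf// gt_eqF.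
Qed.

Let integral_unscale (q : RR -> R) k (L : R) :
  measurable_fun setT q -> (forall x, 0 <= q x) ->
  (\int[mu]_(x in `]0%R, t[) (e * (tilt lam b k x * q x))%:E = L%:E)%E ->
  (\int[mu]_(x in `]0%R, t[) (tilt lam b k x * q x)%:E = (L / e)%:E)%E.
Proof.
move=> mq q0 eL.
have : (e%:E * \int[mu]_(x in `]0%R, t[) (tilt lam b k x * q x)%:E = L%:E)%E.
  rewrite -ge0_integralZl_EFin ?(ltW e_gt0)//.
  - move=> x /=; rewrite in_itv/= => /andP[x0 _].
    by rewrite lee_fin mulr_ge0 ?tilt_ge0// ltW.
  - apply/measurable_EFinP; apply: measurable_funTS; apply: measurable_funM => //.
    exact: measurable_tilt.
move=> h; rewrite [L / e]mulrC EFinM -h muleA -EFinM mulVf ?gt_eqF// mul1e//.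
Qed.

Lemma sojourn_law_same (C : set RR) : measurable C ->
  P (X t @^-1` C `&` (start `&` at_state eps t b)) =
  (pi%:E * ((expR (- lam b * t))%:E * \d_t C +
    \int[mu]_(x in C) (density_same (lam b) (lam (~~ b)) t x)%:E))%E.
Proof.
have mq := measurable_density_same t (lam_gt0 b) (lam_gt0 (~~ b)).
have q0 := @density_same_ge0 R (lam b) (lam (~~ b)) t (lam_gt0 b) (lam_gt0 (~~ b)).
apply: (@sojourn_law _ _ _ _ _ lam meps b t t0 b (NngNum (expR_ge0 (- lam b * t)))) => //.
  by move=> x xD; rewrite /density_same indicE memNset// mulr0.
move=> k.
have cm := @cvg_moment_same _ _ _ _ _ _ meps lam_gt0 _ ptrans b k _ (ltW t0).
have := moment_density_same (lam_gt0 b) (lam_gt0 (~~ b)) t0 (cvg_divpi cm).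
move=> /(integral_unscale mq q0) ->; rewrite -EFinD -EFinM/=; congr EFin.
(* The atom is the term [n = 0] of the series. *)
have -> : expR (- lam b * t) * tilt lam b k t = monomial k t / e.
  rewrite /tilt /e mulrA -expRD -expRN mulrC; congr (_ * expR _); ring.
by field; rewrite !gt_eqF.
Qed.

Lemma sojourn_law_other (C : set RR) : measurable C ->
  P (X t @^-1` C `&` (start `&` at_state eps t (~~ b))) =
  (pi%:E * (0%:E * \d_t C +
    \int[mu]_(x in C) (density_other (lam b) (lam (~~ b)) t x)%:E))%E.
Proof.
have mq := measurable_density_other t (lam_gt0 b) (lam_gt0 (~~ b)).
have q0 := @density_other_ge0 R (lam b) (lam (~~ b)) t (lam_gt0 b) (lam_gt0 (~~ b)).
apply: (@sojourn_law _ _ _ _ _ lam meps b t t0 (~~ b) 0%:nng) => //.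
  by move=> x xD; rewrite /density_other indicE memNset// mulr0.
move=> k.
have cm := @cvg_moment_other _ _ _ _ _ _ meps lam_gt0 _ ptrans b k _ (ltW t0).
have := moment_density_other (lam_gt0 b) (lam_gt0 (~~ b)) t0 (cvg_divpi cm).
move=> /(integral_unscale mq q0) ->; rewrite -EFinD -EFinM/=; congr EFin.
by field; rewrite !gt_eqF.
Qed.

End MarkovSojournLaw.

(** * The telegraph process as a function of the sojourn time *)

Section Velocities.
Context {d : measure_display} {Omega : measurableType d} {R : realType}.
Variables (P : probability Omega R) (eps : R -> Omega -> bool) (a0 a1 : R).
Hypothesis meps : measurable_process eps.
Hypothesis a01 : a1 != a0.
Variables (b : bool) (t : R).
Hypothesis t0 : 0 < t.
Local Notation RR := (measurableTypeR R).
Local Notation mu := (@lebesgue_measure R).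

Let vel (i : bool) : R := if i then a1 else a0.
Let slope := vel b - vel (~~ b).

Let slope_neq0 : slope != 0.
Proof. by rewrite /slope /vel; case: b; rewrite /= subr_eq0// eq_sym. Qed.

(** The velocity takes only two values, so it is an affine function of the
    indicator of state [b]. *)
Lemma telegraph_affine w :
  telegraph a0 a1 eps t w = slope * sojourn eps b t w + vel (~~ b) * t.
Proof.
have mI : measurable (`[0, t]%classic : set RR) by exact: measurable_itv.
have muI : (mu `[0%R, t]%classic = t%:E)%E.
  by rewrite lebesgue_measure_itv/= lte_fin t0 -EFinB subr0.
have Ioo : (mu `[0%R, t]%classic < +oo)%E by rewrite muI ltry.
have I0 u : `[0, t]%classic u -> 0 <= u by rewrite /= in_itv/= => /andP[].
have int := integrable_indicator_state meps w b mI Ioo I0.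
transitivity (\int[mu]_(s in `[0, t]) (slope * (eps s w == b)%:R + vel (~~ b))).
  apply: eq_Rintegral => s _; rewrite /slope /vel.
  by case: (eps s w); case: b => /=; ring.
rewrite RintegralD//; last 2 first.
- have := integrableZl mI slope int; apply: eq_integrable => // x _.
- by apply: (@bounded_integrable _ _ _ _ _ _ `|vel (~~ b)|).
rewrite RintegralZl//; congr (_ + _).
rewrite Rintegral_cst//; congr (_ * _); exact: (congr1 fine muI).
Qed.

(** [qB] is the density of the image of [q dx] by the affine map of
    [telegraph_affine]. *)
Lemma joint_law_of_sojourn (j : bool) (alpha : R) (q qB : RR -> R) (B : set RR) :
  (0 < P (at_state eps 0 b))%E -> measurable B ->
  measurable_fun setT q -> (forall x, 0 <= q x) ->
  (forall x, qB x = q ((x - vel (~~ b) * t) / slope) / `|slope|) ->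
  (forall C : set RR, measurable C ->
    P (sojourn eps b t @^-1` C `&` (at_state eps 0 b `&` at_state eps t j)) =
    ((fine (P (at_state eps 0 b)))%:E *
     (alpha%:E * \d_t C + \int[mu]_(x in C) (q x)%:E))%E) ->
  (joint_law P a0 a1 eps t b j B)%:E =
    (alpha%:E * \d_(vel b * t)%R B + \int[mu]_(x in B) (qB x)%:E)%E.
Proof.
move=> Pstart mB mq q0 qBE lawX.
have mst : measurable (at_state eps 0 b) by exact: measurable_at_state.
have mE : measurable (at_state eps 0 b `&` at_state eps t j).
  by apply: measurableI => //; apply: measurable_at_state => //; exact: ltW.
have pi0 : 0 < fine (P (at_state eps 0 b)).
  by rewrite -lte_fin fineK// fin_num_measure.
pose aff (u : RR) : RR := slope * u + vel (~~ b) * t.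
have maff : measurable_fun setT aff.
  by apply: measurable_funD => //; apply: measurable_funM => //; exact: measurable_cst.
pose C := aff @^-1` B.
have mC : measurable C by rewrite -[C]setTI; exact: maff.
have -> : (\int[mu]_(x in B) (qB x)%:E = \int[mu]_(u in C) (q u)%:E)%E.
  have qB0 x : 0 <= qB x by rewrite qBE divr_ge0.
  have mqB : measurable_fun setT (qB : RR -> R).
    have -> : qB = fun x => q ((x - vel (~~ b) * t) / slope) / `|slope|.
      by apply/funext.
    apply: measurable_funM; last exact: measurable_cst.
    apply: (measurableT_comp mq); apply: measurable_funM; last exact: measurable_cst.
    by apply: measurable_funB => //; exact: measurable_cst.
  rewrite (@ge0_integral_affine _ slope (vel (~~ b) * t))//; last exact/measurable_EFinP.
  have mqa : measurable_fun C (fun u : RR => (qB (aff u))%:E).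
    apply/measurable_EFinP; apply: measurable_funTS; exact: (measurableT_comp mqB maff).
  rewrite -(ge0_integralZl_EFin _ mC _ mqa)//; last by move=> u _; rewrite lee_fin.
  apply: eq_integral => u _; rewrite -EFinM qBE addrK mulrAC divff// mul1r.
  by rewrite mulrC divfK// normr_eq0.
have -> : \d_(vel b * t)%R B = \d_(t : RR) C :> \bar R.
  rewrite !diracE; congr (nat_of_bool _)%:R%:E; apply/idP/idP; rewrite !inE /C/aff/=.
    by rewrite -mulrDl subrK.
  by rewrite -mulrDl subrK.
have PC : (P (telegraph a0 a1 eps t @^-1` B `&` at_state eps t j `&` at_state eps 0 b) =
    P (sojourn eps b t @^-1` C `&` (at_state eps 0 b `&` at_state eps t j)))%E.
  congr (P _); rewrite -setIA [at_state eps t j `&` _]setIC; congr (_ `&` _).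
  by apply/seteqP; split=> w; rewrite /C/aff/= telegraph_affine.
rewrite /joint_law /cond_prob PC lawX//.
set M := (_ + _)%E.
have : ((fine (P (at_state eps 0 b)))%:E * M)%E \is a fin_num.
  rewrite -lawX// fin_num_measure//; apply: measurableI => //.
  by rewrite -[_ @^-1` _]setTI; exact: measurable_sojourn.
case: M => [r|/=|/=] /=; first by rewrite -EFinM/= mulrAC divff ?gt_eqF// mul1r.
  by rewrite gt0_muley// lte_fin.
by rewrite gt0_muleNy// lte_fin.
Qed.

End Velocities.

Theorem theoremA1 (d : measure_display) (Omega : measurableType d)
    (R : realType) (P : probability Omega R) (eps : R -> Omega -> bool)
    (lam0 lam1 a0 a1 : R) :
  0 < lam0 -> 0 < lam1 -> a1 < a0 ->
  measurable_process eps -> markov_property P eps -> time_homogeneous P eps ->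
  switching_intensity P eps false lam0 ->
  switching_intensity P eps true lam1 ->
  forall t : R, 0 < t ->
  let xi := fun x : R => (x - a1 * t) / (a0 - a1) in
  let E := fun x : R => expR (- lam0 * xi x - lam1 * (t - xi x)) in
  let z := fun x : R => 2 * Num.sqrt (lam0 * lam1 * xi x * (t - xi x)) in
  let ind := fun x : R => \1_(`]0, t[) (xi x) : R in
  let q00 := fun x : R =>
    Num.sqrt (lam0 * lam1) / (a0 - a1) * Num.sqrt (xi x / (t - xi x)) *
    E x * besselI1 (z x) * ind x in
  let q11 := fun x : R =>
    Num.sqrt (lam0 * lam1) / (a0 - a1) * Num.sqrt ((t - xi x) / xi x) *
    E x * besselI1 (z x) * ind x in
  let q01 := fun x : R =>
    lam0 / (a0 - a1) * E x * besselI0 (z x) * ind x in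
  let q10 := fun x : R =>
    lam1 / (a0 - a1) * E x * besselI0 (z x) * ind x in
  forall B : set R, measurable B ->
  ((0 < P (at_state eps 0 false))%E ->
    (joint_law P a0 a1 eps t false false B)%:E =
      ((expR (- lam0 * t))%:E * \d_(a0 * t)%R B +
       \int[lebesgue_measure]_(x in B) (q00 x)%:E)%E /\
    (joint_law P a0 a1 eps t false true B)%:E =
      (\int[lebesgue_measure]_(x in B) (q01 x)%:E)%E) /\
  ((0 < P (at_state eps 0 true))%E ->
    (joint_law P a0 a1 eps t true true B)%:E =
      ((expR (- lam1 * t))%:E * \d_(a1 * t)%R B +
       \int[lebesgue_measure]_(x in B) (q11 x)%:E)%E /\
    (joint_law P a0 a1 eps t true false B)%:E =
      (\int[lebesgue_measure]_(x in B) (q10 x)%:E)%E).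

Proof.
move=> lam0_gt0 lam1_gt0 a10 meps markov homogeneous intens0 intens1 t t0.
move=> xi E z ind q00 q11 q01 q10 B mB.
pose lam (i : bool) := if i then lam1 else lam0.
have lam_gt0 i : 0 < lam i by case: i.
have intensity i : switching_intensity P eps i (lam i) by case: i.
have [p ptrans] := transition_exists meps markov homogeneous intensity lam_gt0.
have a10_neq : a1 != a0 by rewrite lt_eqF.
have da0 : 0 < a0 - a1 by rewrite subr_gt0.
have da_neq : a0 - a1 != 0 by rewrite gt_eqF.
have pi_gt0 b : (0 < P (at_state eps 0 b))%E -> 0 < fine (P (at_state eps 0 b)).
  move=> Pb; rewrite -lte_fin fineK// fin_num_measure//.
  exact: measurable_at_state.
(* The time spent in state 1 is [t - xi]. *)
have xi1 x : (x - a0 * t) / (a1 - a0) = t - xi x.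
  by rewrite /xi; field; rewrite da_neq -(opprB a0) oppr_eq0 da_neq.
have ind1 x : \1_(`]0, t[ : set R) (t - xi x) = ind x.
  rewrite /ind !indicE; congr (nat_of_bool _)%:R.
  by apply/idP/idP; rewrite !inE/= !in_itv/= subr_gt0 gtrBl andbC.
have norm1 : `|a1 - a0| = a0 - a1 by rewrite distrC gtr0_norm.
have arg1 x : lam1 * lam0 * (t - xi x) * (t - (t - xi x)) =
  lam0 * lam1 * xi x * (t - xi x) by ring.
have exp1 x : - lam1 * (t - xi x) - lam0 * (t - (t - xi x)) =
  - lam0 * xi x - lam1 * (t - xi x) by ring.
split=> Pstart; have pi0 := pi_gt0 _ Pstart; split.
- apply: (joint_law_of_sojourn meps a10_neq t0 (q := density_same lam0 lam1 t)) => //.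
  + exact: measurable_density_same.
  + exact: density_same_ge0.
  + move=> x; rewrite /= (gtr0_norm da0) /q00 /density_same -/(xi x) -/(E x) -/(z x) -/(ind x).
    by ring.
  + exact: (sojourn_law_same meps lam_gt0 ptrans t0 pi0).
- rewrite -[RHS]add0e -(mul0e (\d_(a0 * t)%R B)).
  apply: (joint_law_of_sojourn meps a10_neq t0 (q := density_other lam0 lam1 t)) => //.
  + exact: measurable_density_other.
  + exact: density_other_ge0.
  + move=> x; rewrite /= (gtr0_norm da0) /q01 /density_other -/(xi x) -/(E x) -/(z x) -/(ind x).
    by ring.
  + exact: (sojourn_law_other meps lam_gt0 ptrans t0 pi0).
- apply: (joint_law_of_sojourn meps a10_neq t0 (q := density_same lam1 lam0 t)) => //.
  + exact: measurable_density_same.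
  + exact: density_same_ge0.
  + move=> x; rewrite /= xi1 norm1 /q11 /density_same arg1 exp1 ind1 -/(E x) -/(z x).
    by rewrite (_ : t - (t - xi x) = xi x) ?[lam1 * lam0]mulrC; ring.
  + exact: (sojourn_law_same meps lam_gt0 ptrans t0 pi0).
- rewrite -[RHS]add0e -(mul0e (\d_(a1 * t)%R B)).
  apply: (joint_law_of_sojourn meps a10_neq t0 (q := density_other lam1 lam0 t)) => //.
  + exact: measurable_density_other.
  + exact: density_other_ge0.
  + by move=> x; rewrite /= xi1 norm1 /q10 /density_other arg1 exp1 ind1 -/(E x) -/(z x); ring.
  + exact: (sojourn_law_other meps lam_gt0 ptrans t0 pi0).
Qed.
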